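(* Let $G$ be a countable group and let $H<K<G$ be infinite subgroups such that $K=\mathcal{N}_G(H)$ is the normalizer of $H$ in $G$. Then the following two conditions are equivalent: (1) $L(K)=W^*\big(q\mathcal{N}^{(1)}_{L(G)}(L(H))\big)$; (2) the triple $H<K<G$ satisfies condition (SS). Thus, if the triple $H<K<G$ satisfies condition (SS), then $\mathcal{N}_{L(G)}(L(H))''=L(K)$, and, moreover, if $G$ acts by trace-preserving automorphisms on some finite von Neumann algebra $Q$ (with separable predual, equipped with a faithful normal normalized trace), then $$Q\rtimes K=\mathcal{N}_{Q\rtimes G}(Q\rtimes H)''.$$
   Context: $L(G)$ denotes the group von Neumann algebra of $G$; for a subgroup $H$ of $G$, $L(H)$ is identified with the von Neumann subalgebra of $L(G)$ generated by $\lambda_h$, $h\in H$. Likewise $Q\rtimes H\subset Q\rtimes K\subset Q\rtimes G$ are the von Neumann crossed products for the restricted actions. For finite von Neumann algebras $1\in B\subset M$: the normalizer $\mathcal{N}_M(B)$ is the group of unitaries $u\in U(M)$ with $uBu^*=B$, and $\mathcal{N}_M(B)''$ is the von Neumann algebra it generates. The one-sided quasi-normalizer $q\mathcal{N}^{(1)}_M(B)$ is the set of all $x\in M$ for which there is a finite set $\{x_1,\dots,x_n\}\subset M$ with $Bx\subset\sum_{i=1}^n x_iB$; $W^*(q\mathcal{N}^{(1)}_M(B))$ is the von Neumann algebra it generates. Condition (SS) for a triple $H<K<G$ of groups ($G$ countable, $H<K$ infinite subgroups): all orbits of the natural left-translation action of $H$ on $(G\setminus K)/H=\{gH: g\in G\setminus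 K\}$ are infinite. *)

(* Defs.v *)
From HB Require Import structures.
From mathcomp Require Import all_boot all_order all_algebra.
From mathcomp Require Import finmap sesquilinear.
From mathcomp Require Import complex.
From mathcomp Require Import all_classical reals topology normedtype.
From mathcomp Require Import ring lra.
From mathcomp Require Import showcase.summability.

Set Implicit Arguments.
Unset Strict Implicit.
Unset Printing Implicit Defensive.
Import Order.TTheory GRing.Theory Num.Theory.
Import numFieldNormedType.Exports.
Local Open Scope classical_set_scope.
Local Open Scope ring_scope.

Section InnerProductSpace.
Variables (C : numClosedFieldType) (V : lmodType C) (f : {dot V for (@Num.conj C)}).

Lemma dot_CS u v : `|f u v| ^+ 2 <= f u u * f v v.
Proof.
have [->|v0] := eqVneq v 0; first by rewrite !linear0r normr0 expr0n mulr0.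
have vp : 0 < f v v by rewrite dnorm_gt0.
pose a := f u v / f v v.
have aE : (a^* * f u v = `|f u v| ^+ 2 / f v v)%R.
  rewrite /a rmorphM fmorphV/= (CrealP (ger0_real (ltW vp))) normCK.
  by rewrite mulrAC (mulrC (f u v)).
have := dnorm_ge0 f (u - a *: v).
rewrite dnormB dnormZ linearZr_LR/= aE.
have -> : `|a| ^+ 2 * f v v = `|f u v| ^+ 2 / f v v.
  by rewrite /a normf_div (gtr0_norm vp) expr_div_n -mulrA; congr (_ * _);
    rewrite expr2 invfM -mulrA mulVf ?mulr1 ?gt_eqF.
have cr : (`|f u v| ^+ 2 / f v v)^* = `|f u v| ^+ 2 / f v v.
  by apply/CrealP/ger0_real; rewrite divr_ge0 ?exprn_ge0// ltW.
by rewrite cr opprD addrACA addrN addr0 subr_ge0 ler_pdivrMr.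
Qed.

Definition dot_norm u := sqrtC (f u u).

Lemma dot_normK u : dot_norm u ^+ 2 = f u u. Proof. exact: sqrtCK. Qed.
Lemma dot_norm_ge0 u : 0 <= dot_norm u. Proof. exact: sqrt_dnorm_ge0. Qed.

Lemma dot_norm_CS u v : `|f u v| <= dot_norm u * dot_norm v.
Proof.
rewrite -(@ler_pXn2r _ 2)// ?nnegrE ?mulr_ge0 ?dot_norm_ge0//.
by rewrite exprMn !dot_normK dot_CS.
Qed.

Lemma dot_normD u v : dot_norm (u + v) <= dot_norm u + dot_norm v.
Proof.
rewrite -(@ler_pXn2r _ 2)// ?nnegrE ?addr_ge0 ?dot_norm_ge0//.
rewrite dot_normK dnormD sqrrD !dot_normK -addrA -addrA lerD2l addrC lerD2r.
have /le_trans : f u v + (f u v)^* <= `|f u v + (f u v)^* |.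
  by apply: real_ler_norm; apply/CrealP; rewrite rmorphD/= conjCK addrC.
apply; rewrite (le_trans (ler_normD _ _))// norm_conjC -mulr2n.
by rewrite lerMn2r/= dot_norm_CS.
Qed.

Lemma dot_normZ (a : C) u : dot_norm (a *: u) = `|a| * dot_norm u.
Proof.
by rewrite /dot_norm dnormZ rootCMl ?exprn_ge0//; rewrite sqrCK.
Qed.

Lemma dot_norm_eq0 u : dot_norm u = 0 -> u = 0.
Proof. by move/eqP; rewrite sqrt_dnorm_eq0 => /eqP. Qed.

Lemma dot_polar u v : 4 * f u v =
  f (u + v) (u + v) - f (u - v) (u - v)
  + 'i * f (u + 'i *: v) (u + 'i *: v) - 'i * f (u - 'i *: v) (u - 'i *: v).
Proof.
have Zl a x y : f (a *: x) y = a * f x y by exact: linearZl_LR.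
have Zr a x y : f x (a *: y) = a^* * f x y by exact: linearZr_LR.
have Nr x y : f x (- y) = - f x y by exact: linearNr.
have NN x : f (- x) (- x) = f x x by exact: hnormN.
rewrite !dnormD !NN !Nr !Zl !Zr conjCi !(rmorphM, rmorphN)/= conjCi.
set a := f u v; set b := a^*; set x := f u u; set y := f v v.
have ii : 'i * 'i = -1 :> C by rewrite -expr2 sqrCi.
transitivity (2 * a + 2 * b - 2 * ('i * 'i) * (a - b)).
  by rewrite ii; ring.
by ring.
Qed.
End InnerProductSpace.
Section ComplexTopology.
Variable R : realType.
Local Open Scope complex_scope.

Lemma gt0_complexE (e : R[i]) : 0 < e -> e = (complex.Re e)%:C /\ 0 < complex.Re e.
Proof.
move=> e0; have := e0; rewrite ltcE => /andP[/eqP/= i0 r0].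
by split=> //; case: e i0 {e0 r0} => a b /= ->.
Qed.

Lemma ge0_complexE (e : R[i]) : 0 <= e -> e = (complex.Re e)%:C /\ 0 <= complex.Re e.
Proof.
move=> e0; have := e0; rewrite lecE => /andP[/eqP/= i0 r0].
by split=> //; case: e i0 {e0 r0} => a b /= ->.
Qed.

Lemma Re_le_norm (z : R[i]) : `|complex.Re z|%:C <= `|z|.
Proof.
rewrite normc_def lecR -sqrtr_sqr ler_wsqrtr// lerDl sqr_ge0//.
Qed.

Lemma Im_le_norm (z : R[i]) : `|complex.Im z|%:C <= `|z|.
Proof.
rewrite normc_def lecR -sqrtr_sqr ler_wsqrtr// lerDr sqr_ge0//.
Qed.

Lemma norm_le_ReIm (z : R[i]) : `|z| <= (`|complex.Re z| + `|complex.Im z|)%:C.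
Proof.
rewrite normc_def lecR -[leRHS]ger0_norm ?addr_ge0// -sqrtr_sqr ler_wsqrtr//.
by rewrite sqrrD !real_normK ?num_real// lerD2r lerDl mulrn_wge0// mulr_ge0.
Qed.

Lemma complex_complete (F : set_system R[i]^o) : ProperFilter F -> cauchy F -> cvg F.
Proof.
move=> FF /cauchyP Fc.
have h (p : R[i] -> R) : (forall z w, p (z - w) = p z - p w) ->
    (forall z, `|p z|%:C <= `|z|) -> cvg (p @ F).
  move=> pB pn; apply/cauchy_cvgP/cauchyP => e e0.
  have [|x Fx] := Fc (e%:C); first by rewrite ltcR.
  exists (p x); rewrite /fmap/=; apply: (@filterS _ F _ _ _ _ Fx) => y xy.
  change (`|p x - p y| < e); rewrite -pB -ltcR.
  exact: le_lt_trans (pn _) xy.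
have /cvg_ex[a ca] : cvg (@complex.Re R @ F).
  apply: h; last exact: Re_le_norm.
  by move=> [x1 x2] [y1 y2].
have /cvg_ex[b cb] : cvg (@complex.Im R @ F).
  apply: h; last exact: Im_le_norm.
  by move=> [x1 x2] [y1 y2].
apply/cvg_ex; exists (a +i* b); apply/cvgrPdist_lt => e /gt0_complexE[-> e0].
have e2 : 0 < complex.Re e / 2 by rewrite divr_gt0.
move/cvgrPdist_lt : ca => /(_ _ e2) ca.
move/cvgrPdist_lt : cb => /(_ _ e2) cb.
apply: filterS2 ca cb => z za zb; apply: le_lt_trans (norm_le_ReIm _) _.
rewrite ltcR (splitr (complex.Re e)) ltrD//.
  by case: z za {zb}.
by case: z zb {za}.
Qed.

(* R[i] as a complete normed module over itself: the alias is needed because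
   the carrier R[i] already bears an R-module structure, and the carrier R[i]^o
   shares its canonical key with R^o. *)
Definition scalars : Type := R[i]^o.
HB.instance Definition _ := NormedModule.copy scalars R[i]^o.
HB.instance Definition _ := Uniform_isComplete.Build scalars complex_complete.
End ComplexTopology.
(* The inner product is linear in its first argument and conjugate-linear in
   the second one. *)
Record hilbert (R : realType) := Hilbert {
  hilbert_sort :> completeNormedModType R[i];
  inner : {dot hilbert_sort for (@Num.conj R[i])};
  inner_norm : forall x, inner x x = `|x| ^+ 2 }.

Section ScalarHilbert.
Variable R : realType.
Let C := scalars R.

Definition scalar_inner (x y : C) : R[i] := (x : R[i]) * (y : R[i])^*.

Lemma scalar_inner_bilinear :
  bilinear_for ( *%R) (@Num.conj R[i] \; *%R) scalar_inner.
Proof.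
split=> [y a u v|x a u v]; rewrite /scalar_inner.
  by rewrite mulrDl -mulrA.
by rewrite /= rmorphD rmorphM mulrDr mulrCA.
Qed.
HB.instance Definition _ :=
  bilinear_isBilinear.Build _ _ _ _ _ _ scalar_inner scalar_inner_bilinear.

Lemma scalar_inner_herm (x y : C) :
  scalar_inner x y = (-1) ^+ false * (scalar_inner y x)^*.
Proof. by rewrite /scalar_inner expr0 mul1r rmorphM/= conjCK mulrC. Qed.
HB.instance Definition _ :=
  isHermitianSesquilinear.Build _ _ _ _ scalar_inner scalar_inner_herm.

Lemma scalar_inner_gt0 (x : C) : x != 0 -> 0 < scalar_inner x x.
Proof. by move=> x0; rewrite mul_conjC_gt0. Qed.
HB.instance Definition _ := isDotProduct.Build _ _ scalar_inner scalar_inner_gt0.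

Lemma scalar_inner_norm (x : C) : scalar_inner x x = `|x| ^+ 2.
Proof. by rewrite normCK. Qed.

Definition scalar_hilbert : hilbert R := Hilbert scalar_inner_norm.
End ScalarHilbert.

#[global] Existing Instance totally_filter.

Section SquareSummable.
Variables (R : realType) (I : choiceType) (E : hilbert R).
Local Notation C := R[i].
Local Open Scope complex_scope.
Implicit Types x y : I -> E.

(* The bound M may be read as a nonnegative real: M dominates a sum over the
   empty set, and z <= M in R[i] forces z and M to have the same imaginary part. *)
Definition square_summable x :=
  exists M : C, forall A : {fset I}, \sum_(i <- A) `|x i| ^+ 2 <= M.

Definition l2_pred : {pred I -> E} := [pred x | `[< square_summable x >]].

Record l2 := L2 {
  l2_fun :> I -> E;
  l2_subproof : l2_fun \in l2_pred }.

HB.instance Definition _ := [isSub for l2_fun].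
HB.instance Definition _ := [Choice of l2 by <:].

Lemma sqr_normD (u v : E) : `|u + v| ^+ 2 <= 2 * `|u| ^+ 2 + 2 * `|v| ^+ 2.
Proof.
rewrite -!inner_norm.
rewrite -subr_ge0; have := dnorm_ge0 (inner E) (u - v).
rewrite dnormB dnormD; congr (_ <= _); ring.
Qed.

Lemma l2_submod : submod_closed l2_pred.
Proof.
split.
  apply/asboolP; exists 0 => A; rewrite big1// => i _.
  by rewrite normr0 expr0n.
move=> a x y /asboolP[M xM] /asboolP[N yN]; apply/asboolP.
exists (2 * (`|a| ^+ 2 * M) + 2 * N) => A.
apply: (@le_trans _ _ (\sum_(i <- A) (2 * (`|a| ^+ 2 * `|x i| ^+ 2) + 2 * `|y i| ^+ 2))).
  apply: ler_sum => i _; apply: le_trans (sqr_normD _ _) _.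
  by rewrite normrZ exprMn.
rewrite big_split/= -!mulr_sumr lerD// ler_wpM2l// ler_wpM2l//.
by rewrite exprn_ge0.
Qed.
HB.instance Definition _ := GRing.isSubmodClosed.Build _ _ l2_pred l2_submod.
HB.instance Definition _ := [SubChoice_isSubLmodule of l2 by <:].

Implicit Types xi eta : l2.

Lemma l2P xi : square_summable xi.
Proof. by case: xi => x /= /asboolP. Qed.

Lemma l2ext xi eta : xi =1 eta -> xi = eta.
Proof. by move=> h; apply/val_inj/funext. Qed.

Lemma l2D xi eta i : (xi + eta) i = xi i + eta i. Proof. by []. Qed.
Lemma l2N xi i : (- xi) i = - xi i. Proof. by []. Qed.
Lemma l2Z (a : C) xi i : (a *: xi) i = a *: xi i. Proof. by []. Qed.

(* The unordered sum over I, i.e. the limit along the finite subsets of I. *)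
Definition l2_inner xi eta : C :=
  summability.sum (fun i => inner E (xi i) (eta i) : scalars R).

Lemma ler_sum_fset (f : I -> C) (A B : {fset I}) : (forall i, 0 <= f i) ->
  (A `<=` B)%fset -> \sum_(i <- A) f i <= \sum_(i <- B) f i.
Proof.
move=> f0 AB; rewrite [leRHS](big_fsetID _ (mem A))/=.
have -> : [fset x | x in B & x \in A]%fset = A.
  apply/fsetP => i; rewrite !inE/=; apply: andb_idl => iA.
  exact: (fsubsetP AB).
by rewrite lerDl sumr_ge0.
Qed.

Lemma sum_ge0_cvg (f : I -> scalars R) (M : C) :
  (forall i, 0 <= (f i : C)) ->
  (forall A : {fset I}, \sum_(i <- A) (f i : C) <= M) ->
  exists s : C, [/\ partial_sum f @ totally --> (s : scalars R),
    forall A : {fset I}, \sum_(i <- A) (f i : C) <= s & s <= M].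
Proof.
move=> f0 fM.
pose S := [set complex.Re (\sum_(i <- A) (f i : C)) | A in [set: {fset I}]].
have sE (A : {fset I}) :
    (\sum_(i <- A) (f i : C)) = (complex.Re (\sum_(i <- A) (f i : C)))%:C.
  by case: (@ge0_complexE _ (\sum_(i <- A) (f i : C))); rewrite ?sumr_ge0.
have ME : M = (complex.Re M)%:C.
  by case: (@ge0_complexE _ M)=> //; apply: le_trans (fM fset0); rewrite big_seq_fset0.
have Sub : ubound S (complex.Re M).
  by move=> _ [A _ <-]; rewrite -lecR -sE -ME.
have supS : has_sup S.
  by split; [exists (complex.Re (\sum_(i <- fset0) (f i : C))), fset0|exists (complex.Re M)].
have le_s (A : {fset I}) : \sum_(i <- A) (f i : C) <= (sup S)%:C.
  by rewrite sE lecR; apply: sup_upper_bound => //; exists A.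
exists (sup S)%:C; split=> //; last first.
  by rewrite ME lecR; apply: ge_sup => //; case: supS.
apply/cvgrPdist_lt => e /gt0_complexE[-> e0].
have [_ [A _ <-] hA] := sup_adherent e0 supS.
exists A => // B /= AB; rewrite /partial_sum -(big_seq_fsetE _ _ predT f)/=.
change (`|(sup S)%:C - \sum_(i <- B) (f i : C)| < (complex.Re e)%:C).
rewrite ger0_norm ?subr_ge0// ltrBlDl -ltrBlDr.
apply: lt_le_trans (ler_sum_fset f0 AB).
by rewrite sE -rmorphB/= ltcR.
Qed.

Lemma partial_sum_eq (f : I -> scalars R) (A : {fset I}) :
  partial_sum f A = \sum_(i <- A) f i.
Proof. by rewrite /partial_sum -(big_seq_fsetE _ _ predT f). Qed.

Lemma l2_sqr xi : exists s : C,
  [/\ partial_sum (fun i => inner E (xi i) (xi i) : scalars R) @ totally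
        --> (s : scalars R),
    forall A : {fset I}, \sum_(i <- A) `|xi i| ^+ 2 <= s &
    forall M, (forall A : {fset I}, \sum_(i <- A) `|xi i| ^+ 2 <= M) -> s <= M].
Proof.
pose f i : scalars R := inner E (xi i) (xi i).
have f0 i : 0 <= (f i : C) by exact: dnorm_ge0.
have fE (A : {fset I}) :
  \sum_(i <- A) (f i : C) = \sum_(i <- A) `|xi i| ^+ 2.
  by apply: eq_bigr => i _; exact: inner_norm.
have [M xM] := l2P xi.
have [|s [sc s1 _]] := @sum_ge0_cvg f M f0; first by move=> A; rewrite fE.
exists s; split=> // [A|N hN]; first by rewrite -fE.
have [|t [tc _ tN]] := @sum_ge0_cvg f N f0; first by move=> A; rewrite fE.
by rewrite (cvg_unique _ sc tc).
Qed.

Let ps (z : I -> E) (A : {fset I}) : scalars R :=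
  partial_sum (fun i => inner E (z i) (z i) : scalars R) A.

Lemma inner_polar xi eta :
  partial_sum (fun i => inner E (xi i) (eta i) : scalars R) =
  (4^-1 : C) \*: ((ps (xi + eta) - ps (xi - eta)
    + ('i : C) \*: ps (xi + ('i : C) *: eta))
    - ('i : C) \*: ps (xi - ('i : C) *: eta)).
Proof.
apply/funext => A.
change (partial_sum (fun i => inner E (xi i) (eta i) : scalars R) A =
  (4^-1 : C) *: ((ps (xi + eta) A - ps (xi - eta) A
    + ('i : C) *: ps (xi + ('i : C) *: eta) A)
    - ('i : C) *: ps (xi - ('i : C) *: eta) A)).
rewrite /ps !partial_sum_eq.
rewrite -[LHS](@scalerK C (scalars R) 4) ?pnatr_eq0//; congr (_ *: _).
rewrite scaler_sumr -sumrB !scaler_sumr -big_split/= -sumrB.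
apply: eq_bigr => i _; exact: dot_polar.
Qed.

Lemma l2_inner_cvg xi eta :
  partial_sum (fun i => inner E (xi i) (eta i) : scalars R) @ totally
    --> (l2_inner xi eta : scalars R).
Proof.
suff : cvg (partial_sum (fun i => inner E (xi i) (eta i) : scalars R) @ totally).
  by [].
rewrite inner_polar; have FT := @totally_filter I.
have [s1 [c1 _ _]] := l2_sqr (xi + eta).
have [s2 [c2 _ _]] := l2_sqr (xi - eta).
have [s3 [c3 _ _]] := l2_sqr (xi + ('i : R[i]) *: eta).
have [s4 [c4 _ _]] := l2_sqr (xi - ('i : R[i]) *: eta).
apply: cvgP; apply: cvgZl_tmp; apply: cvgB; last exact: cvgZl_tmp c4.
apply: cvgD; last exact: cvgZl_tmp c3.
exact: cvgB c1 c2.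
Qed.

Lemma cvg_l2_inner xi eta (l : scalars R) :
  partial_sum (fun i => inner E (xi i) (eta i) : scalars R) @ totally --> l ->
  l2_inner xi eta = l.
Proof. by apply: cvg_unique (@l2_inner_cvg xi eta); exact: norm_hausdorff. Qed.

Lemma l2_innerZD (a : C) (x1 x2 y : l2) :
  l2_inner (a *: x1 + x2) y = a * l2_inner x1 y + l2_inner x2 y.
Proof.
have FT := @totally_filter I.
apply: cvg_l2_inner.
rewrite (_ : partial_sum _ =
  a \*: partial_sum (fun i => inner E (x1 i) (y i) : scalars R) +
  partial_sum (fun i => inner E (x2 i) (y i) : scalars R)).
  by apply: cvgD; [apply: cvgZl_tmp|]; exact: l2_inner_cvg.
apply/funext => A.
change (partial_sum (fun i => inner E ((a *: x1 + x2) i) (y i) : scalars R) A =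
  a *: partial_sum (fun i => inner E (x1 i) (y i) : scalars R) A +
  partial_sum (fun i => inner E (x2 i) (y i) : scalars R) A).
rewrite !partial_sum_eq scaler_sumr -big_split/=.
apply: eq_bigr => i _; change (inner E (a *: x1 i + x2 i) (y i) =
  a * inner E (x1 i) (y i) + inner E (x2 i) (y i)).
by rewrite linearDl; congr (_ + _); exact: linearZl_LR.
Qed.

Lemma conj_cvg (T : Type) (F : set_system T) (f : T -> scalars R) (l : scalars R) :
  Filter F -> f @ F --> l ->
  (fun t => ((f t : C)^* : C)%R : scalars R) @ F --> ((l : C)^* : scalars R).
Proof.
move=> FF /cvgrPdist_lt h; apply/cvgrPdist_lt => e /h; apply: filterS => t.
congr (_ < _); rewrite -[LHS](@norm_conjC C); congr (`|_ : C|).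
exact: rmorphB.
Qed.

Lemma l2_innerC (x y : l2) : l2_inner x y = (-1) ^+ false * (l2_inner y x)^*.
Proof.
rewrite expr0 mul1r; apply: cvg_l2_inner.
have := conj_cvg _ (@l2_inner_cvg y x).
rewrite (_ : (fun _ => _) = partial_sum (fun i : I => inner E (x i) (y i))); first exact.
apply/funext => A; rewrite !partial_sum_eq (@rmorph_sum C C).
by apply: eq_bigr => i _; rewrite [RHS]hermC expr0 mul1r.
Qed.

Lemma l2_inner_bilinear :
  bilinear_for ( *%R) (@Num.conj R[i] \; *%R) l2_inner.
Proof.
split=> [y a u v|x a u v]; first exact: l2_innerZD.
rewrite l2_innerC l2_innerZD [l2_inner x u]l2_innerC [l2_inner x v]l2_innerC.
by rewrite !expr0 !mul1r rmorphD rmorphM.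
Qed.

HB.instance Definition _ :=
  bilinear_isBilinear.Build _ _ _ _ _ _ l2_inner l2_inner_bilinear.
HB.instance Definition _ :=
  isHermitianSesquilinear.Build _ _ _ _ l2_inner l2_innerC.

Lemma l2_inner_le xi M :
  (forall A : {fset I}, \sum_(i <- A) `|xi i| ^+ 2 <= M) ->
  l2_inner xi xi <= M.
Proof. by move=> h; have [s [sc _ sM]] := l2_sqr xi; rewrite (cvg_l2_inner sc); exact: sM. Qed.

Lemma l2_inner_ge xi (A : {fset I}) :
  \sum_(i <- A) `|xi i| ^+ 2 <= l2_inner xi xi.
Proof. by have [s [sc sA _]] := l2_sqr xi; rewrite (cvg_l2_inner sc). Qed.

Lemma l2_inner_gt0 xi : xi != 0 -> 0 < l2_inner xi xi.
Proof.
move=> xi0; have [i xii] : exists i, xi i != 0.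
  apply: contrapT => h; move/eqP: xi0; apply; apply: l2ext => i.
  by apply/eqP/negPn/negP => xii; apply: h; exists i.
apply: lt_le_trans (l2_inner_ge xi [fset i]%fset).
by rewrite big_seq_fset1 exprn_gt0// normr_gt0.
Qed.
HB.instance Definition _ := isDotProduct.Build _ _ l2_inner l2_inner_gt0.

HB.instance Definition _ := Lmodule_isNormed.Build R[i] l2
  (@dot_normD _ _ l2_inner) (@dot_normZ _ _ l2_inner) (@dot_norm_eq0 _ _ l2_inner).

Lemma l2_norm_sqr xi : `|xi| ^+ 2 = l2_inner xi xi.
Proof. exact: dot_normK. Qed.

Lemma l2_norm_le xi (M : C) : 0 <= M ->
  (forall A : {fset I}, \sum_(i <- A) `|xi i| ^+ 2 <= M ^+ 2) -> `|xi| <= M.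
Proof.
move=> M0 h; rewrite -(@ler_pXn2r _ 2)// ?nnegrE// l2_norm_sqr.
exact: l2_inner_le.
Qed.

Lemma l2_norm_ge xi (A : {fset I}) : \sum_(i <- A) `|xi i| ^+ 2 <= `|xi| ^+ 2.
Proof. by rewrite l2_norm_sqr; exact: l2_inner_ge. Qed.

Lemma l2_norm_coord xi i : `|xi i| <= `|xi|.
Proof.
rewrite -(@ler_pXn2r _ 2)// ?nnegrE//.
by have := l2_norm_ge xi [fset i]%fset; rewrite big_seq_fset1.
Qed.

Lemma l2_complete (F : set_system l2) : ProperFilter F -> cauchy F -> cvg F.
Proof.
move=> FF /cauchyP Fc.
have FB (e : C) : 0 < e -> exists xi : l2, \forall eta \near F, `|xi - eta| < e.
  by move=> /Fc[xi Fxi]; exists xi; apply: filterS Fxi => eta.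
have coord_cvg i : cvg ((fun xi : l2 => xi i) @ F).
  apply/cauchy_cvgP/cauchyP => e /FB[xi Fxi]; exists (xi i).
  rewrite /fmap/=; apply: (@filterS _ F _ _ _ _ Fxi) => eta /= h.
  rewrite -ball_normE /=; apply: le_lt_trans h.
  by have := l2_norm_coord (xi - eta) i.
pose l i := lim ((fun xi : l2 => xi i) @ F).
have near_sum (xi : l2) (e : C) : 0 < e ->
    (\forall eta \near F, `|xi - eta| < e) ->
    forall A : {fset I}, \sum_(i <- A) `|l i - xi i| ^+ 2 <= (2 * e) ^+ 2.
  move=> e0 Fxi A.
  pose d := e / (#|` A|%:R + 1).
  have n0 : 0 < #|` A|%:R + 1 :> C by rewrite ltr_wpDl.
  have d0 : 0 < d by rewrite divr_gt0.
  have FA : \forall eta \near F, forall i : A, `|l (val i) - (eta : l2) (val i)| < d.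
    apply: filter_forall => i.
    by have /cvgrPdist_lt/(_ _ d0) := coord_cvg (val i).
  have [eta [eta1 eta2]] := filter_ex (filterI Fxi FA).
  apply: (@le_trans _ _ (\sum_(i <- A) (2 * `|l i - eta i| ^+ 2 +
      2 * `|(eta - xi) i| ^+ 2))).
    apply: ler_sum => i _; apply: le_trans (sqr_normD _ _).
    by rewrite l2D l2N addrA subrK.
  rewrite big_split/= -!mulr_sumr exprMn.
  have -> : 2 ^+ 2 * e ^+ 2 = 2 * e ^+ 2 + 2 * e ^+ 2 by ring.
  rewrite lerD// ler_wpM2l//; last first.
    apply: (le_trans (l2_norm_ge (eta - xi) A)); rewrite distrC.
    by rewrite ler_pXn2r// ?nnegrE// ltW.
  apply: (@le_trans _ _ (\sum_(i <- A) d ^+ 2)).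
    rewrite big_seq [leRHS]big_seq; apply: ler_sum => i iA.
    rewrite ler_pXn2r ?nnegrE ?(ltW d0)//; exact: ltW (eta2 [` iA]%fset).
  rewrite big_const_seq count_predT iter_addr_0.
  rewrite /d exprMn exprVn -mulrnAr ler_piMr ?exprn_ge0 ?(ltW e0)//.
  rewrite -mulr_natl ler_pdivrMr ?exprn_gt0// mul1r.
  rewrite expr2; apply: (@le_trans _ _ (#|` A|%:R + 1)); first by rewrite lerDl.
  by rewrite ler_peMr ?(ltW n0)// lerDr.
have l2l : l \in l2_pred.
  have [xi Fxi] := FB 1 ltr01.
  have [M xiM] := l2P xi; apply/asboolP.
  exists (2 * (2 * 1) ^+ 2 + 2 * M) => A.
  apply: (@le_trans _ _ (\sum_(i <- A) (2 * `|l i - xi i| ^+ 2 + 2 * `|xi i| ^+ 2))).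
    by apply: ler_sum => i _; apply: le_trans (sqr_normD _ _); rewrite subrK.
  rewrite big_split/= -!mulr_sumr lerD// ler_wpM2l//.
  exact: near_sum ltr01 Fxi A.
pose L := L2 l2l.
apply/cvg_ex; exists L; apply/cvgrPdist_lt => e e0.
have e3 : 0 < e / 4 by rewrite divr_gt0.
have [xi Fxi] := FB _ e3.
have Lxi : `|L - xi| <= 2 * (e / 4).
  apply: l2_norm_le; first by rewrite mulr_ge0// ltW.
  exact: near_sum e3 Fxi.
apply: filterS Fxi => eta h.
rewrite -(subrK xi L) -addrA (le_lt_trans (ler_normD _ _))//.
apply: (le_lt_trans (lerD Lxi (ltW h))).
have -> : 2 * (e / 4) + e / 4 = 3 / 4 * e by field.
by rewrite gtr_pMl// ltr_pdivrMr// mul1r ltr_nat.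
Qed.
HB.instance Definition _ := Uniform_isComplete.Build l2 l2_complete.

Lemma l2_inner_norm xi : l2_inner xi xi = `|xi| ^+ 2.
Proof. by rewrite l2_norm_sqr. Qed.

Definition l2_hilbert : hilbert R := Hilbert l2_inner_norm.
End SquareSummable.
Section VonNeumannAlgebras.
Variables (R : realType) (E : hilbert R).
Implicit Types (S M B Q : set (E -> E)) (T x u : E -> E).

Definition bounded_operators : set (E -> E) := [set T : E -> E | linear T /\ continuous T].

Definition is_adjoint (T T' : E -> E) := forall v w, inner E (T v) w = inner E v (T' w).

Definition commutant S : set (E -> E) :=
  bounded_operators `&` [set T : E -> E | forall A : E -> E, S A -> T \o A = A \o T].

Definition von_neumann M :=
  [/\ M `<=` bounded_operators,
      forall T T' : E -> E, M T -> is_adjoint T T' -> M T' &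
      commutant (commutant M) = M].

(* The smallest von Neumann algebra on E containing S. *)
Definition vN_generated S : set (E -> E) :=
  \bigcap_(M in [set M : set (E -> E) | von_neumann M /\ S `<=` M]) M.

(* u' is the adjoint of u, so that u ranges over unitaries of M. *)
Definition normalizer M B : set (E -> E) :=
  [set u : E -> E | M u /\ exists u' : E -> E, [/\ is_adjoint u u', u \o u' = id, u' \o u = id &
                               [set u \o b \o u' | b in B] = B]].

Definition one_sided_quasi_normalizer M B : set (E -> E) :=
  [set x : E -> E | M x /\ exists n (y : 'I_n -> E -> E), (forall i, M (y i)) /\
     forall b, B b -> exists c : 'I_n -> E -> E, (forall i, B (c i)) /\
       b \o x = \sum_(i < n) (y i \o c i)].

Definition finite_algebra Q :=
  forall v v' : E -> E, Q v -> is_adjoint v v' -> v' \o v = id -> v \o v' = id.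

(* The sigma-weakly continuous functionals on Q, i.e. the elements of its
   predual, in Dixmier's form sum_n <x v_n, w_n>. *)
Definition normal_functional Q (phi : (E -> E) -> R[i]) :=
  exists v w : nat -> E, [/\ square_summable v, square_summable w &
    forall x : E -> E, Q x ->
      (fun n => \sum_(k < n) inner E (x (v k)) (w k) : scalars R) @ \oo
        --> (phi x : scalars R)].

(* Norm separability of the predual; the norm of a functional is its supremum
   over the unit ball of Q. *)
Definition separable_predual Q :=
  exists phi : nat -> (E -> E) -> R[i],
    (forall n, normal_functional Q (phi n)) /\
    forall psi, normal_functional Q psi -> forall e : R[i], 0 < e ->
      exists n, forall x : E -> E, Q x -> (forall v, `|x v| <= `|v|) ->
        `|psi x - phi n x| <= e.

Record faithful_normal_trace Q (tau : (E -> E) -> R[i]) : Prop := {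
  trace_linear : forall a x y, Q x -> Q y ->
    tau (a *: x + y) = a * tau x + tau y;
  trace_ge0 : forall x x' : E -> E, Q x -> is_adjoint x x' -> 0 <= tau (x' \o x);
  trace_faithful : forall x x' : E -> E, Q x -> is_adjoint x x' ->
    tau (x' \o x) = 0 -> x = 0;
  trace_tracial : forall x y : E -> E, Q x -> Q y -> tau (x \o y) = tau (y \o x);
  trace_normal : normal_functional Q tau;
  trace_normalized : tau id = 1 }.

(* Only the values of alpha on Q matter; action1 and actionM make every
   alpha g bijective on Q, hence a *-automorphism. *)
Record trace_preserving_action (G : groupType) Q (tau : (E -> E) -> R[i])
    (alpha : G -> (E -> E) -> E -> E) : Prop := {
  action_stable : forall g x, Q x -> Q (alpha g x);
  action1 : forall x, Q x -> alpha 1%g x = x;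
  actionM : forall g h x, Q x -> alpha (g * h)%g x = alpha g (alpha h x);
  action_linear : forall g a x y, Q x -> Q y ->
    alpha g (a *: x + y) = a *: alpha g x + alpha g y;
  action_comp : forall g (x y : E -> E), Q x -> Q y ->
    alpha g (x \o y) = alpha g x \o alpha g y;
  action_adjoint : forall g x x', Q x -> is_adjoint x x' ->
    is_adjoint (alpha g x) (alpha g x');
  action_trace : forall g x, Q x -> tau (alpha g x) = tau x }.

End VonNeumannAlgebras.

Section CrossedProducts.
Variables (R : realType) (G : groupType).

Section Shift.
Variable E : hilbert R.

Lemma shift_subproof (g : G) (xi : l2 G E) :
  (fun x : G => xi (g^-1 * x)%g) \in @l2_pred R G E.
Proof.
have [M xiM] := l2P xi; apply/asboolP; exists M => A.
have := xiM [fset (g^-1 * x)%g | x in A]%fset.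
by rewrite big_imfset//= => x y _ _; exact: mulgI.
Qed.

Definition shift (g : G) (xi : l2_hilbert G E) : l2_hilbert G E :=
  L2 (shift_subproof g xi).

(* The copy of Q in its crossed product: q acts on l2(G, E) by
   (q xi)(g) = alpha_{g^-1}(q) (xi g). The *-automorphisms alpha_g being
   isometric, this defines exactly one bounded operator for each q in Q. *)
Definition crossed_coefficients (Q : set (E -> E))
    (alpha : G -> (E -> E) -> E -> E) : set (l2_hilbert G E -> l2_hilbert G E) :=
  [set T : l2_hilbert G E -> l2_hilbert G E | bounded_operators T /\ exists2 q, Q q &
    forall (xi : l2 G E) (g : G), (T xi : l2 G E) g = alpha g^-1%g q (xi g)].

Definition crossed_product (Q : set (E -> E))
    (alpha : G -> (E -> E) -> E -> E) (H : set G) :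
    set (l2_hilbert G E -> l2_hilbert G E) :=
  vN_generated (crossed_coefficients Q alpha `|` [set shift h | h in H]).
End Shift.

(* L(H), inside the operators on l2(G). *)
Definition group_algebra (H : set G) :=
  vN_generated [set @shift (scalar_hilbert R) h | h in H].

End CrossedProducts.
Arguments group_algebra R {G} H.

Section GroupConditions.
Variable G : groupType.
Implicit Types H K : set G.
Local Open Scope group_scope.

Definition is_subgroup H :=
  [/\ H 1, forall g h, H g -> H h -> H (g * h) & forall g, H g -> H g^-1].

Definition group_normalizer H : set G :=
  [set g | [set g * h * g^-1 | h in H] = H].

Definition left_coset (g : G) H : set G := [set g * h | h in H].

(* The orbit of the point gH under H is a set of left cosets of H. *)
Definition condition_SS H K :=
  forall g, ~ K g -> infinite_set [set left_coset h (left_coset g H) | h in H].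
End GroupConditions.

(* Main.v *)
(** On l2(G, E) an operator T of the crossed product of Q by G has the matrix
    entries T(x, y) = alpha_{x^-1}(t(x y^-1)) with Fourier coefficients t(g) in
    Q, and T belongs to the crossed product of Q by H exactly when t vanishes
    off H.  Let u be a unitary normalizing the crossed product by H.  For h in
    H, the operator u^* h u is a unitary commuting with the projections onto
    right cosets of H; hence the mass of u^* on H x, the sum of
    tau (u^*_y^* u^*_y) over y in H x, equals its mass on H x h.  The total mass
    being finite, it vanishes on every coset with an infinite orbit, and under
    condition (SS) these are all the cosets off K.

    Let now B x be contained in sum_i y_i B with B = L(H).  If the orbit of a
    coset in the support of x^* is infinite, then one can choose cosets in this
    orbit along which all the y_i^* are arbitrarily small; a gliding hump gives
    b in B such that the restrictions of x^* b^* to these cosets do not decay as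
    fast as those of the y_i^*, which contradicts b x in sum_i y_i B.
    Conversely, a finite orbit of g H puts the translation by g in the
    one-sided quasi-normalizer. *)

Require Import Defs.
From HB Require Import structures.
From mathcomp Require Import all_boot all_order all_algebra.
From mathcomp Require Import finmap sesquilinear complex.
From mathcomp Require Import all_classical reals topology normedtype.
From mathcomp Require Import showcase.summability.
From mathcomp Require Import ring lra.

Set Implicit Arguments.
Unset Strict Implicit.
Unset Printing Implicit Defensive.
Import Order.TTheory GRing.Theory Num.Theory.
Import numFieldNormedType.Exports.
Local Open Scope classical_set_scope.
Local Open Scope ring_scope.

(** * Hilbert spaces *)

(** Both inclusions into the crossed product by [K] are proved for adjoints. Elements of the crossed
    product by [H] commute with restriction to right cosets of [H], which helps only when they stand
    on the left, and the adjoint puts them there: [u^* h = (u^* h u) u^*] and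
    [x^* b^* = \sum_i c_i^* y_i^*]. The action enters only through algebra and the invariance of
    [tau]. Hence the Fourier coefficients are compared in the norm of [tau], and the operator
    attached to a coefficient is bounded because it is a diagonal of a bounded operator. Fourier
    series need not converge strongly, so membership in a crossed product is checked in the
    bicommutant, entry by entry. A normal trace comes with two sequences of vectors, so a mass is a
    sesquilinear expression and not a squared norm: it is complex, and its positivity is first known
    at points only. In the inclusion of the crossed product by [K], the copy of [Q] is reached by
    unitaries through the Cayley transform, in place of functional calculus. The gliding hump wins
    because one side decays like [r ^+ m] and the other like its square. *)

Section Inner.
Variables (R : realType) (E : hilbert R).
Local Notation C := R[i].
Local Notation "''[' x , y ]" := (inner E x y) : ring_scope.
Implicit Types (x y z : E) (a : C).

Lemma innerDl x y z : '[x + y, z] = '[x, z] + '[y, z].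
Proof. exact: linearDl. Qed.
Lemma innerDr x y z : '[z, x + y] = '[z, x] + '[z, y].
Proof. exact: linearDr. Qed.
Lemma innerZl a x z : '[a *: x, z] = a * '[x, z].
Proof. exact: linearZl_LR. Qed.
Lemma innerZr a x z : '[z, a *: x] = a^* * '[z, x].
Proof. exact: linearZr_LR. Qed.
Lemma innerNl x z : '[- x, z] = - '[x, z].
Proof. exact: linearNl. Qed.
Lemma innerNr x z : '[z, - x] = - '[z, x].
Proof. exact: linearNr. Qed.
Lemma innerBl x y z : '[x - y, z] = '[x, z] - '[y, z].
Proof. by rewrite innerDl innerNl. Qed.
Lemma innerBr x y z : '[z, x - y] = '[z, x] - '[z, y].
Proof. by rewrite innerDr innerNr. Qed.
Lemma inner0l z : '[0, z] = 0.
Proof. exact: linear0l. Qed.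
Lemma inner0r z : '[z, 0] = 0.
Proof. exact: linear0r. Qed.
Lemma innerC x y : '[x, y] = '[y, x]^*.
Proof. by rewrite (hermC (inner E)) expr0 mul1r. Qed.

Lemma inner_CS x y : `|'[x, y]| <= `|x| * `|y|.
Proof.
have nE z : dot_norm (inner E) z = `|z| by rewrite /dot_norm inner_norm sqrCK.
by rewrite -!nE; exact: dot_norm_CS.
Qed.

Lemma inner_eq0 x : '[x, x] = 0 -> x = 0.
Proof. by rewrite inner_norm => /eqP; rewrite sqrf_eq0 normr_eq0 => /eqP. Qed.

Lemma inner_injl x y : (forall z, '[x, z] = '[y, z]) -> x = y.
Proof.
by move=> h; apply/eqP; rewrite -subr_eq0; apply/eqP/inner_eq0;
  rewrite innerBl h subrr.
Qed.

Lemma inner_injr x y : (forall z, '[z, x] = '[z, y]) -> x = y.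
Proof. by move=> h; apply: inner_injl => z; rewrite innerC h -innerC. Qed.

Lemma parallelogram x y :
  `|x + y| ^+ 2 + `|x - y| ^+ 2 = 2 * `|x| ^+ 2 + 2 * `|y| ^+ 2.
Proof.
rewrite -!inner_norm !(innerDl, innerDr, innerNl, innerNr).
by ring.
Qed.

Lemma pythagoras x y : '[x, y] = 0 -> `|x + y| ^+ 2 = `|x| ^+ 2 + `|y| ^+ 2.
Proof.
move=> h; rewrite -!inner_norm !(innerDl, innerDr) h (innerC y) h conjC0.
by rewrite addr0 add0r.
Qed.
End Inner.

Lemma eq0_norm_lt (K : numFieldType) (V : normedModType K) (x : V) :
  (forall e, 0 < e -> `|x| < e) -> x = 0.
Proof.
move=> h; apply/eqP/negPn/negP => x0.
by have := h `|x|; rewrite ltxx normr_gt0 => /(_ x0).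
Qed.

(** * Orthogonal projection onto closed subspaces *)

Section Projection.
Variables (R : realType) (E : hilbert R).
Local Notation C := R[i].
Local Open Scope complex_scope.

Definition closed_subspace (V : set E) :=
  [/\ V 0, forall (a : C) u v, V u -> V v -> V (a *: u + v) &
      forall p, (forall e : C, 0 < e -> exists2 v, V v & `|p - v| < e) -> V p].

(** Norms live in the partially ordered [R[i]]; the real part makes [inf] and arithmetic over [R]
    available. *)
Let nr (x : E) : R := complex.Re `|x|.

Let nrE x : `|x| = (nr x)%:C.
Proof. by have [] := ge0_complexE (normr_ge0 x). Qed.

Let nr_ge0 x : 0 <= nr x.
Proof. by rewrite -ler0c -nrE. Qed.

Lemma closest_point (V : set E) x : closed_subspace V ->
  exists2 p, V p & forall v, V v -> `|x - p| <= `|x - v|.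
Proof.
case=> V0 Vlin Vcl.
pose d := inf [set nr (x - v) | v in V].
have dlb : lbound [set nr (x - v) | v in V] 0 by move=> _ [v _ <-]; exact: nr_ge0.
have d_le v : V v -> d <= nr (x - v).
  by move=> Vv; apply: ge_inf; [exists 0; exact: dlb|exists v].
have d0 : 0 <= d by apply: lb_le_inf => //; exists (nr (x - 0)), 0.
pose S e := [set v | V v /\ nr (x - v) < d + e].
have S_ex e : 0 < e -> exists v, S e v.
  move=> e0; have [|_ [v Vv <-] h] := @inf_adherent _ [set nr (x - v) | v in V] e e0.
    by split; [exists (nr (x - 0)), 0|exists 0; exact: dlb].
  by exists v.
(* Two near-minimizers are close: their midpoint is in [V], hence at distance at least [d] from [x],
   and the parallelogram identity leaves [4 (d + e)^2 - 4 d^2]. *)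
have S_diam e u v : 0 < e -> S e u -> S e v -> nr (u - v) ^+ 2 <= 4 * e * (2 * d + e).
  move=> e0 [Vu xu] [Vv xv].
  have Vm : V ((2^-1 : C) *: (u + v)).
    by rewrite -[_ *: _]addr0; apply: (Vlin) => //; rewrite -[u]scale1r; exact: Vlin.
  have := parallelogram (x - u) (x - v).
  have -> : x - u + (x - v) = (2 : C) *: (x - (2^-1 : C) *: (u + v)).
    rewrite scalerBr scalerA mulfV ?pnatr_eq0// scale1r opprD scaler_nat mulr2n.
    by rewrite addrACA.
  have -> : x - u - (x - v) = v - u by rewrite opprB addrC addrA subrK.
  move: (2^-1 *: (u + v)) Vm => w Vm.
  rewrite normrZ normr_nat (distrC v u) !nrE -!rmorphXn/=.
  have -> : (2 : C) = (2 : R)%:C by rewrite rmorph_nat.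
  rewrite -!rmorphM/= -!rmorphXn/= -!rmorphD/= => /(congr1 (@complex.Re R))/=.
  have := d_le _ Vm; have := d_le _ Vu; have := d_le _ Vv.
  have := nr_ge0 (x - u); have := nr_ge0 (x - v).
  set a := nr (x - u) in xu *; set b := nr (x - v) in xv *.
  set m := nr (x - _); set t := nr (u - v).
  move=> b0 a0 db da dm h.
  have a2 : a ^+ 2 <= (d + e) ^+ 2 by rewrite ler_pXn2r ?nnegrE ?addr_ge0 ?(ltW e0)// ltW.
  have b2 : b ^+ 2 <= (d + e) ^+ 2 by rewrite ler_pXn2r ?nnegrE ?addr_ge0 ?(ltW e0)// ltW.
  have m2 : d ^+ 2 <= m ^+ 2 by rewrite ler_pXn2r ?nnegrE// (le_trans d0).
  move: h a2 b2 m2; move: (a ^+ 2) (b ^+ 2) => A B.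
  nra.
pose F : set_system E := filter_from [set e | 0 < e] S.
have FF : ProperFilter F.
  apply: filter_from_proper; last by move=> e /S_ex.
  apply: filter_from_filter; first by exists 1 => /=.
  move=> e e' /= e0 e'0; exists (Num.min e e'); rewrite /= ?lt_min ?e0//.
  by move=> v [Vv h]; split; split=> //; apply: lt_le_trans h _;
    rewrite lerD2l ge_min lexx ?orbT.
have Fc : cauchy F.
  apply/cauchyP => e' /gt0_complexE[e'E].
  move: (complex.Re e') e'E => e -> {e'} e0.
  (* Since [s <= 1], the bound [4 s (2 d + s)] is at most [4 s (2 d + 1)], which is below
     [e ^+ 2]. *)
  pose s := Num.min 1 (e ^+ 2 / (4 * (2 * d + 2))).
  have dd : 0 < 4 * (2 * d + 2) by lra.
  have s0 : 0 < s by rewrite lt_min ltr01 divr_gt0// exprn_gt0.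
  have [v Sv] := S_ex _ s0.
  exists v; exists s => // u Su; rewrite -ball_normE /= nrE ltcR.
  have := S_diam _ _ _ s0 Sv Su.
  have s1 : s <= 1 by rewrite ge_min lexx.
  have : s <= e ^+ 2 / (4 * (2 * d + 2)) by rewrite ge_min lexx orbT.
  rewrite ler_pdivlMr// => s2.
  have := nr_ge0 (v - u).
  set t := nr _ => t0 h.
  have te : t ^+ 2 < e ^+ 2 by nra.
  by nra.
have /cvg_ex[p Fp] : cvg F by exact: cauchy_cvg.
have near_p e : 0 < e -> exists2 v, S e v & nr (p - v) < e.
  move=> e0; have e0' : 0 < e%:C by rewrite ltcR.
  have h := Fp _ (nbhsx_ballx p e%:C e0').
  have FS : F (S e) by exists e.
  have [v [Sv]] := filter_ex (filterI FS h).
  by rewrite -ball_normE /= nrE ltcR; exists v.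
exists p.
  apply: Vcl => e /gt0_complexE[-> /near_p[v [Vv _] h]]; exists v => //.
  by rewrite nrE ltcR.
move=> v /d_le dv; rewrite !nrE lecR; apply: le_trans dv.
rewrite leNgt; apply/negP => h.
have [|u [Vu xu] pu] := near_p ((nr (x - p) - d) / 2).
  by rewrite divr_gt0// subr_gt0.
have : nr (x - p) <= nr (x - u) + nr (p - u).
  rewrite -lecR rmorphD/= -!nrE (distrC p).
  have -> : x - p = (x - u) + (u - p) by rewrite addrA subrK.
  exact: ler_normD.
lra.
Qed.

(** If [x - p] had a nonzero component [a *: v] along [v], moving [p] by it would come closer to
    [x]; Pythagoras turns the minimality of [p] into [a = 0]. *)
Lemma orthogonal_projection (V : set E) x : closed_subspace V ->
  exists2 p, V p & forall v, V v -> inner E (x - p) v = 0.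
Proof.
move=> Vcs; have [p Vp pmin] := closest_point x Vcs.
have [V0 Vlin _] := Vcs; exists p => // v Vv.
have [->|v0] := eqVneq v 0; first by rewrite inner0r.
set z := x - p; pose a := inner E z v / inner E v v.
have vv : inner E v v != 0 by apply: contra_neq v0; exact: inner_eq0.
have zav : inner E (z - a *: v) v = 0.
  by rewrite innerBl innerZl divfK// subrr.
have := @pythagoras _ _ (z - a *: v) (a *: v).
rewrite innerZr zav mulr0 subrK => /(_ erefl) h.
have : `|z| ^+ 2 <= `|z - a *: v| ^+ 2.
  rewrite ler_pXn2r// ?nnegrE// /z -addrA -opprD.
  by apply: pmin; rewrite addrC; exact: Vlin.
rewrite h gerDl normrZ exprMn => h1.
have /eqP : (`|a| ^+ 2 * `|v| ^+ 2) = 0.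
  by apply/le_anti; rewrite h1 mulr_ge0 ?exprn_ge0.
rewrite mulf_eq0 !sqrf_eq0 !normr_eq0 (negPf v0) orbF mulf_eq0 invr_eq0 (negPf vv).
by rewrite orbF => /eqP.
Qed.
End Projection.

(** * Bounded operators and von Neumann algebras *)

Lemma continuous_linearP (K : numFieldType) (V W : normedModType K) (f : V -> W) :
  linear f ->
  continuous f <-> exists2 M, 0 <= M & forall x, `|f x| <= M * `|x|.
Proof.
move=> lf; pose F : {linear V -> W} := HB.pack f (GRing.isLinear.Build _ _ _ _ _ lf).
have -> : f = F :> (V -> W) by [].
rewrite -linear_bounded_continuous linear_boundedP; split.
  by move=> /pinfty_ex_gt0[M /ltW M0 h]; exists M.
move=> [M M0 h]; exists M; split; first exact: ger0_real.
by move=> r Mr x; apply: le_trans (h x) _; rewrite ler_wpM2r// ltW.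
Qed.

Section Linear.
Variables (K : numFieldType) (V W : normedModType K) (f : V -> W).
Hypothesis lf : linear f.

(** Operators are bare functions with a proof of linearity; packing one makes the lemmas on linear
    maps apply. *)
Let F : {linear V -> W} := HB.pack f (GRing.isLinear.Build _ _ _ _ _ lf).

Lemma lin0 : f 0 = 0. Proof. exact: (linear0 F). Qed.
Lemma linD x y : f (x + y) = f x + f y. Proof. exact: (linearD F). Qed.
Lemma linB x y : f (x - y) = f x - f y. Proof. exact: (linearB F). Qed.
Lemma linZ a x : f (a *: x) = a *: f x. Proof. exact: (linearZZ F). Qed.
Lemma lin_sum (I : Type) (r : seq I) (P : pred I) (g : I -> V) :
  f (\sum_(i <- r | P i) g i) = \sum_(i <- r | P i) f (g i).
Proof. exact: (linear_sum F). Qed.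
End Linear.

Section Operators.
Variables (R : realType) (E : hilbert R).
Local Notation C := R[i].
Local Notation "''[' x , y ]" := (inner E x y) : ring_scope.
Implicit Types (S M B : set (E -> E)) (T U : E -> E).

Lemma bounded_operatorsP T : bounded_operators T <->
  linear T /\ exists2 M : C, 0 <= M & forall x, `|T x| <= M * `|x|.
Proof. by split=> -[lT h]; split=> //; apply/(continuous_linearP lT). Qed.

Lemma bounded_linear T : bounded_operators T -> linear T.
Proof. by case. Qed.

Lemma bounded_id : bounded_operators (id : E -> E).
Proof. by apply/bounded_operatorsP; split=> //; exists 1 => // x; rewrite mul1r. Qed.

Lemma bounded_comp T U :
  bounded_operators T -> bounded_operators U -> bounded_operators (T \o U).
Proof.
move=> /bounded_operatorsP[lT [M M0 hT]] /bounded_operatorsP[lU [N N0 hU]].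
apply/bounded_operatorsP; split; first by move=> a x y; rewrite /= lU lT.
exists (M * N) => [|x]; first exact: mulr_ge0.
by apply: le_trans (hT _) _; rewrite -mulrA ler_wpM2l.
Qed.

Lemma bounded_lin T U (a : C) : bounded_operators T -> bounded_operators U ->
  bounded_operators (a *: T + U).
Proof.
move=> /bounded_operatorsP[lT [M M0 hT]] /bounded_operatorsP[lU [N N0 hU]].
apply/bounded_operatorsP; split.
  move=> b x y; change (a *: T (b *: x + y) + U (b *: x + y) =
    b *: (a *: T x + U x) + (a *: T y + U y)).
  by rewrite lT lU !scalerDr addrACA !scalerA [a * b]mulrC.
exists (`|a| * M + N) => [|x]; first by rewrite addr_ge0 ?mulr_ge0.
change (`|a *: T x + U x| <= (`|a| * M + N) * `|x|).
apply: le_trans (ler_normD _ _) _; rewrite mulrDl lerD// normrZ -mulrA.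
by rewrite ler_wpM2l.
Qed.

Lemma bounded0 : bounded_operators (0 : E -> E).
Proof.
apply/bounded_operatorsP; split; first by move=> a x y; rewrite /= scaler0 addr0.
by exists 0 => // x; rewrite normr0 mul0r.
Qed.

Lemma is_adjointC T U : is_adjoint T U -> is_adjoint U T.
Proof. by move=> h v w; rewrite innerC -h -innerC. Qed.

Lemma is_adjoint_comp T T' U U' :
  is_adjoint T T' -> is_adjoint U U' -> is_adjoint (T \o U) (U' \o T').
Proof. by move=> hT hU v w; rewrite /= hT hU. Qed.

Lemma is_adjoint_lin T T' U U' (a : C) : is_adjoint T T' -> is_adjoint U U' ->
  is_adjoint (a *: T + U) (a^* *: T' + U').
Proof.
move=> hT hU v w; change ('[a *: T v + U v, w] = '[v, a^* *: T' w + U' w]).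
by rewrite innerDl innerDr innerZl innerZr conjCK hT hU.
Qed.

Lemma adjoint_unique T U U' : is_adjoint T U -> is_adjoint T U' -> U = U'.
Proof.
by move=> h h'; apply/funext => w; apply: inner_injr => v; rewrite -h -h'.
Qed.

Lemma bounded_adjoint T U : bounded_operators T -> is_adjoint T U ->
  bounded_operators U.
Proof.
move=> /bounded_operatorsP[lT [M M0 hT]] h; apply/bounded_operatorsP; split.
  move=> a x y; apply: inner_injr => z.
  by rewrite -h innerDr innerZr !h -innerZr -innerDr.
exists M => // x; have [->|Ux] := eqVneq (U x) 0.
  by rewrite normr0 mulr_ge0.
rewrite -(ler_pM2r (x := `|U x|)) ?normr_gt0// -expr2 -inner_norm -h.
rewrite -[leLHS]ger0_norm; last by rewrite h inner_norm exprn_ge0.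
apply: le_trans (inner_CS _ _) _.
by rewrite mulrAC ler_wpM2r.
Qed.

(** Riesz representation of [v => '[T v, w]]: the functional is the inner product with a suitable
    multiple of a vector orthogonal to its kernel. *)
Lemma adjoint_exists T : bounded_operators T -> exists U, is_adjoint T U.
Proof.
move=> /bounded_operatorsP[lT [M M0 hT]].
suff h w : exists u, forall v, '[T v, w] = '[v, u].
  by have [U hU] := choice h; exists U => v w.
pose V := [set v | '[T v, w] = 0].
have Vcs : closed_subspace V.
  split=> [|a u v|p h]; rewrite /V /=.
  - by rewrite (lin0 lT) inner0l.
  - by move=> Vu Vv; rewrite lT innerDl innerZl Vu Vv mulr0 addr0.
  apply: (@eq0_norm_lt _ (scalars R)) => e e0.
  have c0 : 0 < M * `|w| + 1 by rewrite ltr_wpDl// mulr_ge0.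
  have [|v Vv pv] := h (e / (M * `|w| + 1)); first by rewrite divr_gt0.
  have -> : '[T p, w] = '[T (p - v), w] by rewrite (linB lT) innerBl Vv subr0.
  apply: (@le_lt_trans _ _ ((M * `|w| + 1) * `|p - v|)); last first.
    by rewrite mulrC -ltr_pdivlMr.
  apply: le_trans (inner_CS _ _) _; apply: (@le_trans _ _ (M * `|p - v| * `|w|)).
    by rewrite ler_wpM2r.
  by rewrite mulrAC ler_wpM2r// lerDl.
have [hV|] := pselect (forall v, V v).
  by exists 0 => v; rewrite inner0r; exact: hV.
move=> /existsNP[z0 z0V].
have [p Vp pz] := orthogonal_projection z0 Vcs.
set z := z0 - p in pz.
have Tz : '[T z, w] != 0.
  by apply/eqP => h; apply: z0V; rewrite /V /= -h (linB lT) innerBl Vp subr0.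
have z0' : '[z, z] != 0.
  by apply: contra_neq Tz => /inner_eq0 ->; rewrite (lin0 lT) inner0l.
exists (('[T z, w] / '[z, z])^* *: z) => v.
have : V (v - ('[T v, w] / '[T z, w]) *: z).
  by rewrite /V /= (linB lT) (linZ lT) innerBl innerZl divfK// subrr.
move/pz; rewrite innerC => /eqP; rewrite conjC_eq0 innerBl innerZl subr_eq0.
move=> /eqP h; rewrite innerZr conjCK h.
by rewrite mulrA mulrAC mulfVK// mulrC divfK.
Qed.

Lemma commutant_bounded S T : commutant S T -> bounded_operators T.
Proof. by case. Qed.

Lemma commutantE S T A x : commutant S T -> S A -> T (A x) = A (T x).
Proof. by move=> [_ h] /h /(congr1 (@^~ x)). Qed.

Lemma commutantS S M : S `<=` M -> commutant M `<=` commutant S.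
Proof. by move=> SM T [bT h]; split=> // A /SM; exact: h. Qed.

Lemma sub_bicommutant S : S `<=` @bounded_operators R E ->
  S `<=` commutant (commutant S).
Proof. by move=> Sb T ST; split=> [|A [_ hA]]; [exact: Sb|rewrite hA]. Qed.

Lemma commutant_comp S T U : commutant S T -> commutant S U ->
  commutant S (T \o U).
Proof.
move=> cT cU; split; first exact: bounded_comp (proj1 cT) (proj1 cU).
move=> A SA; apply/funext => x /=.
by rewrite (commutantE x cU SA) (commutantE _ cT SA).
Qed.

Lemma commutant_id S : commutant S id.
Proof. by split=> //; exact: bounded_id. Qed.

Lemma commutant0 S : S `<=` @bounded_operators R E -> commutant S 0.
Proof.
move=> Sb; split; first exact: bounded0.
by move=> A /Sb[lA _]; apply/funext => x /=; rewrite (lin0 lA).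
Qed.

Lemma commutant_lin S T U (a : C) : S `<=` @bounded_operators R E ->
  commutant S T -> commutant S U -> commutant S (a *: T + U).
Proof.
move=> Sb cT cU; split; first exact: bounded_lin (proj1 cT) (proj1 cU).
move=> A SA; apply/funext => x; change (a *: T (A x) + U (A x) =
  A (a *: T x + U x)).
have [lA _] := Sb _ SA.
by rewrite lA (commutantE x cU SA) (commutantE x cT SA).
Qed.

Definition self_adjoint_set S := forall T, S T -> exists2 U, S U & is_adjoint T U.

Lemma commutant_adjoint S T U : self_adjoint_set S -> commutant S T ->
  is_adjoint T U -> commutant S U.
Proof.
move=> Sa cT TU; split; first exact: bounded_adjoint (proj1 cT) TU.
move=> A SA; have [B SB AB] := Sa _ SA.
apply: (@adjoint_unique (B \o T)).
  exact: is_adjoint_comp (is_adjointC AB) TU.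
have -> : B \o T = T \o B by apply/funext => x; rewrite /= (commutantE _ cT SB).
exact: is_adjoint_comp TU (is_adjointC AB).
Qed.

Lemma commutant_self_adjoint S : self_adjoint_set S ->
  self_adjoint_set (commutant S).
Proof.
move=> Sa T cT; have [U TU] := adjoint_exists (proj1 cT).
by exists U => //; exact: commutant_adjoint TU.
Qed.

Lemma bicommutant_von_neumann S : S `<=` @bounded_operators R E ->
  self_adjoint_set S -> von_neumann (commutant (commutant S)).
Proof.
move=> Sb Sa; split.
- by move=> T [].
- by move=> T T' cT; exact: commutant_adjoint (commutant_self_adjoint Sa) cT.
- apply/seteqP; split; last by apply: sub_bicommutant => T [].
  by apply: commutantS; apply: sub_bicommutant => T [].
Qed.

Lemma vN_generatedE S : S `<=` @bounded_operators R E -> self_adjoint_set S ->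
  vN_generated S = commutant (commutant S).
Proof.
move=> Sb Sa; apply/seteqP; split.
  move=> T; apply; split; first exact: bicommutant_von_neumann.
  exact: sub_bicommutant.
move=> T cT M [[_ _ MM] SM]; rewrite -MM; apply: (commutantS _ cT).
exact: commutantS.
Qed.

Lemma von_neumann_generated S : S `<=` @bounded_operators R E -> self_adjoint_set S ->
  von_neumann (vN_generated S).
Proof. by move=> Sb Sa; rewrite vN_generatedE//; exact: bicommutant_von_neumann. Qed.

Lemma sub_vN_generated S : S `<=` vN_generated S.
Proof. by move=> T ST M [_ SM]; exact: SM. Qed.

Lemma vN_generated_sub S M : von_neumann M -> S `<=` M -> vN_generated S `<=` M.
Proof. by move=> vM SM T hT; exact: hT. Qed.

Section VonNeumann.
Variable M : set (E -> E).
Hypothesis vM : von_neumann M.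

Lemma vN_bounded T : M T -> bounded_operators T.
Proof. by have [+ _ _] := vM; apply. Qed.

Lemma vN_adjoint T U : M T -> is_adjoint T U -> M U.
Proof. by have [_ + _] := vM; apply. Qed.

Lemma vN_self_adjoint : self_adjoint_set M.
Proof.
move=> T MT; have [U TU] := adjoint_exists (vN_bounded MT).
by exists U => //; exact: vN_adjoint TU.
Qed.

Let Mb : commutant M `<=` @bounded_operators R E. Proof. by move=> T []. Qed.

Lemma vN_id : M id.
Proof. by have [_ _ <-] := vM; exact: commutant_id. Qed.
Lemma vN_zero : M 0.
Proof. by have [_ _ <-] := vM; exact: commutant0. Qed.
Lemma vN_comp T U : M T -> M U -> M (T \o U).
Proof. by have [_ _ <-] := vM; exact: commutant_comp. Qed.
Lemma vN_lin T U (a : C) : M T -> M U -> M (a *: T + U).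
Proof. by have [_ _ <-] := vM; exact: commutant_lin. Qed.
Lemma vN_add T U : M T -> M U -> M (T + U).
Proof. by move=> MT MU; rewrite -[T]scale1r; exact: vN_lin. Qed.
Lemma vN_scale T (a : C) : M T -> M (a *: T).
Proof. by move=> MT; rewrite -[_ *: _]addr0; apply: vN_lin => //; exact: vN_zero. Qed.
Lemma vN_sum (I : Type) (r : seq I) (P : pred I) (F : I -> E -> E) :
  (forall i, P i -> M (F i)) -> M (\sum_(i <- r | P i) F i).
Proof. by move=> h; apply: big_ind => //; [exact: vN_zero|exact: vN_add]. Qed.

Lemma vN_commute T : bounded_operators T ->
  (forall A, commutant M A -> A \o T = T \o A) -> M T.
Proof. by move=> bT h; have [_ _ <-] := vM; split=> // A /h ->. Qed.
End VonNeumann.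
End Operators.

(** * Commutation with unitaries *)

Section Cayley.
Variables (R : realType) (E : hilbert R).
Local Notation C := R[i].
Local Notation "''[' x , y ]" := (inner E x y) : ring_scope.
Implicit Types (M : set (E -> E)) (T U X Y A : E -> E).

(** The conditions on [s] make it ['i] or [- 'i]; the cross terms cancel because [X] is self-adjoint
    and [s] imaginary. *)
Lemma shifted_norm X (s : C) v : is_adjoint X X -> s^* = - s -> s * s = -1 ->
  `|X v + s *: v| ^+ 2 = `|X v| ^+ 2 + `|v| ^+ 2.
Proof.
move=> Xs sN ss; rewrite -!inner_norm innerDl !innerDr !innerZr !innerZl.
have -> : '[X v, v] = '[v, X v] by exact: Xs.
rewrite sN; set a := '[X v, X v]; set b := '[v, X v]; set c := '[v, v].
by transitivity (a - (s * s) * c); [ring|rewrite ss; ring].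
Qed.

(** The range of [X + s] is closed because [X + s] does not shrink norms, and nothing nonzero is
    orthogonal to it because a self-adjoint operator has no imaginary eigenvalue. *)
Lemma shifted_bijective X (s : C) : bounded_operators X -> is_adjoint X X ->
  s^* = - s -> s * s = -1 -> forall x, exists v, X v + s *: v = x.
Proof.
move=> bX Xs sN ss.
pose Y v := X v + s *: v.
have bY : bounded_operators Y.
  have -> : Y = s *: id + X by apply/funext => v; rewrite /Y addrC.
  apply: bounded_lin bX; exact: bounded_id.
have lY := bounded_linear bY.
have Yge v : `|v| <= `|Y v|.
  by rewrite -(@ler_pXn2r _ 2)// ?nnegrE// shifted_norm// lerDr exprn_ge0.
pose V := [set Y v | v in [set: E]].
(* Preimages of better and better approximations of [p] form a Cauchy filter by [Yge]; its limit is
   a preimage of [p]. *)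
have Vcs : closed_subspace V.
  split=> [|a _ _ [u _ <-] [v _ <-]|p h]; first by exists 0; rewrite ?(lin0 lY).
    by exists (a *: u + v) => //; rewrite lY.
  pose S (e : C) := [set v | `|p - Y v| < e].
  pose F : set_system E := filter_from [set e | 0 < e] S.
  have FF : ProperFilter F.
    apply: filter_from_proper; last by move=> e /h[_ [v _ <-]]; exists v.
    apply: filter_from_filter; first by exists 1 => /=.
    move=> e' f' /gt0_complexE[e'E]; move: (complex.Re e') e'E => e -> {e'} e0.
    move=> /gt0_complexE[f'E]; move: (complex.Re f') f'E => f -> {f'} f0.
    exists (Num.min e f)%:C%C; first by rewrite /= ltcR lt_min e0.
    by move=> v Sv; split; apply: lt_le_trans Sv _; rewrite lecR ge_min lexx ?orbT.
  have Fc : cauchy F.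
    apply/cauchyP => e e0; have e2 : 0 < e / 2 by rewrite divr_gt0.
    have [_ [v _ <-] pv] := h _ e2; exists v; exists (e / 2) => // u pu.
    rewrite -ball_normE /=; apply: le_lt_trans (Yge _) _.
    have -> : Y (v - u) = (p - Y u) - (p - Y v).
      by rewrite (linB lY) opprB [RHS]addrC addrA subrK.
    by rewrite (splitr e); apply: le_lt_trans (ler_normB _ _) (ltrD pu pv).
  have /cvg_ex[v Fv] : cvg F by exact: cauchy_cvg.
  exists v => //; apply/eqP; rewrite eq_sym -subr_eq0; apply/eqP.
  apply: eq0_norm_lt => e e0; have e2 : 0 < e / 2 by rewrite divr_gt0.
  have [_ cY] := bY.
  have /cvgrPdist_lt/(_ _ e2) h1 := cY v.
  have FS : F (S (e / 2)) by exists (e / 2).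
  have [u [Su /= hu]] := filter_ex (filterI FS (Fv _ h1)).
  rewrite (splitr e); have -> : p - Y v = (p - Y u) - (Y v - Y u).
    by rewrite opprB addrA subrK.
  exact: le_lt_trans (ler_normB _ _) (ltrD Su hu).
move=> x; have [_ [v _ <-] hz] := orthogonal_projection x Vcs.
exists v; apply/eqP; rewrite eq_sym -subr_eq0; apply/eqP; set z := x - Y v in hz *.
(* Orthogonality of [z] to every [X w + s *: w] says that [z] is an eigenvector. *)
have Xz : X z = s *: z.
  apply: inner_injl => w; have := hz (Y w); rewrite /Y innerDr innerZr sN -Xs.
  move=> /(_ (ex_intro2 _ _ w I erefl)) /eqP.
  by rewrite mulNr subr_eq0 innerZl => /eqP.
apply: inner_eq0; have := Xs z z; rewrite Xz innerZl innerZr sN mulNr => /eqP.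
rewrite -subr_eq0 opprK -mulr2n mulrn_eq0/= mulf_eq0 => /orP[/eqP s0|/eqP//].
by move: ss => /eqP; rewrite s0 mul0r eq_sym oppr_eq0 oner_eq0.
Qed.

Lemma shifted_inverse X (s : C) : bounded_operators X -> is_adjoint X X ->
  s^* = - s -> s * s = -1 -> exists T, [/\ bounded_operators T,
    forall v, X (T v) + s *: T v = v & forall v, T (X v + s *: v) = v].
Proof.
move=> bX Xs sN ss; have lX := bounded_linear bX.
have [T hT] := choice (shifted_bijective bX Xs sN ss).
have inj u v : X u + s *: u = X v + s *: v -> u = v.
  move=> /eqP; rewrite -subr_eq0 opprD addrACA -scalerBr -(linB lX) => /eqP h.
  apply/eqP; rewrite -subr_eq0 -normr_eq0 -sqrf_eq0.
  have := shifted_norm (u - v) Xs sN ss; rewrite h normr0 expr0n/= => /eqP.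
  by rewrite eq_sym paddr_eq0 ?exprn_ge0// => /andP[].
exists T; split=> //; last by move=> v; apply: inj; rewrite hT.
apply/bounded_operatorsP; split.
  move=> a x y; apply: inj; rewrite hT lX scalerDr addrACA -{1}[x]hT -{1}[y]hT.
  by rewrite scalerDr !scalerA [s * a]mulrC.
exists 1 => // x; rewrite mul1r -{2}[x]hT.
by rewrite -(@ler_pXn2r _ 2)// ?nnegrE// shifted_norm// lerDr exprn_ge0.
Qed.

Definition unitary_pair U U' := [/\ is_adjoint U U', U \o U' = id & U' \o U = id].

(* Through the Cayley transform (X - i)(X + i)^-1 = 1 - 2i(X + i)^-1 of a
   self-adjoint X, commuting with unitaries amounts to commuting with X. *)
Lemma commute_self_adjoint M X A : von_neumann M -> M X -> is_adjoint X X ->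
  linear A ->
  (forall U U', M U -> M U' -> unitary_pair U U' -> A \o U = U \o A) ->
  A \o X = X \o A.
Proof.
move=> vM MX Xs lA hA; have bX := vN_bounded vM MX; have lX := bounded_linear bX.
have iN : ('i : C)^* = - 'i by exact: conjCi.
have ii : ('i : C) * 'i = -1 by rewrite -expr2 sqrCi.
have iN' : (- 'i : C)^* = - - 'i by rewrite rmorphN/= iN.
have ii' : (- 'i : C) * - 'i = -1 by rewrite mulrNN.
have [T [bT XT TX]] := shifted_inverse bX Xs iN ii.
have [T' [bT' XT' TX']] := shifted_inverse bX Xs iN' ii'.
have M_inv (s : C) S : bounded_operators S ->
    (forall v, X (S v) + s *: S v = v) -> (forall v, S (X v + s *: v) = v) -> M S.
  move=> bS XS SX; apply: vN_commute => // B cB; apply/funext => v /=.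
  have lB := bounded_linear (commutant_bounded cB).
  rewrite -{2}[v]XS (linD lB) (linZ lB) (commutantE _ cB MX) SX.
  by [].
have TT' v w : '[T v, w] = '[v, T' w].
  rewrite -{2}[v]XT -{1}[w]XT' innerDl innerDr innerZl innerZr Xs iN'.
  by rewrite opprK.
pose U := (- 2 * 'i : C) *: T + id; pose U' := (2 * 'i : C) *: T' + id.
have MT : M T by exact: M_inv XT TX.
have MT' : M T' by exact: M_inv XT' TX'.
have UE v : U v = X (T v) - 'i *: T v.
  change ((- 2 * 'i : C) *: T v + v = X (T v) - 'i *: T v).
  rewrite -{2}[v]XT addrC -addrA -scalerDl; congr (_ + _); rewrite -scaleNr.
  by congr (_ *: _); ring.
have U'E v : U' v = X (T' v) + 'i *: T' v.
  change ((2 * 'i : C) *: T' v + v = X (T' v) + 'i *: T' v).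
  rewrite -{2}[v]XT' addrC -addrA -scalerDl; congr (_ + _).
  by congr (_ *: _); ring.
have Upair : unitary_pair U U'.
  split.
  - have -> : U' = (- 2 * 'i : C)^* *: T' + id.
      by rewrite /U' rmorphM rmorphN/= iN mulrNN conjC_nat.
    exact: is_adjoint_lin.
  - apply/funext => v /=; rewrite UE U'E TX.
    by have := XT' v; rewrite scaleNr.
  - by apply/funext => v /=; rewrite U'E UE -scaleNr TX' XT.
have /(congr1 (fun f => f _))AU : A \o U = U \o A.
  by apply: hA Upair; apply: vN_lin => //; exact: vN_id.
have AT v : A (T v) = T (A v).
  have : A ((- 2 * 'i : C) *: T v + v) = (- 2 * 'i : C) *: T (A v) + A v by exact: AU.
  rewrite (linD lA) (linZ lA) => /addIr/scalerI; apply.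
  by rewrite mulf_neq0 ?oppr_eq0 ?pnatr_eq0// neq0Ci.
apply/funext => v /=; have := XT (A (X v + 'i *: v)).
rewrite -AT TX (linD lA) (linZ lA) => /addIr ->.
by [].
Qed.

(** [T] is half the sum of [T + T'] and [T - T'], where [T'] is its adjoint. The first is
    self-adjoint, the second becomes so after multiplication by ['i], and the Cayley transform
    treats both. *)
Lemma commute_unitaries M T A : von_neumann M -> M T -> linear A ->
  (forall U U', M U -> M U' -> unitary_pair U U' -> A \o U = U \o A) ->
  A \o T = T \o A.
Proof.
move=> vM MT lA hA; have [T' MT' TT'] := vN_self_adjoint vM MT.
pose X : E -> E := (1 : C) *: T + T'; pose Y : E -> E := ('i : C) *: T + (- 'i : C) *: T'.
have MX : M X by exact: vN_lin.
have MY : M Y by apply: vN_lin => //; exact: vN_scale.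
have Xs : is_adjoint X X.
  move=> v w; change ('[(1 : C) *: T v + T' v, w] = '[v, (1 : C) *: T w + T' w]).
  by rewrite !scale1r innerDl innerDr TT' (is_adjointC TT') addrC.
have Ys : is_adjoint Y Y.
  move=> v w; change ('[('i : C) *: T v + (- 'i : C) *: T' v, w] =
    '[v, ('i : C) *: T w + (- 'i : C) *: T' w]).
  rewrite innerDl innerDr !innerZl !innerZr TT' (is_adjointC TT') rmorphN/= conjCi.
  by rewrite opprK addrC.
have hX := commute_self_adjoint vM MX Xs lA hA.
have hY := commute_self_adjoint vM MY Ys lA hA.
apply/funext => v /=.
have : A ((1 : C) *: T v + T' v) = (1 : C) *: T (A v) + T' (A v).
  exact: (congr1 (@^~ v) hX).
have : A (('i : C) *: T v + (- 'i : C) *: T' v) =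
    ('i : C) *: T (A v) + (- 'i : C) *: T' (A v).
  exact: (congr1 (@^~ v) hY).
rewrite !(linD lA) !(linZ lA) !scale1r !scaleNr -!scalerBr => /scalerI h.
have {}h := h (neq0Ci _); move=> h'.
have dbl (a b : E) : a - b + (a + b) = (2 : C) *: a.
  by rewrite addrACA addNr addr0 -mulr2n scaler_nat.
have : (2 : C) *: A (T v) = (2 : C) *: T (A v) by rewrite -(dbl _ (A (T' v))) h h' dbl.
by move=> /scalerI; apply; rewrite pnatr_eq0.
Qed.
End Cayley.

(** * Square-summable families *)

Section SquareSummableFamilies.
Variables (R : realType) (I : choiceType) (E : hilbert R).
Local Notation C := R[i].
Local Notation L := (l2 I E).
Local Notation "''[' x , y ]" := (inner (l2_hilbert I E) x y) : ring_scope.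
Implicit Types (xi eta : L) (D : set I) (i : I) (v w : E).

Lemma l2_dominated (x : I -> E) xi : (forall i, `|x i| <= `|xi i|) ->
  x \in @l2_pred R I E.
Proof.
move=> h; have [M xiM] := l2P xi; apply/asboolP; exists M => A.
apply: le_trans (xiM A); apply: ler_sum => i _.
by rewrite ler_pXn2r ?nnegrE.
Qed.

Lemma mask_subproof D xi :
  (fun i => if `[< D i >] then xi i else 0) \in @l2_pred R I E.
Proof.
by apply: (@l2_dominated _ xi) => i; case: ifP => // _; rewrite normr0.
Qed.

Definition mask D xi : L := L2 (mask_subproof D xi).

Lemma maskT D xi i : D i -> mask D xi i = xi i.
Proof. by move=> Di; rewrite /= asboolT. Qed.

Lemma maskF D xi i : ~ D i -> mask D xi i = 0.
Proof. by move=> Di; rewrite /= asboolF. Qed.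

Lemma single_subproof i v : (fun j => if j == i then v else 0) \in @l2_pred R I E.
Proof.
apply/asboolP; exists (`|v| ^+ 2) => A.
apply: (@le_trans _ _ (\sum_(j <- A | j == i) `|v| ^+ 2)).
  rewrite [leRHS]big_mkcond/=; apply: ler_sum => j _.
  by case: ifP => // _; rewrite normr0 expr0n.
rewrite big_const_seq iter_addr_0.
have : (count (fun j => j == i) A <= 1)%N.
  by rewrite (@count_uniq_mem _ _ i)// leq_b1.
by case: count => [|[|//]] _; rewrite ?mulr0n ?mulr1n// exprn_ge0.
Qed.

Definition single i v : L := L2 (single_subproof i v).

Lemma singleE i v : single i v i = v.
Proof. by rewrite /= eqxx. Qed.

Lemma singleF i j v : j <> i -> single i v j = 0.
Proof. by move=> /eqP/negPf /= ->. Qed.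

Lemma single_lin i (a : C) v w : single i (a *: v + w) = a *: single i v + single i w.
Proof.
apply: l2ext => j; change (single i (a *: v + w) j = a *: single i v j + single i w j).
by rewrite /=; case: eqP => // _; rewrite scaler0 addr0.
Qed.

Lemma l2_sum (T : Type) (r : seq T) (P : pred T) (F : T -> L) i :
  (\sum_(t <- r | P t) F t) i = \sum_(t <- r | P t) F t i.
Proof.
apply: (big_morph (fun x : L => x i)) => //.
Qed.

Lemma mask_lin D (a : C) xi eta : mask D (a *: xi + eta) = a *: mask D xi + mask D eta.
Proof.
apply: l2ext => j; change (mask D (a *: xi + eta) j = a *: mask D xi j + mask D eta j).
by rewrite /=; case: asboolP => // _; rewrite scaler0 addr0.
Qed.

Lemma mask_mask D D' xi : mask D (mask D' xi) = mask (D `&` D') xi.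
Proof.
apply: l2ext => j /=; case: asboolP => h; case: asboolP => h'.
- by rewrite asboolT.
- by rewrite asboolF// => -[].
- by case: h'.
- by [].
Qed.

Lemma mask_single D i v : D i -> mask D (single i v) = single i v.
Proof.
move=> Di; apply: l2ext => j /=; have [->|ji] := eqVneq j i.
  by rewrite asboolT.
by rewrite if_same.
Qed.

Lemma mask_single0 D i v : ~ D i -> mask D (single i v) = 0.
Proof.
move=> Di; apply: l2ext => j; change (mask D (single i v) j = 0) => /=.
by have [->|ji] := eqVneq j i; [rewrite asboolF|rewrite if_same].
Qed.

Lemma mask_set1 xi i : mask [set i] xi = single i (xi i).
Proof.
apply: l2ext => j /=; case: eqP => [->|ji]; first by rewrite asboolT.
by rewrite asboolF.
Qed.

Lemma inner_support xi eta (A : {fset I}) :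
  (forall i, i \notin A -> inner E (xi i) (eta i) = 0) ->
  '[xi, eta] = \sum_(i <- A) inner E (xi i) (eta i).
Proof.
move=> h; apply: cvg_l2_inner; apply: cvg_near_cst.
exists A => // B /= AB; rewrite partial_sum_eq (big_fsetID _ (mem A))/= addrC.
rewrite big1_fset ?add0r => [|i]; last by rewrite !inE/= => /andP[_ /h].
apply: eq_fbigl => i; rewrite !inE/=; apply: andb_idl; exact: (fsubsetP AB).
Qed.

Lemma inner_disjoint xi eta : (forall i, inner E (xi i) (eta i) = 0) -> '[xi, eta] = 0.
Proof. by move=> h; rewrite (@inner_support _ _ fset0)// big_seq_fset0. Qed.

Lemma inner_single xi i v : '[xi, single i v] = inner E (xi i) v.
Proof.
rewrite (@inner_support _ _ [fset i]%fset) ?big_seq_fset1 ?singleE// => j.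
by rewrite inE => /eqP ji; rewrite singleF// inner0r.
Qed.

Lemma norm_single i v : `|single i v| = `|v|.
Proof.
apply/eqP; rewrite -(@eqrXn2 _ 2)//; apply/eqP.
by rewrite -(@inner_norm _ (l2_hilbert I E)) inner_single singleE inner_norm.
Qed.

Lemma inner_mask D xi eta : '[mask D xi, eta] = '[xi, mask D eta].
Proof.
apply/eqP; rewrite -subr_eq0; apply/eqP.
have -> : '[mask D xi, eta] - '[xi, mask D eta] =
    '[mask D xi, eta - mask D eta] - '[xi - mask D xi, mask D eta].
  by rewrite innerBl innerBr; ring.
have s z : z - mask D z = mask (~` D) z.
  apply: l2ext => j; change (z j - mask D z j = mask (~` D) z j).
  have [Dj|Dj] := pselect (D j).
    by rewrite maskT// maskF// subrr.
  by rewrite maskF// maskT// subr0.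
rewrite !s !inner_disjoint ?subrr// => j; have [Dj|Dj] := pselect (D j).
- by rewrite [in X in inner _ X _]maskF// inner0l.
- by rewrite [in X in inner _ _ X]maskF// inner0r.
- by rewrite [in X in inner _ _ X]maskF// inner0r.
- by rewrite [in X in inner _ X _]maskF// inner0l.
Qed.

Lemma mask_setU D D' xi : D `&` D' = set0 ->
  `|mask (D `|` D') xi| ^+ 2 = `|mask D xi| ^+ 2 + `|mask D' xi| ^+ 2.
Proof.
move=> DD'; have dd j : D j -> ~ D' j by move=> Dj D'j; rewrite -[False]/(set0 j) -DD'.
have -> : mask (D `|` D') xi = mask D xi + mask D' xi.
  apply: l2ext => j; change (mask (D `|` D') xi j = mask D xi j + mask D' xi j).
  have [Dj|Dj] := pselect (D j).
    by rewrite maskT; [rewrite maskT// maskF ?addr0//; exact: dd|left].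
  have [D'j|D'j] := pselect (D' j).
    by rewrite maskT; [rewrite maskF// maskT// add0r|right].
  by rewrite !maskF ?addr0// => -[].
apply: (@pythagoras _ (l2_hilbert I E)); apply: inner_disjoint => j.
have [Dj|Dj] := pselect (D j).
  by rewrite [in X in inner _ _ X]maskF ?inner0r//; exact: dd.
by rewrite [in X in inner _ X _]maskF// inner0l.
Qed.

Lemma norm_mask D xi : `|mask D xi| <= `|xi|.
Proof.
have -> : xi = mask (D `|` ~` D) xi by apply: l2ext => j; rewrite setUv maskT.
rewrite mask_mask setUv setIT.
rewrite -(@ler_pXn2r _ 2)// ?nnegrE// -(setUv D) mask_setU ?setICr//.
by rewrite lerDl exprn_ge0.
Qed.

Lemma mask_bounded D : bounded_operators (mask D : l2_hilbert I E -> l2_hilbert I E).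
Proof.
apply/bounded_operatorsP; split; first by move=> a x y; exact: mask_lin.
by exists 1 => // x; rewrite mul1r; exact: norm_mask.
Qed.

Lemma mask_fset (A : {fset I}) xi :
  mask [set` A] xi = \sum_(i <- A) single i (xi i).
Proof.
apply: l2ext => j; rewrite l2_sum; have [jA|jA] := boolP (j \in A).
  rewrite maskT//= (big_fsetD1 j)//= eqxx big1_fset ?addr0// => i.
  by rewrite !inE eq_sym => /andP[/negPf ->].
rewrite maskF/=; last exact/negP.
rewrite big1_fset// => i iA _; case: eqP => // ji.
by move: jA; rewrite ji iA.
Qed.

(** The estimate holds for every larger finite set, so that two approximations can later be compared
    on a common one. *)
Lemma mask_approx xi (e : C) : 0 < e -> exists A : {fset I},
  forall B : {fset I}, (A `<=` B)%fset -> `|xi - mask [set` B] xi| < e.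
Proof.
move=> e0; have [s [sc _ _]] := l2_sqr xi.
have sE : s = `|xi| ^+ 2 by rewrite l2_norm_sqr (cvg_l2_inner sc).
have e2 : 0 < e ^+ 2 by rewrite exprn_gt0.
have /cvgrPdist_lt/(_ _ e2)[A _ hA] := sc.
exists A => B /hA /=; rewrite partial_sum_eq => h.
rewrite -(@ltr_pXn2r _ 2)// ?nnegrE ?(ltW e0)//; apply: le_lt_trans h.
have -> : xi - mask [set` B] xi = mask (~` [set` B]) xi.
  apply: l2ext => j; change (xi j - mask [set` B] xi j = mask (~` [set` B]) xi j).
  have [Dj|Dj] := pselect ([set` B] j).
    by rewrite maskT// maskF// subrr.
  by rewrite maskF// maskT// subr0.
have := @mask_setU [set` B] (~` [set` B]) xi (setICr _).
have -> : mask ([set` B] `|` ~` [set` B]) xi = xi.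
  by apply: l2ext => j; rewrite setUv maskT.
move=> h; apply: le_trans (real_ler_norm _); last first.
  by rewrite realB// ger0_real// ?sE ?exprn_ge0// sumr_ge0// => i _; exact: dnorm_ge0.
rewrite sE h; rewrite [leRHS]addrAC lerDr subr_ge0.
apply: le_trans (l2_norm_ge _ B); rewrite big_seq [leRHS]big_seq.
by apply: ler_sum => i iB; rewrite maskT// inner_norm.
Qed.

Lemma linear_l2_approx (V : normedModType C) (f : L -> V) xi (e : C) :
  linear f -> continuous f -> 0 < e -> exists A : {fset I},
  forall B : {fset I}, (A `<=` B)%fset ->
    `|f xi - \sum_(i <- B) f (single i (xi i))| < e.
Proof.
move=> lf /(continuous_linearP lf)[M M0 hM] e0.
have M1 : 0 < M + 1 by rewrite ltr_wpDl.
have [|A hA] := @mask_approx xi (e / (M + 1)); first by rewrite divr_gt0.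
exists A => B /hA h; rewrite -(lin_sum lf) -mask_fset -(linB lf).
apply: le_lt_trans (hM _) _; move: h; rewrite ltr_pdivlMr// mulrC; apply: le_lt_trans.
by rewrite ler_wpM2r// lerDl.
Qed.

Lemma linear_l2_eq (V : normedModType C) (f g : L -> V) :
  linear f -> continuous f -> linear g -> continuous g ->
  (forall i v, f (single i v) = g (single i v)) -> f = g.
Proof.
move=> lf cf lg cg h; apply/funext => xi; apply/eqP; rewrite -subr_eq0; apply/eqP.
apply: eq0_norm_lt => e e0; have e2 : 0 < e / 2 by rewrite divr_gt0.
have [A hA] := linear_l2_approx xi lf cf e2.
have [B hB] := linear_l2_approx xi lg cg e2.
have := hA _ (fsubsetUl A B); have := hB _ (fsubsetUr A B).
under eq_bigr do rewrite -h; set s := \sum_(i <- _) _ => h1 h2.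
have -> : f xi - g xi = (f xi - s) - (g xi - s) by rewrite opprB addrA subrK.
by rewrite (splitr e); exact: le_lt_trans (ler_normB _ _) (ltrD h2 h1).
Qed.

Lemma sum_mask_le (T : eqType) (r : seq T) (D : T -> set I) xi : uniq r ->
  (forall s t, s \in r -> t \in r -> s != t -> D s `&` D t = set0) ->
  \sum_(t <- r) `|mask (D t) xi| ^+ 2 <= `|xi| ^+ 2.
Proof.
move=> ur Dr; apply: (@le_trans _ _ (`|mask (\bigcup_(t in [set` r]) D t) xi| ^+ 2)); last first.
  by rewrite ler_pXn2r ?nnegrE//; exact: norm_mask.
rewrite le_eqVlt; apply/orP; left; apply/eqP.
elim: r ur Dr => [|t r IH]/=.
  move=> _ _; rewrite big_nil; set z := mask _ _.
  have -> : z = 0 by apply: l2ext => j; rewrite maskF// => -[].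
  by rewrite normr0 expr0n.
move=> /andP[tr ur] Dr; rewrite big_cons IH//; last first.
  by move=> s s' sr s'r; apply: Dr; rewrite inE ?sr ?s'r orbT.
rewrite -mask_setU; last first.
  rewrite setI_bigcupr; apply/seteqP; split=> // j [s sr].
  by rewrite Dr ?inE ?eqxx//; [rewrite [s \in r]sr orbT|apply: contraNneq tr => ->].
congr (`|mask _ _| ^+ 2); apply/seteqP; split=> j.
  by move=> [Dj|[s sr Dj]]; [exists t|exists s] => //=; rewrite inE ?eqxx ?[s \in r]sr ?orbT.
by move=> [s]; rewrite /= inE => /orP[/eqP ->|sr] Dj; [left|right; exists s].
Qed.
End SquareSummableFamilies.

Lemma subrBB (V : zmodType) (a b c : V) : a - b = (c - b) - (c - a).
Proof. by rewrite opprB [RHS]addrC addrA subrK. Qed.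

(** * Density of a *-algebra in its bicommutant *)

Section Density.
Variables (R : realType) (I : choiceType) (E : hilbert R).
Local Notation C := R[i].
Local Notation L := (l2_hilbert I E).
Local Notation "''[' x , y ]" := (inner L x y) : ring_scope.

Lemma bounded_l2 (f : E -> E) (xi : l2 I E) (M : C) : 0 <= M ->
  (forall v, `|f v| <= M * `|v|) ->
  (fun i => f (xi i)) \in @l2_pred R I E.
Proof.
move=> M0 hM; apply: (@l2_dominated _ _ _ _ (M *: xi)) => i.
by rewrite l2Z normrZ ger0_norm.
Qed.

Lemma amplify_subproof (T : E -> E) (bT : bounded_operators T) (xi : l2 I E) :
  (fun i => T (xi i)) \in @l2_pred R I E.
Proof.
by have /bounded_operatorsP[_ [M M0 hM]] := bT; exact: bounded_l2 hM.
Qed.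

Definition amplify (T : E -> E) (bT : bounded_operators T) (xi : L) : L :=
  L2 (amplify_subproof bT xi).

Lemma norm_amplify (T : E -> E) (bT : bounded_operators T) :
  exists2 M : C, 0 <= M & forall xi : L, `|amplify bT xi| <= M * `|xi|.
Proof.
have /bounded_operatorsP[_ [M M0 hM]] := bT; exists M => // xi.
apply: l2_norm_le; first exact: mulr_ge0.
move=> A; rewrite exprMn; apply: le_trans (ler_wpM2l _ (l2_norm_ge xi A)); last first.
  exact: exprn_ge0.
rewrite mulr_sumr; apply: ler_sum => i _; rewrite -exprMn.
by rewrite ler_pXn2r ?nnegrE ?mulr_ge0//=.
Qed.

Lemma amplify_bounded (T : E -> E) (bT : bounded_operators T) :
  bounded_operators (amplify bT).
Proof.
apply/bounded_operatorsP; split; last exact: norm_amplify.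
move=> a x y; apply: l2ext => i.
exact: (bounded_linear bT).
Qed.

Lemma amplify_single (T : E -> E) (bT : bounded_operators T) i v :
  amplify bT (single i v) = single i (T v).
Proof.
apply: l2ext => j /=; case: eqP => // _.
exact: (lin0 (bounded_linear bT)).
Qed.

Lemma amplify_adjoint (T T' : E -> E) (bT : bounded_operators T)
  (bT' : bounded_operators T') :
  is_adjoint T T' -> is_adjoint (amplify bT) (amplify bT').
Proof.
move=> TT' xi eta; change (l2_inner (amplify bT xi) eta = l2_inner xi (amplify bT' eta)).
rewrite /l2_inner (_ : (fun i => inner E (amplify bT xi i) _) =
  (fun i => inner E ((xi : l2 I E) i) (amplify bT' eta i)))//.
by apply/funext => i; exact: TT'.
Qed.

(** von Neumann's argument. The projection [P] onto the closure of [A xi] commutes with the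
    amplified [A], so its matrix entries lie in the commutant of [A]; hence [T] commutes with [P]
    and keeps [xi] inside the closure. An arbitrary index type [I] allows infinitely many vectors to
    be approximated at once. *)
Lemma bicommutant_density (A : set (E -> E)) (T : E -> E) (xi : L) (e : C) :
  A `<=` @bounded_operators R E -> self_adjoint_set A ->
  A id -> (forall a S S', A S -> A S' -> A (a *: S + S')) ->
  (forall S S', A S -> A S' -> A (S \o S')) ->
  commutant (commutant A) T -> 0 < e ->
  exists2 S, A S & forall B : {fset I},
    \sum_(i <- B) `|T (xi i) - S (xi i)| ^+ 2 <= e.
Proof.
move=> Ab Asa A1 Alin Acomp cT.
suff main (d : C) : 0 < d ->
    exists2 S, A S & exists bS : bounded_operators S,
    `|amplify (proj1 cT) xi - amplify bS xi| < d.
  move=> e0; have [|S AS [bS h]] := main (sqrtC e); first by rewrite sqrtC_gt0.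
  exists S => // B; apply: (@le_trans _ _ (sqrtC e ^+ 2)); last by rewrite sqrtCK.
  apply: le_trans (l2_norm_ge (amplify (proj1 cT) xi - amplify bS xi) B) _.
  by rewrite ler_pXn2r ?nnegrE ?sqrtC_ge0 ?(ltW e0)// ltW.
(* The closure of the orbit of [xi] under the amplified [A]. *)
pose V := [set eta : L | forall d, 0 < d -> exists2 S, A S & exists bS : bounded_operators S,
    `|eta - amplify bS xi| < d].
suff : V (amplify (proj1 cT) xi) by exact.
have Vxi : V xi.
  move=> d' d'0; exists id => //; exists (@bounded_id _ _).
  have -> : amplify (@bounded_id _ _) xi = xi by exact: l2ext.
  by rewrite subrr normr0.
have Vamp (S : E -> E) (bS : bounded_operators S) eta : A S -> V eta -> V (amplify bS eta).
  move=> AS Veta d' d'0; have [M M0 hM] := norm_amplify bS.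
  have M1 : 0 < M + 1 by rewrite ltr_wpDl.
  have [|U AU [bU h]] := Veta (d' / (M + 1)); first by rewrite divr_gt0.
  exists (S \o U); first exact: Acomp; exists (bounded_comp bS bU).
  have -> : amplify (bounded_comp bS bU) xi = amplify bS (amplify bU xi) by exact: l2ext.
  rewrite -(linB (bounded_linear (amplify_bounded bS))).
  apply: le_lt_trans (hM _) _; move: h; rewrite ltr_pdivlMr// mulrC; apply: le_lt_trans.
  by rewrite ler_wpM2r// lerDl.
have Vcs : closed_subspace V.
  split=> [d' d'0|a eta zeta Veta Vzeta d' d'0|p h d' d'0].
  - exists ((-1 : C) *: id + id); first exact: Alin.
    exists (bounded_lin (-1) (@bounded_id _ _) (@bounded_id _ _)).
    set z := amplify _ _; have -> : z = 0.
      by apply: l2ext => i; rewrite /z; change ((-1 : C) *: xi i + xi i = 0);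
        rewrite scaleN1r addNr.
    by rewrite subrr normr0.
  - have a1 : 0 < `|a| + 1 by rewrite ltr_wpDl.
    have [|S AS [bS h]] := Veta (d' / 2 / (`|a| + 1)); first by rewrite !divr_gt0.
    have [|U AU [bU h']] := Vzeta (d' / 2); first by rewrite divr_gt0.
    exists (a *: S + U); first exact: Alin; exists (bounded_lin a bS bU).
    have -> : amplify (bounded_lin a bS bU) xi = a *: amplify bS xi + amplify bU xi.
      exact: l2ext.
    rewrite opprD addrACA -scalerBr (splitr d').
    apply: le_lt_trans (ler_normD _ _) _; apply: ltrD => //.
    rewrite normrZ mulrC; move: h; rewrite ltr_pdivlMr//; apply: le_lt_trans.
    by rewrite ler_wpM2l// lerDl.
  - have d2 : 0 < d' / 2 by rewrite divr_gt0.
    have [v Vv pv] := h _ d2; have [S AS [bS hS]] := Vv _ d2.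
    exists S => //; exists bS.
    have -> : p - amplify bS xi = (p - v) + (v - amplify bS xi) by rewrite addrA subrK.
    by rewrite (splitr d'); exact: le_lt_trans (ler_normD _ _) (ltrD pv hS).
have /choice[P hP] : forall x, exists p, V p /\ forall v, V v -> '[x - p, v] = 0.
  by move=> x; have [p Vp h] := orthogonal_projection x Vcs; exists p.
have [V0 Vlin _] := Vcs.
have VB u v : V u -> V v -> V (u - v).
  by move=> Vu Vv; rewrite -scaleN1r addrC; exact: Vlin.
(* [P] comes from a choice; uniqueness of the projection gives its linearity and its commutation
   with [A]. *)
have Puniq x p : V p -> (forall v, V v -> '[x - p, v] = 0) -> P x = p.
  move=> Vp h; have [VP hPx] := hP x.
  apply/eqP; rewrite -subr_eq0; apply/eqP/inner_eq0.
  have -> : '[P x - p, P x - p] = '[x - p, P x - p] - '[x - P x, P x - p].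
    by rewrite -innerBl -subrBB.
  by rewrite (h _ (VB _ _ VP Vp)) (hPx _ (VB _ _ VP Vp)) subr0.
have Plin : linear P.
  move=> a x y; have [Vx hx] := hP x; have [Vy hy] := hP y.
  apply: Puniq; first exact: Vlin.
  by move=> v Vv; rewrite opprD addrACA -scalerBr innerDl innerZl hx// hy// mulr0 addr0.
have Pnorm x : `|P x| <= `|x|.
  rewrite -(@ler_pXn2r _ 2)// ?nnegrE//.
  have [Vx hx] := hP x; have := @pythagoras _ L (x - P x) (P x) (hx _ Vx).
  by rewrite subrK => ->; rewrite lerDr exprn_ge0.
have bP : bounded_operators P.
  by apply/bounded_operatorsP; split=> //; exists 1 => // x; rewrite mul1r.
have Pamp (S : E -> E) (bS : bounded_operators S) x : A S ->
    P (amplify bS x) = amplify bS (P x).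
  move=> AS; have [Vx hx] := hP x; apply: Puniq; first exact: Vamp.
  have [S' AS' SS'] := Asa _ AS => v Vv.
  rewrite -(linB (bounded_linear (amplify_bounded bS))).
  rewrite (amplify_adjoint bS (Ab _ AS') SS').
  exact/hx/Vamp.
have Pentry i j : commutant A (fun v => (P (single j v) : l2 I E) i).
  split.
    apply/bounded_operatorsP; split; first by move=> a u v; rewrite single_lin Plin.
    exists 1 => // v; rewrite mul1r -(norm_single (E := E) j v).
    exact: le_trans (l2_norm_coord _ _) (Pnorm _).
  move=> S AS; apply/funext => v /=.
  by rewrite -(amplify_single (Ab _ AS)) Pamp.
have TP : amplify (proj1 cT) \o P = P \o amplify (proj1 cT).
  have [lT cTc] := bounded_comp (amplify_bounded (proj1 cT)) bP.
  have [lT' cTc'] := bounded_comp bP (amplify_bounded (proj1 cT)).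
  apply: linear_l2_eq => // i v; apply: l2ext => j.
  change (T ((P (single i v) : l2 I E) j) =
    (P (amplify (proj1 cT) (single i v)) : l2 I E) j).
  rewrite amplify_single.
  exact: (commutantE v cT (Pentry j i)).
have <- : P xi = xi.
  by apply: Puniq => // v _; rewrite subrr inner0l.
have /= -> := congr1 (@^~ xi) TP.
by have [] := hP (amplify (proj1 cT) xi).
Qed.
End Density.

(** * Crossed products *)

Section Shift.
Variables (R : realType) (G : groupType) (E : hilbert R).
Local Notation C := R[i].
Local Notation L := (l2_hilbert G E).
Local Notation sh := (@Defs.shift R G E).
Local Notation "''[' x , y ]" := (inner L x y) : ring_scope.
Implicit Types (g h x y : G) (v w : E) (xi eta : L).

Lemma shiftE g xi x : (sh g xi : l2 G E) x = (xi : l2 G E) (g^-1 * x)%g.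
Proof. by []. Qed.

Lemma shift_comp g h : sh g \o sh h = sh (g * h)%g.
Proof.
by apply/funext => xi; apply: l2ext => x; rewrite /= invgM mulgA.
Qed.

Lemma shift1 : sh 1%g = id.
Proof. by apply/funext => xi; apply: l2ext => x; rewrite /= invg1 mul1g. Qed.

Lemma shift_single g y v : sh g (single y v) = single (g * y)%g v.
Proof.
apply: l2ext => x /=; congr (if _ then _ else _).
by rewrite -(inj_eq (mulgI g)) mulVKg.
Qed.

Lemma norm_shift g xi : `|sh g xi| <= `|xi|.
Proof.
apply: l2_norm_le => // A.
apply: le_trans (l2_norm_ge xi [fset (g^-1 * x)%g | x in A]%fset).
by rewrite big_imfset//= => x y _ _; exact: mulgI.
Qed.

Lemma shift_bounded g : bounded_operators (sh g).
Proof.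
apply/bounded_operatorsP; split; first by move=> a xi eta; exact: l2ext.
by exists 1 => // xi; rewrite mul1r; exact: norm_shift.
Qed.

Lemma adjoint_coord (T U : L -> L) xi y v : is_adjoint T U ->
  inner E ((U xi : l2 G E) y) v = '[xi, T (single y v)].
Proof. by move=> TU; rewrite -inner_single (is_adjointC TU). Qed.

Lemma shift_adjoint g : is_adjoint (sh g) (sh g^-1%g).
Proof.
have [U hU] := adjoint_exists (shift_bounded g).
suff -> : sh g^-1%g = U by [].
apply/funext => xi; apply: l2ext => y; apply: inner_injl => v.
by rewrite (adjoint_coord _ _ _ hU) shift_single inner_single shiftE invgK.
Qed.

Lemma mask_shift (D : set G) g xi :
  mask D (sh g xi) = sh g (mask [set x | D (g * x)%g] xi).
Proof.
apply: l2ext => x /=; have [Dx|Dx] := pselect (D x).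
  by rewrite !asboolT//= mulVKg.
by rewrite !asboolF//= mulVKg.
Qed.

Lemma bounded_entry (T : L -> L) x y : bounded_operators T ->
  bounded_operators (fun v => (T (single y v) : l2 G E) x).
Proof.
move=> bT; apply/bounded_operatorsP; split.
  by move=> a v w; rewrite single_lin (bounded_linear bT).
have /bounded_operatorsP[_ [M M0 hM]] := bT.
exists M => // v; rewrite -(norm_single y v).
exact: le_trans (l2_norm_coord _ _) (hM _).
Qed.

Lemma operator_eq (T U : L -> L) : bounded_operators T -> bounded_operators U ->
  (forall x y v, (T (single y v) : l2 G E) x = (U (single y v) : l2 G E) x) -> T = U.
Proof.
move=> [lT cT] [lU cU] h; apply: linear_l2_eq => // y v.
by apply: l2ext => x; exact: h.
Qed.
End Shift.

Section StarAlgebra.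
Variables (R : realType) (E : hilbert R) (S : set (E -> E)).
Local Notation C := R[i].
Implicit Types T U : E -> E.

(** The linear span, built by adding one scaled element of [S] at a time, so that an induction on
    membership meets a single element of [S]. *)
Inductive span : set (E -> E) :=
| span_zero : span 0
| span_cons (a : C) T U : S T -> span U -> span (a *: T + U).

Hypothesis S_bounded : S `<=` @bounded_operators R E.
Hypothesis S_adjoint : self_adjoint_set S.
Hypothesis S_comp : forall T U, S T -> S U -> S (T \o U).

Lemma span_bounded : span `<=` @bounded_operators R E.
Proof.
move=> T; elim=> [|a U V SU _ bV]; first exact: bounded0.
by apply: bounded_lin => //; exact: S_bounded.
Qed.

Lemma sub_span : S `<=` span.
Proof.
move=> T ST; have -> : T = (1 : C) *: T + 0 by rewrite scale1r addr0.
by apply: span_cons => //; exact: span_zero.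
Qed.

Lemma span_lin (a : C) T U : span T -> span U -> span (a *: T + U).
Proof.
move=> sT sU; elim: sT => [|b V W SV _ IH]; first by rewrite scaler0 add0r.
by rewrite scalerDr scalerA -addrA; exact: span_cons.
Qed.

Lemma span_self_adjoint : self_adjoint_set span.
Proof.
move=> T; elim=> [|a U V SU _ [V' sV' VV']].
  exists 0; first exact: span_zero.
  by move=> v w; rewrite inner0l inner0r.
have [U' SU' UU'] := S_adjoint SU.
exists (a^* *: U' + V'); first exact: span_cons.
exact: is_adjoint_lin.
Qed.

Lemma span_comp T U : span T -> span U -> span (T \o U).
Proof.
move=> sT sU; elim: sT => [|a V W SV _ IH].
  have -> : (0 : E -> E) \o U = 0 by [].
  exact: span_zero.
have -> : (a *: V + W) \o U = a *: (V \o U) + (W \o U) by [].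
apply: span_lin => //; have lV := bounded_linear (S_bounded SV).
elim: sU {IH} => [|b U1 U2 SU1 _ IH].
  have -> : V \o (0 : E -> E) = 0 :> (E -> E) by apply/funext => v /=; rewrite (lin0 lV).
  exact: span_zero.
have -> : V \o (b *: U1 + U2) = b *: (V \o U1) + (V \o U2).
  by apply/funext => v; exact: lV.
by apply: span_cons => //; exact: S_comp.
Qed.
End StarAlgebra.

Section CrossedProduct.
Variables (R : realType) (G : groupType) (E : hilbert R) (Q : set (E -> E)).
Variables (tau : (E -> E) -> R[i]) (alpha : G -> (E -> E) -> E -> E).
Hypotheses (vQ : von_neumann Q) (tQ : faithful_normal_trace Q tau).
Hypothesis aQ : trace_preserving_action Q tau alpha.
Local Notation C := R[i].
Local Notation L := (l2_hilbert G E).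
Local Notation sh := (@Defs.shift R G E).
Local Notation "''[' x , y ]" := (inner L x y) : ring_scope.
Local Notation coeffs := (crossed_coefficients Q alpha).
Implicit Types (g h x y : G) (v w : E) (xi eta : L) (T U : L -> L) (q : E -> E).

Lemma action_Q g q : Q q -> Q (alpha g q). Proof. exact: action_stable aQ _ _. Qed.

Lemma action_bounded g q : Q q -> bounded_operators (alpha g q).
Proof. by move=> /(action_Q g)/(vN_bounded vQ). Qed.

Lemma action_op0 g : alpha g 0 = 0.
Proof.
have Q0 := vN_zero vQ; have := action_linear aQ g (-1) Q0 Q0.
by rewrite scaler0 addr0 scaleN1r addNr.
Qed.

(** Unitality follows from multiplicativity: [id] is a value of [alpha g], and [alpha g id] acts as
    a left unit on such values. *)
Lemma action_id g : alpha g id = id.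
Proof.
have Q1 := vN_id vQ; have Qg := action_Q g^-1%g Q1.
have e : alpha g (alpha g^-1%g id) = id by rewrite -(actionM aQ)// mulgV (action1 aQ).
have h : alpha g (alpha g^-1%g id) = alpha g id \o alpha g (alpha g^-1%g id).
  exact: (action_comp aQ g Q1 Qg).
by rewrite e in h; rewrite [RHS]h.
Qed.

Lemma action0 g q : Q q -> alpha g q 0 = 0.
Proof. by move=> /(action_bounded g)/bounded_linear/lin0. Qed.

Lemma coeffs_single T q g v : Q q ->
  (forall (xi : l2 G E) g, (T xi : l2 G E) g = alpha g^-1%g q (xi g)) ->
  T (single g v) = single g (alpha g^-1%g q v).
Proof.
move=> Qq Tq; apply: l2ext => x; rewrite Tq /=; case: eqP => [->//|_].
exact: action0.
Qed.

Lemma coeffs_bounded : coeffs `<=` @bounded_operators R L.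
Proof. by move=> T []. Qed.

Lemma coeffs_adjoint : self_adjoint_set coeffs.
Proof.
move=> T [bT [q Qq Tq]]; have [U TU] := adjoint_exists bT.
have [q' Qq' qq'] := vN_self_adjoint vQ Qq.
exists U => //; split; first exact: bounded_adjoint TU.
exists q' => // xi g; apply: inner_injl => v.
rewrite (adjoint_coord _ _ _ TU) (coeffs_single _ _ Qq Tq) inner_single.
by rewrite -(is_adjointC (action_adjoint aQ _ Qq qq')).
Qed.

Lemma coeffs_id : coeffs id.
Proof.
split; first exact: bounded_id.
by exists id; [exact: vN_id|move=> xi g; rewrite action_id].
Qed.

Lemma coeffs_comp T U : coeffs T -> coeffs U -> coeffs (T \o U).
Proof.
move=> [bT [q Qq Tq]] [bU [p Qp Up]]; split; first exact: bounded_comp.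
exists (q \o p); first exact: vN_comp.
by move=> xi g; rewrite (action_comp aQ) //= Tq Up.
Qed.

(** The covariance relation: conjugation by [sh g] replaces the coefficient [q] by [alpha g q]. *)
Lemma coeffs_shift g T : coeffs T -> coeffs (sh g \o T \o sh g^-1%g).
Proof.
move=> [bT [q Qq Tq]]; split.
  by apply: bounded_comp; [apply: bounded_comp|]; rewrite //; exact: shift_bounded.
exists (alpha g q); first exact: action_Q.
move=> xi x; rewrite -(actionM aQ)// shiftE Tq shiftE invgM !invgK mulVKg.
by [].
Qed.

Lemma shiftK g : sh g \o sh g^-1%g = id.
Proof. by rewrite shift_comp mulgV shift1. Qed.

Lemma shiftVK g : sh g^-1%g \o sh g = id.
Proof. by rewrite shift_comp mulVg shift1. Qed.

Section Subgroup.
Variable H : set G.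
Hypothesis sH : is_subgroup H.

Definition generators : set (L -> L) := coeffs `|` [set sh h | h in H].

Lemma generators_bounded : generators `<=` @bounded_operators R L.
Proof.
by move=> T [/coeffs_bounded//|[h _ <-]]; exact: shift_bounded.
Qed.

Lemma generators_adjoint : self_adjoint_set generators.
Proof.
move=> T [/coeffs_adjoint[U cU TU]|[h Hh <-]]; first by exists U => //; left.
exists (sh h^-1%g); last exact: shift_adjoint.
by right; exists h^-1%g => //; have [_ _] := sH; apply.
Qed.

Lemma crossed_productE :
  crossed_product Q alpha H = commutant (commutant generators).
Proof. exact: vN_generatedE generators_bounded generators_adjoint. Qed.

Lemma crossed_product_vN : von_neumann (crossed_product Q alpha H).
Proof. exact: von_neumann_generated generators_bounded generators_adjoint. Qed.

(** By covariance these products are closed under composition and adjoints, so their span is a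
    *-algebra to which density applies; its elements have visible Fourier coefficients. *)
Definition monomials : set (L -> L) :=
  [set T | exists c h, [/\ coeffs c, H h & T = c \o sh h]].

Lemma monomials_bounded : monomials `<=` @bounded_operators R L.
Proof.
move=> _ [c [h [/coeffs_bounded bc _ ->]]].
by apply: bounded_comp => //; exact: shift_bounded.
Qed.

Lemma monomials_id : monomials id.
Proof.
exists id, 1%g; rewrite shift1; split=> //; first exact: coeffs_id.
by have [] := sH.
Qed.

Lemma monomials_comp T U : monomials T -> monomials U -> monomials (T \o U).
Proof.
move=> [c [h [cc Hh ->]]] [d [k [cd Hk ->]]].
exists (c \o (sh h \o d \o sh h^-1%g)), (h * k)%g; split.
- by apply: coeffs_comp => //; exact: coeffs_shift.
- by have [_ + _] := sH; apply.
- rewrite -shift_comp; apply/funext => xi /=; congr (c (sh h (d _))).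
  by have /= -> := congr1 (@^~ (sh k xi)) (shiftVK h).
Qed.

Lemma monomials_adjoint : self_adjoint_set monomials.
Proof.
move=> _ [c [h [cc Hh ->]]]; have [d cd cc'] := coeffs_adjoint cc.
exists (sh h^-1%g \o d); last exact: is_adjoint_comp cc' (shift_adjoint h).
exists (sh h^-1%g \o d \o sh h^-1%g^-1%g), h^-1%g; split.
- exact: coeffs_shift.
- by have [_ _] := sH; apply.
- by apply/funext => xi /=; rewrite invgK; have /= -> := congr1 (@^~ xi) (shiftK h).
Qed.

Lemma commutant_monomials : commutant (span monomials) = commutant generators.
Proof.
apply/seteqP; split.
  apply: commutantS => T [cT|[h Hh <-]]; apply: sub_span.
    by exists T, 1%g; rewrite shift1; split=> //; have [] := sH.
  by exists id, h; split=> //; exact: coeffs_id.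
move=> A [bA hA]; split=> // T; elim=> [|a U V [c [h [cc Hh ->]]] _ IH].
  by apply/funext => xi /=; rewrite (lin0 (bounded_linear bA)).
apply/funext => xi; change (A (a *: c (sh h xi) + V xi) = a *: c (sh h (A xi)) + V (A xi)).
rewrite (bounded_linear bA).
have cA z : A (c z) = c (A z) by exact: (congr1 (@^~ z) (hA c (or_introl cc))).
have hA' : A (sh h xi) = sh h (A xi).
  by apply: (congr1 (@^~ xi) (hA (sh h) _)); right; exists h.
have hV : A (V xi) = V (A xi) by exact: (congr1 (@^~ xi) IH).
by rewrite cA hA' hV.
Qed.
End Subgroup.

Definition fourier T (t : G -> E -> E) := (forall g, Q (t g)) /\
  forall x y v, (T (single y v) : l2 G E) x = alpha x^-1%g (t (x * y^-1)%g) v.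

Lemma fourier_span H T : span (monomials H) T -> exists t, fourier T t.
Proof.
elim=> [|a U V [c [h [[bc [q Qq cq]] Hh ->]]] _ [t [Qt Vt]]].
  exists (fun=> 0); split=> [g|x y v]; first exact: vN_zero.
  by rewrite action_op0.
exists (fun g => (if g == h then a else 0) *: q + t g); split=> [g|x y v].
  exact: vN_lin.
rewrite (action_linear aQ)//.
change (a *: (c (sh h (single y v)) : l2 G E) x + (V (single y v) : l2 G E) x =
  (if (x * y^-1)%g == h then a else 0) *: alpha x^-1%g q v
    + alpha x^-1%g (t (x * y^-1)%g) v).
rewrite Vt; congr (_ + _); rewrite shift_single (coeffs_single _ _ Qq cq) /=.
have -> : ((x * y^-1)%g == h) = (x == (h * y)%g).
  by apply/eqP/eqP => [<-|->]; rewrite ?mulgVK ?mulgK.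
by case: eqP => [->//|_]; rewrite scaler0 scale0r.
Qed.
End CrossedProduct.

Lemma norm_lim_le (R : realType) (f : nat -> scalars R) (l : scalars R) (e : R[i]) :
  f @ \oo --> l -> 0 <= e -> (forall n, `|f n| <= e) -> `|l| <= e.
Proof.
move=> /cvgrPdist_lt fl e0 h; rewrite real_leNgt ?ger0_real//; apply/negP => el.
have d0 : 0 < `|l| - e by rewrite subr_gt0.
have [n hn] := filter_ex (fl _ d0).
have : `|l| < `|l|.
  rewrite -{1}[l](subrK (f n)); apply: le_lt_trans (ler_normD _ _) _.
  by rewrite -[ltRHS](subrK e); apply: ltr_leD.
by rewrite ltxx.
Qed.

(** Bundles finitely many sequences into one vector, so that one use of density approximates an
    operator on all of them. *)
Lemma square_summable_pairs (R : realType) (J : finType) (E : hilbert R)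
  (x : J -> nat -> E) : (forall j, square_summable (x j)) ->
  (fun i : J * nat => x i.1 i.2) \in @l2_pred R (J * nat)%type E.
Proof.
move=> /choice[M hM]; apply/asboolP; exists (\sum_j M j) => A.
rewrite (partition_big fst xpredT)//=; apply: ler_sum => j _.
have ur : uniq [seq i.2 | i <- A & i.1 == j].
  rewrite map_inj_in_uniq ?filter_uniq ?fset_uniq// => -[a n] [b m] /=.
  by rewrite !mem_filter/= => /andP[/eqP -> _] /andP[/eqP -> _] ->.
apply: le_trans (hM j (seq_fset tt [seq i.2 | i <- A & i.1 == j])).
rewrite le_eqVlt; apply/orP; left; apply/eqP.
rewrite [RHS](perm_big [seq i.2 | i <- A & i.1 == j])/=; last first.
  apply: uniq_perm => // n; exact: seq_fsetE.
rewrite big_map big_filter; apply: eq_bigr => -[a n] /= /eqP ->.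
by [].
Qed.

(** * Existence of Fourier coefficients *)

Section Fourier.
Variables (R : realType) (G : groupType) (E : hilbert R) (Q : set (E -> E)).
Variables (tau : (E -> E) -> R[i]) (alpha : G -> (E -> E) -> E -> E).
Hypotheses (vQ : von_neumann Q) (tQ : faithful_normal_trace Q tau).
Hypothesis aQ : trace_preserving_action Q tau alpha.
Local Notation C := R[i].
Local Notation L := (l2_hilbert G E).
Local Notation sh := (@Defs.shift R G E).
Local Notation coeffs := (crossed_coefficients Q alpha).
Implicit Types (g h x y : G) (v w : E) (xi eta : L) (T U : L -> L) (q : E -> E).

Lemma traceD q p : Q q -> Q p -> tau (q + p) = tau q + tau p.
Proof.
by move=> Qq Qp; have := trace_linear tQ 1 Qq Qp; rewrite scale1r mul1r.
Qed.

(** The parallelogram identity under [tau], with the nonnegative term [tau ((u' + b') \o (u + b))]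
    dropped: a triangle inequality for the norm of [tau]. *)
Lemma trace_parallelogram u u' b b' : Q u -> Q b -> is_adjoint u u' ->
  is_adjoint b b' ->
  tau ((u' - b') \o (u - b)) <= 2 * tau (u' \o u) + 2 * tau (b' \o b).
Proof.
move=> Qu Qb uu' bb'; have Qu' := vN_adjoint vQ Qu uu'; have Qb' := vN_adjoint vQ Qb bb'.
have QN p : Q p -> Q (- p) by move=> Qp; rewrite -scaleN1r; exact: vN_scale.
have lu' := bounded_linear (vN_bounded vQ Qu').
have lb' := bounded_linear (vN_bounded vQ Qb').
have Qc p r : Q p -> Q r -> Q (p \o r) by exact: vN_comp.
have QD p r : Q p -> Q r -> Q (p + r) by exact: vN_add.
have e : (u' - b') \o (u - b) + ((u' + b') \o (u + b)) =
    (u' \o u + (u' \o u)) + (b' \o b + (b' \o b)).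
  apply/funext => v.
  change (u' (u v - b v) - b' (u v - b v) + (u' (u v + b v) + b' (u v + b v)) =
    u' (u v) + u' (u v) + (b' (b v) + b' (b v))).
  rewrite !(linB lu', linB lb', linD lu', linD lb').
  set a := u' (u v); set c := u' (b v); set d := b' (u v); set f := b' (b v).
  have -> : a - c - (d - f) = (a + f) - (c + d) by rewrite opprB addrACA -opprD.
  have -> : a + c + (d + f) = (a + f) + (c + d) by rewrite [d + f]addrC addrACA.
  by rewrite addrACA addNr addr0 addrACA.
have h1 : Q ((u' - b') \o (u - b)) by apply: Qc; apply: (QD) => //; exact: QN.
have h2 : Q ((u' + b') \o (u + b)) by apply: Qc; exact: QD.
have h3 : Q (u' \o u) by exact: Qc.
have h4 : Q (b' \o b) by exact: Qc.
have := congr1 tau e; rewrite (traceD h1 h2) (traceD (QD _ _ h3 h3) (QD _ _ h4 h4)).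
rewrite (traceD h3 h3) (traceD h4 h4).
set t := tau (u' \o u); set s := tau (b' \o b).
have -> : 2 * t + 2 * s = t + t + (s + s) by ring.
move=> <-; rewrite lerDl.
apply: (trace_ge0 tQ); first exact: QD.
by have := is_adjoint_lin 1 uu' bb'; rewrite conjC1 !scale1r.
Qed.

(** [tau (z' \o z)] is the sum of the inner products of [z (v k)] and [z (w k)]; Cauchy-Schwarz and
    [2 a b <= a^2 + b^2] bound it by the mean of the two sums of squares. *)
Lemma trace_bound : exists v w : nat -> E,
  [/\ square_summable v, square_summable w &
  forall z z' (e : C), Q z -> is_adjoint z z' ->
    (forall n, \sum_(k < n) `|z (v k)| ^+ 2 <= e) ->
    (forall n, \sum_(k < n) `|z (w k)| ^+ 2 <= e) -> tau (z' \o z) <= e].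
Proof.
have [v [w [sv sw h]]] := trace_normal tQ.
exists v, w; split=> // z z' e Qz zz' hv hw.
have Qz' := vN_adjoint vQ Qz zz'.
have e0 : 0 <= e by apply: le_trans (hv 0%N); rewrite big_ord0.
rewrite -[leLHS]ger0_norm; last exact: (trace_ge0 tQ Qz zz').
apply: (norm_lim_le (h _ (vN_comp vQ Qz' Qz))) => // n.
apply: (@le_trans _ _ (\sum_(k < n) ((`|z (v k)| ^+ 2 + `|z (w k)| ^+ 2) / 2))).
  apply: le_trans (ler_norm_sum _ _ _) _; apply: ler_sum => k _ /=.
  rewrite (is_adjointC zz'); apply: le_trans (inner_CS _ _) _.
  rewrite ler_pdivlMr// -subr_ge0.
  have -> : `|z (v k)| ^+ 2 + `|z (w k)| ^+ 2 - `|z (v k)| * `|z (w k)| * 2 =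
    (`|z (v k)| - `|z (w k)|) ^+ 2 by ring.
  by rewrite real_exprn_even_ge0// realB.
rewrite -mulr_suml big_split/= ler_pdivrMr// mulr_natr mulr2n.
exact: (lerD (hv n) (hw n)).
Qed.

Lemma crossed_product_sub (H K : set G) : H `<=` K ->
  crossed_product Q alpha H `<=` crossed_product Q alpha K.
Proof.
move=> HK T hT M [vM SM]; apply: hT; split=> // U [cU|[h Hh <-]].
  by apply: SM; left.
by apply: SM; right; exists h => //; exact: HK.
Qed.

Lemma subgroupT : is_subgroup [set: G]. Proof. by []. Qed.

(** [Q] is its own bicommutant. An operator in the commutant of [Q], amplified to [L], commutes with
    all generators, hence with [T], and so with every entry of [T]. *)
Lemma entry_Q T x y : crossed_product Q alpha [set: G] T ->
  Q (fun v => (T (single y v) : l2 G E) x).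
Proof.
rewrite (crossed_productE vQ aQ subgroupT) => cT.
apply: (vN_commute vQ); first exact: bounded_entry (commutant_bounded cT).
move=> c cc; have bc := commutant_bounded cc; apply/funext => v /=.
have amp : commutant (generators Q alpha [set: G]) (amplify (I := G) bc).
  split; first exact: amplify_bounded.
  move=> A [[bA [q Qq hA]]|[h _ <-]]; apply/funext => xi; apply: l2ext => g //.
  change (c ((A xi : l2 G E) g) = (A (amplify bc xi) : l2 G E) g).
  rewrite !hA; exact: (commutantE _ cc (action_Q aQ _ Qq)).
by rewrite -(amplify_single bc) (commutantE _ cT amp).
Qed.

(* Only the trace makes alpha continuous: strong approximation on the vectors
   of tau controls the norm tau (z^* z), which alpha preserves. *)
Lemma entry_equivariant T x y : crossed_product Q alpha [set: G] T ->
  alpha x^-1%g (fun v => (T (single (y * x^-1)%g v) : l2 G E) 1%g) =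
  (fun v => (T (single y v) : l2 G E) x).
Proof.
move=> MT.
set q := fun v => _; set r := fun v => _.
have Qq : Q q by exact: entry_Q.
have Qr : Q r by exact: entry_Q.
have [v [w [sv sw hvw]]] := trace_bound.
have QB p p' : Q p -> Q p' -> Q (p - p').
  by move=> Qp Qp'; rewrite addrC -scaleN1r; exact: vN_lin.
have QD : Q (alpha x^-1%g q - r) by apply: QB => //; exact: (action_Q aQ).
have [D' _ DD'] := vN_self_adjoint vQ QD.
suff small e : 0 < e -> tau (D' \o (alpha x^-1%g q - r)) <= 4 * e.
  apply/eqP; rewrite -subr_eq0; apply/eqP; apply: (trace_faithful tQ QD DD').
  apply: (@eq0_norm_lt _ (scalars R)) => e e0.
  have e8 : 0 < e / 8 by rewrite divr_gt0.
  rewrite ger0_norm; last exact: (trace_ge0 tQ QD DD').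
  apply: le_lt_trans (small _ e8) _.
  have -> : 4 * (e / 8) = e / 2 by field.
  by rewrite ltr_pdivrMr// ltr_pMr// ltr1n.
move=> e0.
have := MT; rewrite (crossed_productE vQ aQ subgroupT) => cT.
rewrite -(commutant_monomials vQ aQ subgroupT) in cT.
(* Four sequences must be approximated together: two columns, each tested on the vectors [v] and [w]
   of the trace. *)
pose X (j : bool * bool) n : L :=
  single (if j.1 then y else (y * x^-1)%g) (if j.2 then v n else w n).
have sX j : square_summable (X j).
  case: j => b [|].
    by have [M hM] := sv; exists M => A; under eq_bigr do rewrite norm_single.
  by have [M hM] := sw; exists M => A; under eq_bigr do rewrite norm_single.
pose xi : l2_hilbert (bool * bool * nat)%type L := L2 (square_summable_pairs sX).
have mb := @monomials_bounded R G E Q alpha [set: G].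
have ma := monomials_adjoint vQ aQ subgroupT.
have mc := @monomials_comp _ _ _ _ _ _ vQ aQ _ subgroupT.
have [S sS hS] := bicommutant_density xi (span_bounded mb) (span_self_adjoint ma)
  (sub_span (monomials_id vQ aQ subgroupT)) (@span_lin _ _ _) (@span_comp _ _ _ mb mc)
  cT e0.
have [s [Qs Ss]] := fourier_span vQ aQ sS.
have hj j n : \sum_(k < n) `|T (X j k) - S (X j k)| ^+ 2 <= e.
  apply: le_trans (hS (seq_fset tt [seq (j, k) | k <- iota 0 n])).
  rewrite [leRHS](perm_big [seq (j, k) | k <- iota 0 n]); last first.
    apply: uniq_perm; first exact: fset_uniq.
      by rewrite map_inj_uniq ?iota_uniq// => k l [].
    by move=> i; rewrite -[RHS](seq_fsetE tt).
  rewrite big_map -(big_mkord xpredT (fun k => `|T (X j k) - S (X j k)| ^+ 2)).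
  by rewrite /index_iota subn0.
(* Both entries compared have this coefficient of [S], since [1 * (y * x^-1)^-1 = x * y^-1]. So [q]
   is near [p] and [r] is near [alpha x^-1 p]. *)
pose p := s (x * y^-1)%g.
have Qp : Q p by exact: Qs.
have Qa : Q (q - p) by exact: QB.
have Qb : Q (r - alpha x^-1%g p) by apply: QB => //; exact: (action_Q aQ).
have [a' Qa' aa'] := vN_self_adjoint vQ Qa.
have [b' Qb' bb'] := vN_self_adjoint vQ Qb.
have hqp u : (q - p) u = (T (single (y * x^-1)%g u) - S (single (y * x^-1)%g u) : l2 G E) 1%g.
  change (q u - p u = (T (single (y * x^-1)%g u) : l2 G E) 1%g - (S (single (y * x^-1)%g u) : l2 G E) 1%g).
  by rewrite Ss invg1 (action1 aQ)// mul1g invgM invgK.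
have hrp u : (r - alpha x^-1%g p) u = (T (single y u) - S (single y u) : l2 G E) x.
  change (r u - alpha x^-1%g p u = (T (single y u) : l2 G E) x - (S (single y u) : l2 G E) x).
  by rewrite Ss.
have coordle (j : bool * bool) (f : E -> E) (z : nat -> E) (g : G) n :
    (forall k, f (z k) = (T (X j k) - S (X j k) : l2 G E) g) ->
    \sum_(k < n) `|f (z k)| ^+ 2 <= e.
  move=> hf; apply: le_trans (hj j n); apply: ler_sum => k _; rewrite hf.
  by rewrite ler_pXn2r ?nnegrE//; exact: l2_norm_coord.
have ta : tau (a' \o (q - p)) <= e.
  apply: hvw => // n.
    by apply: (coordle (false, true) _ _ 1%g) => k; rewrite hqp.
  by apply: (coordle (false, false) _ _ 1%g) => k; rewrite hqp.
have tb : tau (b' \o (r - alpha x^-1%g p)) <= e.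
  apply: hvw => // n.
    by apply: (coordle (true, true) _ _ x) => k; rewrite hrp.
  by apply: (coordle (true, false) _ _ x) => k; rewrite hrp.
have DE : alpha x^-1%g q - r = alpha x^-1%g (q - p) - (r - alpha x^-1%g p).
  have -> : q - p = (-1 : C) *: p + q by rewrite scaleN1r addrC.
  by rewrite (action_linear aQ)// scaleN1r opprB addrACA addNr add0r.
have ua' := action_adjoint aQ x^-1%g Qa aa'.
have -> : D' = alpha x^-1%g a' - b'.
  apply: (adjoint_unique DD'); rewrite DE.
  have := is_adjoint_lin (-1) bb' ua'; rewrite rmorphN rmorph1 !scaleN1r.
  by rewrite [_ + alpha _ _]addrC [_ + alpha _ a']addrC.
rewrite DE; apply: le_trans (trace_parallelogram (action_Q aQ _ Qa) Qb ua' bb') _.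
rewrite -(action_comp aQ)// (action_trace aQ); last exact: vN_comp.
have -> : 4 * e = 2 * e + 2 * e by ring.
by rewrite lerD// ler_wpM2l.
Qed.

Lemma fourier_exists T : crossed_product Q alpha [set: G] T ->
  exists t, fourier Q alpha T t.
Proof.
(* The coefficients are read off the row of [1], where the action is trivial. *)
move=> MT; exists (fun g v => (T (single g^-1%g v) : l2 G E) 1%g).
split=> [g|x y v]; first exact: entry_Q.
by rewrite invgM invgK entry_equivariant.
Qed.
End Fourier.

(** * Membership in the crossed product by a subgroup *)

Section Membership.
Variables (R : realType) (G : groupType) (E : hilbert R).
Local Notation C := R[i].
Local Notation L := (l2_hilbert G E).
Local Notation sh := (@Defs.shift R G E).
Implicit Types (g h x y z : G) (v w : E) (xi eta : L) (T U : L -> L) (H : set G).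

Definition right_coset H x : set G := [set z | H (z * x^-1)%g].

Lemma right_cosetxx H x : is_subgroup H -> right_coset H x x.
Proof. by move=> [H1 _ _]; rewrite /right_coset /= mulgV. Qed.

Lemma right_coset_eq H x y : is_subgroup H -> right_coset H x y ->
  right_coset H x = right_coset H y.
Proof.
move=> [_ HM HV] Hxy; apply/seteqP; split=> z; rewrite /right_coset /= => Hz.
  have -> : (z * y^-1 = (z * x^-1) * (y * x^-1)^-1)%g.
    by rewrite invgM invgK mulgA mulgVK.
  by apply: HM => //; exact: HV.
have -> : (z * x^-1 = (z * y^-1) * (y * x^-1))%g by rewrite mulgA mulgVK.
exact: HM.
Qed.

Lemma right_coset_disjoint H x y : is_subgroup H ->
  right_coset H x <> right_coset H y -> right_coset H x `&` right_coset H y = set0.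
Proof.
move=> sH xy; apply/seteqP; split=> // z [xz yz]; apply: xy.
by rewrite (right_coset_eq sH xz) (right_coset_eq sH yz).
Qed.

(** The block diagonal of [T] along the right cosets of [H]. It is bounded by the bound of [T],
    because distinct blocks read and write mutually orthogonal pieces. *)
Lemma pinch_exists H T : is_subgroup H -> bounded_operators T ->
  exists U, bounded_operators U /\ forall xi x,
    (U xi : l2 G E) x = (T (mask (right_coset H x) xi) : l2 G E) x.
Proof.
move=> sH bT; have lT := bounded_linear bT.
have /bounded_operatorsP[_ [M M0 hM]] := bT.
pose F xi x := (T (mask (right_coset H x) xi) : l2 G E) x.
have FM xi (A : {fset G}) : \sum_(x <- A) `|F xi x| ^+ 2 <= (M * `|xi|) ^+ 2.
  rewrite (partition_big_imfset _ (right_coset H))/= exprMn.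
  apply: (@le_trans _ _ (M ^+ 2 *
    \sum_(D <- [fset right_coset H x | x in A]%fset) `|mask D xi| ^+ 2)); last first.
    rewrite ler_wpM2l ?exprn_ge0//; apply: sum_mask_le; first exact: fset_uniq.
    move=> D D' /imfsetP[x _ ->] /imfsetP[y _ ->] /eqP xy.
    exact: right_coset_disjoint.
  rewrite mulr_sumr; apply: ler_sum => D _.
  apply: (@le_trans _ _ (\sum_(x <- A) `|(T (mask D xi) : l2 G E) x| ^+ 2)).
    rewrite [leRHS](bigID (fun x => right_coset H x == D))/=.
    rewrite -[leLHS]addr0; apply: lerD; last by apply: sumr_ge0 => x _; exact: exprn_ge0.
    rewrite le_eqVlt; apply/orP; left; apply/eqP.
    by apply: eq_bigr => x /eqP <-.
  apply: le_trans (l2_norm_ge (T (mask D xi)) A) _; rewrite -exprMn.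
  by rewrite ler_pXn2r ?nnegrE ?mulr_ge0.
have F_l2 xi : F xi \in @l2_pred R G E.
  by apply/asboolP; exists ((M * `|xi|) ^+ 2); exact: FM.
exists (fun xi => L2 (F_l2 xi)); split=> //; apply/bounded_operatorsP; split.
  move=> a xi eta; apply: l2ext => x.
  by rewrite /= /F mask_lin lT.
by exists M => // xi; apply: l2_norm_le; [exact: mulr_ge0|exact: FM].
Qed.

Lemma trivial_subgroup : is_subgroup [set 1%g : G].
Proof. by split=> // [g h -> ->|g ->] /=; rewrite ?mulg1 ?invg1. Qed.

Lemma mask_trivial_coset x xi :
  mask (right_coset [set 1%g] x) xi = single x ((xi : l2 G E) x) :> L.
Proof.
apply: l2ext => z; rewrite /= /right_coset/=; case: eqP => [->|zx].
  by rewrite asboolT// mulgV.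
by rewrite asboolF// => /eqP; rewrite divg_eq1 => /eqP.
Qed.

Section Action.
Variables (Q : set (E -> E)) (tau : (E -> E) -> R[i]).
Variable alpha : G -> (E -> E) -> E -> E.
Hypotheses (vQ : von_neumann Q) (tQ : faithful_normal_trace Q tau).
Hypothesis aQ : trace_preserving_action Q tau alpha.

(** The operator of the coefficient [t h] is the diagonal of [T \o sh h^-1], that is, its pinching
    along the trivial subgroup; boundedness is inherited from [T]. *)
Lemma fourier_coefficient T t h : bounded_operators T -> fourier Q alpha T t ->
  exists2 D, crossed_coefficients Q alpha D &
    forall xi x, (D xi : l2 G E) x = alpha x^-1%g (t h) ((xi : l2 G E) x).
Proof.
move=> bT [Qt Tt].
have bTs := bounded_comp bT (@shift_bounded R G E h^-1%g).
have [D [bD hD]] := pinch_exists trivial_subgroup bTs.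
have DE xi x : (D xi : l2 G E) x = alpha x^-1%g (t h) ((xi : l2 G E) x).
  rewrite hD mask_trivial_coset /= -/(Defs.shift _ _) shift_single Tt.
  rewrite invgM invgK. by rewrite mulVKg.
by exists D => //; split=> //; exists (t h).
Qed.

(** For [A] in the commutant of the generators, the entries of [A T] and [T A] at [(x, y)] expand
    into two series whose terms are matched by a bijection of [G]: each matched pair is one instance
    of [A] commuting with a coefficient times a shift. No convergence of the Fourier series of [T]
    itself is involved. *)
Lemma crossed_product_fourier H T t : is_subgroup H -> bounded_operators T ->
  fourier Q alpha T t -> (forall g, ~ H g -> t g = 0) ->
  crossed_product Q alpha H T.
Proof.
move=> sH bT Tf t0; have [Qt Tt] := Tf; rewrite (crossed_productE vQ aQ sH).
split=> // A cA; have bA := commutant_bounded cA.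
apply: operator_eq; [exact: bounded_comp|exact: bounded_comp|] => x y v /=.
set zeta : L := A (single y v).
pose f xi := (A xi : l2 G E) x; pose g xi := (T xi : l2 G E) x.
have [lA ctA] := bA; have [lT ctT] := bT.
have lf : linear f by move=> a u w; rewrite /f lA.
have lg : linear g by move=> a u w; rewrite /g lT.
have cf : continuous f.
  have /bounded_operatorsP[_ [M M0 hM]] := bA.
  by apply/(continuous_linearP lf); exists M => // u; apply: le_trans (l2_norm_coord _ _) (hM _).
have cg : continuous g.
  have /bounded_operatorsP[_ [M M0 hM]] := bT.
  by apply/(continuous_linearP lg); exists M => // u; apply: le_trans (l2_norm_coord _ _) (hM _).
(* Chosen so that [x * (phi z)^-1 = z * y^-1]: both terms then use the same Fourier coefficient. *)
pose phi z := (y * z^-1 * x)%g.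
have phiI : injective phi by move=> z z' /mulIg/mulgI/invg_inj.
have fE z : f (single z ((T (single y v) : l2 G E) z)) =
    g (single (phi z) ((zeta : l2 G E) (phi z))).
  rewrite /g !Tt /phi.
  have -> : (x * (y * z^-1 * x)^-1 = z * y^-1)%g.
    by rewrite !invgM invgK mulVKg.
  have [Hh|nHh] := pselect (H (z * y^-1)%g); last first.
    rewrite t0// !(action_op0 vQ aQ) /f.
    have -> : single z (0 : E) = 0 :> L by apply: l2ext => j /=; rewrite if_same.
    by rewrite (lin0 lA).
  have [D cD hD] := fourier_coefficient (z * y^-1)%g bT Tf.
  have -> : single z (alpha z^-1%g (t (z * y^-1)%g) v) = D (sh (z * y^-1)%g (single y v)).
    rewrite shift_single mulgVK; apply: l2ext => j; rewrite hD /=.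
    by case: eqP => [->//|_]; rewrite (action0 vQ aQ).
  have AD : A (D (sh (z * y^-1)%g (single y v))) = D (sh (z * y^-1)%g zeta).
    rewrite (commutantE _ cA (or_introl cD)); congr (D _).
    by apply: (commutantE _ cA); right; exists (z * y^-1)%g.
  by rewrite /f AD hD shiftE invgM invgK.
apply/eqP; rewrite -subr_eq0; apply/eqP; apply: eq0_norm_lt => e e0.
have e2 : 0 < e / 2 by rewrite divr_gt0.
have [A1 hA1] := linear_l2_approx (T (single y v)) lf cf e2.
have [A2 hA2] := linear_l2_approx zeta lg cg e2.
(* The second set is the preimage of [A2] under [phi], so [B] serves the first series and its image
   the second. *)
pose B := (A1 `|` [fset (x * w^-1 * y)%g | w in A2])%fset.
have AB2 : (A2 `<=` [fset phi z | z in B])%fset.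
  apply/fsubsetP => w wA2; apply/imfsetP; exists (x * w^-1 * y)%g.
    by apply/fsetUP; right; apply/imfsetP; exists w.
  by rewrite /phi !invgM invgK !mulgA mulgV mul1g mulgVK.
have := hA1 B (fsubsetUl _ _); have := hA2 _ AB2.
rewrite big_imfset/=; last by move=> z z' _ _ /phiI.
under eq_bigr do rewrite -fE.
set s := \sum_(_ <- _) _ => h1 h2.
rewrite -/(g zeta) -/(f (T (single y v))).
have -> : g zeta - f (T (single y v)) = (g zeta - s) - (f (T (single y v)) - s).
  by rewrite opprB addrA subrK.
by rewrite (splitr e); exact: le_lt_trans (ler_normB _ _) (ltrD h1 h2).
Qed.

(** Coefficients act diagonally and shifts by [H] preserve [D], so the restriction to [D] lies in
    the commutant of the generators. *)
Lemma mask_commute H T (D : set G) xi : is_subgroup H ->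
  crossed_product Q alpha H T -> (forall h x, H h -> D (h * x)%g = D x) ->
  T (mask D xi) = mask D (T xi).
Proof.
move=> sH; rewrite (crossed_productE vQ aQ sH) => cT hD.
apply: (commutantE _ cT); split; first exact: mask_bounded.
move=> A [[bA [q Qq hA]]|[h Hh <-]]; apply/funext => eta /=.
  apply: l2ext => g; rewrite hA /=; case: ifP => _; rewrite ?hA//.
  by rewrite (action0 vQ aQ).
rewrite mask_shift; congr (sh h (mask _ _)).
by apply/seteqP; split=> x; rewrite /= hD.
Qed.

Lemma right_coset_invariant H x h z : is_subgroup H -> H h ->
  right_coset H x (h * z)%g = right_coset H x z.
Proof.
move=> [_ HM HV] Hh; apply/propext; rewrite /right_coset /= -mulgA; split=> hz.
  by rewrite -[(z * _)%g](mulKg h); apply: (HM) => //; exact: HV.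
exact: HM.
Qed.

Lemma crossed_product_support H T x y v : is_subgroup H ->
  crossed_product Q alpha H T -> ~ H (x * y^-1)%g ->
  (T (single y v) : l2 G E) x = 0.
Proof.
move=> sH HT nxy.
have <- : mask (right_coset H y) (single y v) = single y v :> L.
  by apply: mask_single; exact: right_cosetxx.
rewrite (mask_commute _ sH HT); first by rewrite maskF.
by move=> h z Hh; exact: right_coset_invariant.
Qed.
End Action.
End Membership.

(** * Masses of coset restrictions *)

Section NatSums.
Variables (R : realType) (E : hilbert R).

(** Normal functionals are sums along initial segments, while [l2_inner] is a limit over finite
    sets; initial segments are cofinal among these. *)
Lemma l2_inner_nat (xi eta : l2 nat E) :
  (fun n => \sum_(k < n) inner E (xi k) (eta k) : scalars R) @ \oo
    --> (l2_inner xi eta : scalars R).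
Proof.
have h := @l2_inner_cvg _ _ _ xi eta.
pose s n : {fset nat} := seq_fset tt (iota 0 n).
have sc : s @ \oo --> totally.
  move=> P [A _ AP]; exists (\max_(k <- A) k).+1 => // n /= An; apply: AP => /=.
  apply/fsubsetP => k kA; rewrite seq_fsetE mem_iota/= add0n.
  by apply: leq_trans An; rewrite ltnS; exact: (@leq_bigmax_seq _ _ xpredT id).
have := cvg_comp s _ sc h; apply: cvg_trans; apply: near_eq_cvg; near=> n.
rewrite /= partial_sum_eq (perm_big (iota 0 n)).
  by rewrite -(big_mkord xpredT (fun k => inner E (xi k) (eta k))) /index_iota subn0.
apply: uniq_perm; [exact: fset_uniq|exact: iota_uniq|].
by move=> i; rewrite -[RHS](seq_fsetE tt).
Unshelve. all: end_near. Qed.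
End NatSums.

Section Mass.
Variables (R : realType) (J G : choiceType) (E : hilbert R).
Local Notation C := R[i].
Local Notation L := (l2_hilbert G E).
Local Notation LL := (l2_hilbert J L).
Local Notation amask D := (amplify (I := J) (@mask_bounded R G E D)).
Implicit Types (D : set G) (A B : {fset G}) (xi : L) (Xi Theta : LL).

Lemma norm_amask D Xi : `|amask D Xi| <= `|Xi|.
Proof.
apply: l2_norm_le => // N; apply: le_trans (l2_norm_ge Xi N).
apply: ler_sum => n _; rewrite ler_pXn2r ?nnegrE//; exact: norm_mask.
Qed.

(** Up to [e / 4] only the finitely many coordinates in [N] matter, and each is approximated within
    [d], which is [e / 4] shared among them. Three errors of [e / 4] stay below [e]. *)
Lemma amask_approx Xi (e : C) : 0 < e -> exists A, forall B, (A `<=` B)%fset ->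
  `|Xi - amask [set` B] Xi| < e.
Proof.
move=> e0; have e4 : 0 < e / 4 by rewrite divr_gt0.
have [N hN] := mask_approx Xi e4; have {hN} := hN N (fsubset_refl N).
set Xi0 := mask [set` N] Xi => hN.
pose d := e / 4 / (#|` N|%:R + 1).
have n0 : 0 < #|` N|%:R + 1 :> C by rewrite ltr_wpDl.
have d0 : 0 < d by rewrite divr_gt0.
have /choice[A hA] n : exists A : {fset G}, forall B, (A `<=` B)%fset ->
    `|(Xi : l2 J L) n - mask [set` B] ((Xi : l2 J L) n)| < d.
  exact: mask_approx.
exists (\bigcup_(n <- N) A n)%fset => B AB.
have lB := bounded_linear (@amplify_bounded R J L _ (@mask_bounded R G E [set` B])).
have h0 : `|Xi0 - amask [set` B] Xi0| <= e / 4.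
  rewrite /Xi0 mask_fset (lin_sum lB) -sumrB; apply: le_trans (ler_norm_sum _ _ _) _.
  apply: (@le_trans _ _ (\sum_(n <- N) d)).
    rewrite big_seq [leRHS]big_seq; apply: ler_sum => n nN.
    rewrite amplify_single; set z := (Xi : l2 J L) n.
    pose z' : L := mask [set` B] z.
    change (`|single n z - single n z' : LL| <= d).
    have -> : single n z - single n z' = single n (z - z') :> LL.
      have := single_lin n (-1) z' z; rewrite !scaleN1r [- z' + z]addrC => ->.
      exact: addrC.
    rewrite norm_single; apply/ltW/hA/(fsubset_trans _ AB).
    by apply/fsubsetP => x xA; apply/bigfcupP; exists n => //; rewrite nN.
  rewrite big_const_seq count_predT iter_addr_0 /d -mulrnAr ler_piMr ?(ltW e4)//.
  by rewrite -mulr_natl ler_pdivrMr// mul1r lerDl.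
have -> : Xi - amask [set` B] Xi = (Xi - Xi0) + (Xi0 - amask [set` B] Xi0)
    - amask [set` B] (Xi - Xi0).
  by rewrite (linB lB) addrA subrK opprB addrA subrK.
apply: le_lt_trans (ler_normB _ _) _.
apply: (@le_lt_trans _ _ (e / 4 + e / 4 + e / 4)); last first.
  have -> : e / 4 + e / 4 + e / 4 = 3 / 4 * e by field.
  by rewrite gtr_pMl// ltr_pdivrMr// mul1r ltr_nat.
apply: lerD; last by apply: le_trans (norm_amask _ _) _; exact: ltW.
by apply: le_trans (ler_normD _ _) _; apply: lerD => //; exact: ltW.
Qed.

Variables Xi Theta : LL.
(** Two families are needed because a normal trace is given by two sequences; for equal families
    this is the squared norm of the restriction to [D]. *)
Definition mass D : C := inner LL (amask D Xi) Theta.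

(** One finite set [A] serves all [D]: a coset moved off [A] has small mass, wherever it goes. *)
Lemma mass_approx (e : C) : 0 < e -> exists A, forall D B, (A `<=` B)%fset ->
  `|mass D - mass (D `&` [set` B])| < e.
Proof.
move=> e0; have t0 : 0 < `|Theta| + 1 by rewrite ltr_wpDl.
have [|A hA] := @amask_approx Xi (e / (`|Theta| + 1)); first by rewrite divr_gt0.
exists A => D B /hA h; have lD := bounded_linear (@amplify_bounded R J L _ (@mask_bounded R G E D)).
have -> : mass D - mass (D `&` [set` B]) = inner LL (amask D (Xi - amask [set` B] Xi)) Theta.
  rewrite (linB lD Xi) innerBl /mass.
  have -> : amask D (amask [set` B] Xi) = amask (D `&` [set` B]) Xi.
    by apply: l2ext => n; exact: mask_mask.
  by [].
apply: le_lt_trans (inner_CS _ _) _.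
apply: (@le_lt_trans _ _ (`|Xi - amask [set` B] Xi| * (`|Theta| + 1))).
  by apply: ler_pM => //; [exact: norm_amask|rewrite lerDl].
by rewrite -ltr_pdivlMr.
Qed.

Lemma mass_single x : mass [set x] =
  l2_inner Xi (L2 (amplify_subproof (@mask_bounded R G E [set x]) Theta)).
Proof.
rewrite /mass [LHS](amplify_adjoint _ (@mask_bounded R G E [set x]))//.
by move=> u v; exact: inner_mask.
Qed.

Lemma mass_fset B : mass [set` B] = \sum_(x <- B) mass [set x].
Proof.
rewrite /mass.
have -> : amask [set` B] Xi = \sum_(x <- B) amask [set x] Xi.
  apply: l2ext => n; rewrite l2_sum; apply: l2ext => x; rewrite l2_sum.
  change (mask [set` B] ((Xi : l2 J L) n) x = \sum_(y <- B) mask [set y] ((Xi : l2 J L) n) x).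
  have [xB|xB] := boolP (x \in B).
    rewrite maskT//= (big_fsetD1 x)//= asboolT// big1_fset ?addr0// => y.
    rewrite !inE => /andP[yx _] _; rewrite asboolF// => xy.
    by move: yx; rewrite xy eqxx.
  rewrite maskF; last exact/negP.
  rewrite big1_fset// => y yB _; rewrite maskF// => xy.
  by move: xB; rewrite xy yB.
exact: (big_morph (fun z => inner LL z Theta) (fun u v => innerDl u v Theta) (inner0l Theta)).
Qed.

Lemma massI_fset D B : mass (D `&` [set` B]) = \sum_(x <- B | `[< D x >]) mass [set x].
Proof.
have -> : D `&` [set` B] = [set` [fset x | x in B & `[< D x >]]%fset].
  apply/seteqP; split=> x /=; rewrite !inE/=.
    by move=> [Dx xB]; apply/andP; split => //; apply/asboolP.
  by move=> /andP[xB /asboolP].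
by rewrite mass_fset [RHS]big_fset_condE.
Qed.

(** The difference [mass D - mass [set x]] is approximated by nonnegative finite sums. Being
    complex, it must be shown to be real as well as nonnegative. *)
Lemma mass_ge D x : (forall y, 0 <= mass [set y]) -> D x -> mass [set x] <= mass D.
Proof.
move=> m0 Dx.
have hB B : x \in B -> mass [set x] <= mass (D `&` [set` B]).
  move=> xB; rewrite massI_fset big_mkcond/= (big_fsetD1 x)//= asboolT// lerDl.
  by apply: sumr_ge0 => y _; case: ifP.
have near_e (e : C) : 0 < e -> exists2 s, 0 <= s & `|mass D - mass [set x] - s| < e.
  move=> /mass_approx[A hA]; exists (mass (D `&` [set` (A `|` [fset x])%fset]) - mass [set x]).
    by rewrite subr_ge0 hB// !inE eqxx orbT.
  by rewrite opprB addrA subrK; apply: hA; exact: fsubsetUl.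
rewrite -subr_ge0; move: near_e; set z := mass D - _ => near_e.
have [zr|zr] := boolP (z \is Num.real).
  rewrite real_leNgt//; apply/negP => z0.
  have [|s s0] := near_e (- z); first by rewrite oppr_gt0.
  rewrite -normrN opprB ger0_norm; last by rewrite subr_ge0 (le_trans _ s0)// ltW.
  by rewrite gtrDr (le_gtF s0).
(* A real [s] cannot come closer to [z] than the imaginary part of [z]. *)
have : complex.Im z != 0 by move: zr; case: (z) => a b; rewrite complex_real.
move=> iz; have [|s s0] := near_e (`|complex.Im z|%:C)%C.
  by rewrite ltcR normr_gt0.
move=> /(le_lt_trans (Im_le_norm _)); rewrite ltcR.
have [-> _] := ge0_complexE s0; case: (z) => a b /=.
by rewrite subr0 ltxx.
Qed.
End Mass.

Section Escape.
Variable G : groupType.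
Implicit Types (H K : set G).

(** Inversion turns the right coset of [x * h] into the left coset [h^-1 x^-1 H]. If every such
    right coset met [A], the orbit of [x^-1 H] would lie among the finitely many [y^-1 H] with [y]
    in [A]. *)
Lemma coset_escape H K x (A : {fset G}) : is_subgroup H -> is_subgroup K ->
  condition_SS H K -> ~ K x ->
  exists2 h, H h & forall y, y \in A -> ~ right_coset H (x * h)%g y.
Proof.
move=> [H1 HM HV] [_ _ KV] SS nKx.
have nKg : ~ K x^-1%g by move=> /KV; rewrite invgK.
apply: contrapT => hn; apply: (SS _ nKg).
apply: (@sub_finite_set _ _ [set left_coset y^-1%g H | y in [set` A]]); last first.
  exact/finite_image/finite_fset.
move=> _ [h Hh <-]; apply: contrapT => nA; apply: hn.
exists h^-1%g; first exact: HV.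
move=> y yA; rewrite /right_coset /= invgM invgK => Hy; apply: nA.
exists y => //; apply/seteqP; split=> z.
  move=> [k Hk <-]; exists (x^-1 * (y * (h * x^-1))^-1 * k)%g.
    exists ((y * (h * x^-1))^-1 * k)%g; last by rewrite mulgA.
    by apply: HM => //; exact: HV.
  by rewrite !invgM invgK !mulgA mulgVK mulgV mul1g.
move=> [_ [k Hk <-] <-]; exists (y * (h * x^-1) * k)%g; first exact: HM.
by rewrite !mulgA mulVg mul1g.
Qed.
End Escape.

(** * Normalizers *)

Section Normalizer.
Variables (R : realType) (G : groupType) (E : hilbert R) (Q : set (E -> E)).
Variables (tau : (E -> E) -> R[i]) (alpha : G -> (E -> E) -> E -> E).
Hypotheses (vQ : von_neumann Q) (tQ : faithful_normal_trace Q tau).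
Hypothesis aQ : trace_preserving_action Q tau alpha.
Local Notation C := R[i].
Local Notation L := (l2_hilbert G E).
Local Notation sh := (@Defs.shift R G E).
Local Notation W := (crossed_product Q alpha).
Implicit Types (g h k x y z : G) (v w : E) (xi eta : L) (T U : L -> L) (H K : set G).

Lemma shiftKV g xi : sh g (sh g^-1%g xi) = xi.
Proof. exact: (congr1 (@^~ xi) (@shiftK R G E g)). Qed.

Lemma shiftVKV g xi : sh g^-1%g (sh g xi) = xi.
Proof. exact: (congr1 (@^~ xi) (@shiftVK R G E g)). Qed.

Lemma shift_conj_crossed H k T : is_subgroup H ->
  (forall h, H h -> H (k * h * k^-1)%g) -> W H T -> W H (sh k \o T \o sh k^-1%g).
Proof.
move=> sH kH; rewrite (crossed_productE vQ aQ sH) => cT.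
have bk g := @shift_bounded R G E g.
split; first by apply: bounded_comp; [apply: bounded_comp|]; rewrite //; exact: commutant_bounded cT.
move=> A cA; have bA := commutant_bounded cA.
have cA' : commutant (generators Q alpha H) (sh k^-1%g \o A \o sh k).
  split; first by apply: bounded_comp; [apply: bounded_comp|].
  move=> S gS; have gkS : generators Q alpha H (sh k \o S \o sh k^-1%g).
    case: gS => [cS|[h Hh <-]]; first by left; exact: (coeffs_shift aQ).
    right; exists (k * h * k^-1)%g; first exact: kH.
    by rewrite !shift_comp.
  apply/funext => xi /=.
  have := commutantE (sh k xi) cA gkS; rewrite /= shiftVKV => ->.
  by rewrite shiftVKV.
apply/funext => xi /=.
have := commutantE (sh k^-1%g xi) cT cA'; rewrite /= shiftKV => ->.
by rewrite shiftKV.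
Qed.

Lemma normalizes H k h : group_normalizer H k -> H h ->
  H (k * h * k^-1)%g /\ H (k^-1 * h * k)%g.
Proof.
rewrite /group_normalizer /= => kH Hh; split; first by rewrite -kH; exists h.
by move: Hh; rewrite -{1}kH => -[h' Hh' <-]; rewrite !mulgA mulVg mul1g mulgVK.
Qed.

Lemma crossed_shift H h : H h -> W H (sh h).
Proof. by move=> Hh; apply: sub_vN_generated; right; exists h. Qed.

Lemma shift_normalizer H k : is_subgroup H -> group_normalizer H k ->
  normalizer (W [set: G]) (W H) (sh k).
Proof.
move=> sH kH; split; first exact: crossed_shift.
exists (sh k^-1%g); split; [exact: shift_adjoint|exact: (@shiftK R G E)|exact: (@shiftVK R G E)|].
apply/seteqP; split.
  move=> _ [b Wb <-]; apply: shift_conj_crossed => // h Hh.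
  by have [] := normalizes kH Hh.
move=> b Wb; exists (sh k^-1%g \o b \o sh k).
  rewrite -{2}[k]invgK; apply: shift_conj_crossed => // h Hh.
  by have [_] := normalizes kH Hh; rewrite invgK.
by apply/funext => xi /=; rewrite !shiftKV.
Qed.

Lemma unitary_normalizer H U U' : is_subgroup H -> W H U -> W H U' ->
  unitary_pair U U' -> normalizer (W [set: G]) (W H) U.
Proof.
move=> sH WU WU' [UU' U1 U2]; have vW := crossed_product_vN vQ aQ sH.
split; first exact: crossed_product_sub WU.
exists U'; split=> //; apply/seteqP; split=> [_ [b Wb <-]|b Wb].
  by apply: (vN_comp vW) => //; exact: (vN_comp vW).
exists (U' \o b \o U); first by apply: (vN_comp vW) => //; exact: (vN_comp vW).
have U1' xi : U (U' xi) = xi by exact: (congr1 (@^~ xi) U1).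
by apply/funext => xi /=; rewrite !U1'.
Qed.

(** Shifts by [K] normalize. The coefficients lie in [W H], whose unitaries also normalize, and an
    operator commuting with these unitaries commutes with all of [W H]. *)
Lemma crossed_sub_normalizer H K : is_subgroup H -> is_subgroup K ->
  K `<=` group_normalizer H ->
  W K `<=` vN_generated (normalizer (W [set: G]) (W H)).
Proof.
move=> sH sK KH T WT V [vV NV]; apply: WT; split=> // S [cS|[k Kk <-]]; last first.
  by apply: NV; apply: shift_normalizer => //; exact: KH.
have WS : W H S by apply: sub_vN_generated; left.
apply: (vN_commute vV) => [|A cA]; first by have [] := cS.
apply: (commute_unitaries (crossed_product_vN vQ aQ sH) WS).
  exact: bounded_linear (commutant_bounded cA).
move=> U U' WU WU' UU'.
have VU : V U by apply: NV; exact: unitary_normalizer UU'.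
by apply/funext => xi; exact: commutantE cA VU.
Qed.

(** * Fourier support of the adjoint of a normalizing unitary *)

Section Support.
Variables (H K : set G) (u : L -> L) (t : G -> E -> E).
Hypotheses (sH : is_subgroup H) (sK : is_subgroup K) (SS : condition_SS H K).
Hypotheses (bu : bounded_operators u) (ut : fourier Q alpha u t).
(** For the adjoint [u] of a normalizing unitary [w], the operator [b] is [u \o sh h \o w]. *)
Hypothesis uH : forall h, H h -> exists b b', [/\ W H b, is_adjoint b b', b' \o b = id
  & u \o sh h = b \o u].

Lemma singles_l2 (v : nat -> E) y : square_summable v ->
  (fun n => single y (v n) : L) \in @l2_pred R nat L.
Proof.
by move=> [M hM]; apply/asboolP; exists M => A; under eq_bigr do rewrite norm_single.
Qed.

Definition translates (v : nat -> E) (sv : square_summable v) y : l2_hilbert nat L :=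
  amplify bu (L2 (singles_l2 y sv)).

(* The mass of the y-th column of u on D is the sum of tau (u_x^* u_x) over
   x in D y^-1, where u_x denotes the x-th Fourier coefficient of u. *)
Definition column_mass (v w : nat -> E) (sv : square_summable v)
    (sw : square_summable w) y D :=
  mass (translates sv y) (translates sw y) D.

Section Columns.
Variables (v w : nat -> E) (sv : square_summable v) (sw : square_summable w).
Hypothesis tau_vw : forall q, Q q ->
  (fun n => \sum_(k < n) inner E (q (v k)) (w k) : scalars R) @ \oo
    --> (tau q : scalars R).
Local Notation cm := (column_mass sv sw).

(** The entry at [(x, y)] carries [alpha x^-1], which the invariance of [tau] removes; the mass then
    depends on [x * y^-1] only. *)
Lemma column_mass_point x y q : is_adjoint (t (x * y^-1)%g) q ->
  cm y [set x] = tau (q \o t (x * y^-1)%g).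
Proof.
have [Qt hu] := ut; set g := (x * y^-1)%g => tq.
have Qq : Q q by exact: vN_adjoint (Qt g) tq.
have -> : tau (q \o t g) = tau (alpha x^-1%g (q \o t g)).
  by rewrite (action_trace aQ)//; exact: vN_comp.
rewrite /column_mass mass_single.
have h1 := @l2_inner_nat R L (translates sv y)
  (L2 (amplify_subproof (@mask_bounded R G E [set x]) (translates sw y))).
have h2 := tau_vw (action_Q aQ x^-1%g (vN_comp vQ Qq (Qt g))).
have e : (fun n => \sum_(k < n) inner E (alpha x^-1%g (q \o t g) (v k)) (w k) : scalars R) =
   (fun n => \sum_(k < n) inner L ((translates sv y : l2 nat L) k)
    (mask [set x] ((translates sw y : l2 nat L) k)) : scalars R).
  apply/funext => n; apply: eq_bigr => k _.
  rewrite mask_set1 inner_single.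
  change (inner E (alpha x^-1%g (q \o t g) (v k)) (w k) =
    inner E ((u (single y (v k)) : l2 G E) x) ((u (single y (w k)) : l2 G E) x)).
  rewrite !hu (action_comp aQ)//=.
  by rewrite (is_adjointC (action_adjoint aQ x^-1%g (Qt g) tq)).
rewrite e in h2.
exact: (cvg_unique (@norm_hausdorff _ (scalars R)) h1 h2).
Qed.

Lemma column_mass_shift x y : cm y [set x] = cm 1%g [set (x * y^-1)%g].
Proof.
have [Qt _] := ut; have [q _ tq] := vN_self_adjoint vQ (Qt (x * y^-1)%g).
rewrite (column_mass_point tq).
have tq' : is_adjoint (t (x * y^-1 * 1^-1)%g) q by rewrite invg1 mulg1.
by rewrite (column_mass_point tq') invg1 mulg1.
Qed.

Lemma column_mass_ge0 x y : 0 <= cm y [set x].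
Proof.
have [Qt _] := ut; have [q _ tq] := vN_self_adjoint vQ (Qt (x * y^-1)%g).
by rewrite (column_mass_point tq); exact: (trace_ge0 tQ (Qt _) tq).
Qed.

Lemma column_mass_eq0 x : cm 1%g [set x] = 0 -> t x = 0.
Proof.
have [Qt _] := ut; have [q _ tq] := vN_self_adjoint vQ (Qt x).
have tq' : is_adjoint (t (x * 1^-1)%g) q by rewrite invg1 mulg1.
by rewrite (column_mass_point tq') invg1 mulg1; exact: (trace_faithful tQ (Qt _) tq).
Qed.

(** At points this is [column_mass_shift]. For general [D], both sides are compared with one finite
    sum, taken over [B] and over its translate [B2]. *)
Lemma column_mass_right h D : cm h D = cm 1%g [set z | D (z * h)%g].
Proof.
apply/eqP; rewrite -subr_eq0; apply/eqP; apply: (@eq0_norm_lt _ (scalars R)) => e e0.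
have e2 : 0 < e / 2 by rewrite divr_gt0.
have [A1 h1] := mass_approx (translates sv h) (translates sw h) e2.
have [A2 h2] := mass_approx (translates sv 1%g) (translates sw 1%g) e2.
pose B := (A1 `|` [fset (z * h)%g | z in A2])%fset.
pose B2 := [fset (x * h^-1)%g | x in B]%fset.
have AB2 : (A2 `<=` B2)%fset.
  apply/fsubsetP => z zA2; apply/imfsetP; exists (z * h)%g; last by rewrite mulgK.
  by apply/fsetUP; right; apply/imfsetP; exists z.
have {}h1 := h1 D B (fsubsetUl _ _).
have {}h2 := h2 [set z | D (z * h)%g] B2 AB2.
have sE : mass (translates sv h) (translates sw h) (D `&` [set` B]) =
    mass (translates sv 1%g) (translates sw 1%g) ([set z | D (z * h)%g] `&` [set` B2]).
  rewrite !massI_fset [in RHS]big_mkcond/= big_imfset/=; last by move=> z z' _ _ /mulIg.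
  rewrite big_mkcond/=; apply: eq_bigr => x _; rewrite mulgVK.
  by case: ifP => // _; exact: column_mass_shift.
rewrite -sE in h2; rewrite /column_mass.
set a := mass _ _ D in h1 *; set b := mass _ _ [set z | _] in h2 *.
set s := mass _ _ (D `&` _) in h1 h2.
have -> : a - b = (a - s) - (b - s) by rewrite opprB addrA subrK.
by rewrite (splitr e); exact: le_lt_trans (ler_normB _ _) (ltrD h1 h2).
Qed.

(** Column [h] of [u] is [b] applied to column [1], and [b] is an isometry commuting with
    restriction to right cosets of [H]. *)
Lemma column_mass_left h x : H h -> cm h (right_coset H x) = cm 1%g (right_coset H x).
Proof.
move=> Hh; have [b [b' [Wb bb' b1 uh]]] := uH Hh.
have bb := vN_bounded (crossed_product_vN vQ aQ sH) Wb.
have bb1 := bounded_adjoint bb bb'.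
set D := right_coset H x.
have tE (a : nat -> E) (sa : square_summable a) :
    translates sa h = amplify bb (translates sa 1%g).
  apply: l2ext => n.
  change (u (single h (a n)) = b (u (single 1%g (a n)))).
  have := congr1 (@^~ (single 1%g (a n))) uh.
  by rewrite /= -/(Defs.shift _ _) shift_single mulg1.
rewrite /column_mass /mass !tE.
have -> : amplify (@mask_bounded R G E D) (amplify bb (translates sv 1%g)) =
    amplify bb (amplify (@mask_bounded R G E D) (translates sv 1%g)).
  apply: l2ext => n; symmetry.
  apply: (mask_commute vQ aQ (D := D) ((translates sv 1%g : l2 nat L) n) sH Wb).
  by move=> k z Hk; exact: right_coset_invariant.
have bK : amplify bb1 (amplify bb (translates sw 1%g)) = translates sw 1%g.
  by apply: l2ext => n; exact: (congr1 (@^~ _) b1).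
rewrite -[in RHS]bK; exact: (amplify_adjoint bb bb1 bb').
Qed.
End Columns.

Lemma coefficients_support x : ~ K x -> t x = 0.
Proof.
move=> nKx; have [v [w [sv sw tau_vw]]] := trace_normal tQ.
pose cm := column_mass sv sw.
apply: (column_mass_eq0 (sv := sv) (sw := sw) tau_vw).
set D := right_coset H x.
have cD : cm 1%g [set x] <= cm 1%g D.
  apply: mass_ge; last exact: right_cosetxx.
  by move=> y; exact: column_mass_ge0.
apply/eqP/negPn/negP => cx0.
have c0 : 0 < cm 1%g D.
  by apply: lt_le_trans cD; rewrite lt_def cx0 column_mass_ge0.
(* The mass of the coset itself is the precision: a translate avoiding [A] would have smaller mass,
   although translates by [H] all have the same mass. *)
have [A hA] := mass_approx (translates sv 1%g) (translates sw 1%g) c0.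
have [h Hh xhA] := coset_escape A sH sK SS nKx.
have Hh' : H h^-1%g by have [_ _] := sH; apply.
have := hA (right_coset H (x * h)%g) A (fsubset_refl _).
have -> : right_coset H (x * h)%g `&` [set` A] = [set` fset0].
  by apply/seteqP; split=> y //= [+ yA] => /(xhA _ yA).
rewrite mass_fset big_seq_fset0 subr0.
have -> : mass (translates sv 1%g) (translates sw 1%g) (right_coset H (x * h)%g) = cm 1%g D.
  rewrite /cm -(column_mass_left sv sw x Hh') (column_mass_right sv sw tau_vw).
  congr (mass _ _ _); apply/seteqP.
  by split=> z; rewrite /D /right_coset /= invgM mulgA.
by rewrite ger0_norm ?ltxx// ltW.
Qed.

Lemma crossed_product_support_sub : W K u.
Proof.
apply: (crossed_product_fourier vQ aQ sK bu ut) => x; exact: coefficients_support.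
Qed.
End Support.

Lemma normalizer_sub H K : is_subgroup H -> is_subgroup K -> condition_SS H K ->
  normalizer (W [set: G]) (W H) `<=` W K.
Proof.
move=> sH sK SS u [Wu [u' [uu' u1 u2 uB]]].
have vG := crossed_product_vN vQ aQ (@subgroupT G).
have vK := crossed_product_vN vQ aQ sK.
have Wu' : W [set: G] u' by exact: vN_adjoint Wu uu'.
have bu' := vN_bounded vG Wu'.
have [t ut] := fourier_exists vQ tQ aQ Wu'.
apply: (vN_adjoint vK _ (is_adjointC uu')).
apply: (crossed_product_support_sub sH sK SS bu' ut) => h Hh.
have HV : H h^-1%g by have [_ _] := sH; apply.
have u1' xi : u (u' xi) = xi by exact: (congr1 (@^~ xi) u1).
have u2' xi : u' (u xi) = xi by exact: (congr1 (@^~ xi) u2).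
have conj k : H k -> exists2 b, W H b & b = u' \o sh k \o u.
  move=> Hk; have : W H (sh k) by exact: crossed_shift.
  rewrite -{1}uB => -[b Wb bk]; exists b => //; rewrite -bk.
  apply/funext => xi /=.
  by rewrite !u2'.
have [b Wb bE] := conj _ Hh; have [b' _ b'E] := conj _ HV.
exists b, b'; split=> //.
- rewrite bE b'E.
  exact: is_adjoint_comp (is_adjoint_comp (is_adjointC uu') (@shift_adjoint R G E h)) uu'.
- by apply/funext => xi; rewrite bE b'E /= u1' shiftVKV u2'.
- by apply/funext => xi; rewrite bE /= u1'.
Qed.

Theorem crossed_normalizer H K : is_subgroup H -> is_subgroup K ->
  K `<=` group_normalizer H -> condition_SS H K ->
  vN_generated (normalizer (W [set: G]) (W H)) = W K.
Proof.
move=> sH sK KH SS; apply/seteqP; split; last exact: crossed_sub_normalizer.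
apply: vN_generated_sub; first exact: (crossed_product_vN vQ aQ sK).
exact: normalizer_sub.
Qed.
End Normalizer.

(** * One-sided quasi-normalizers in group algebras *)

Section Scalars.
Variables (R : realType) (G : groupType).
Local Notation C := R[i].
Local Notation E0 := (scalar_hilbert R).
Local Notation L := (l2_hilbert G E0).
Local Notation sh := (@Defs.shift R G E0).
Let one : E0 := (1 : C).

(** With the bounded operators on [E0], that is the scalars, and the trivial action, [L(H)] becomes
    a crossed product and the preceding results apply to it. *)
Definition scalar_trace (q : E0 -> E0) : C := q one.
Definition trivial_action (g : G) (q : E0 -> E0) : E0 -> E0 := q.
Local Notation B0 := (@bounded_operators R E0).
Local Notation W := (@crossed_product R G E0 B0 trivial_action).

Lemma scalar_operatorE (q : E0 -> E0) z : B0 q -> q z = (z : C) *: q one.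
Proof.
move=> bq; rewrite -(linZ (bounded_linear bq)); congr (q _).
by rewrite /one; change (z = (z : C) * 1 :> C); rewrite mulr1.
Qed.

Lemma scalar_innerE (x y : E0) : inner E0 x y = (x : C) * (y : C)^*.
Proof. by []. Qed.

Lemma scalar_commute (q p : E0 -> E0) : B0 q -> B0 p -> q \o p = p \o q.
Proof.
move=> bq bp; apply/funext => z /=.
rewrite (scalar_operatorE _ bq) [RHS](scalar_operatorE _ bp).
rewrite (scalar_operatorE z bp) (scalar_operatorE z bq).
change (((z : C) * (p one : C)) * (q one : C) = ((z : C) * (q one : C)) * (p one : C)).
by rewrite mulrAC.
Qed.

Lemma scalars_von_neumann : von_neumann B0.
Proof.
split; [by move=> T|by move=> T T'; exact: bounded_adjoint|].
apply/seteqP; split=> [T [bT _] //|T bT]; split=> [//|A [bA _]].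
exact: scalar_commute.
Qed.

Lemma scalar_trace_adjoint (x x' : E0 -> E0) : is_adjoint x x' ->
  scalar_trace (x' \o x) = `|x one| ^+ 2.
Proof.
move=> xx'; have h := xx' one (x one); rewrite !scalar_innerE in h.
have {}h : `|x one : C| ^+ 2 = (x' (x one) : C)^*.
  by rewrite normCK h /one mul1r.
have hh : ((`|x one : C| ^+ 2)^* : C) = x' (x one) by rewrite h conjCK.
apply: (etrans (esym hh)).
by apply/CrealP/ger0_real; rewrite exprn_ge0.
Qed.

Lemma scalar_faithful_normal_trace : faithful_normal_trace B0 scalar_trace.
Proof.
split=> //.
- by move=> x x' _ xx'; rewrite scalar_trace_adjoint// exprn_ge0.
- move=> x x' bx xx'; rewrite scalar_trace_adjoint// => /eqP.
  rewrite sqrf_eq0 normr_eq0 => /eqP x1; apply/funext => z.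
  by rewrite (scalar_operatorE z bx) x1 scaler0.
- by move=> x y bx by_; rewrite scalar_commute.
- pose v (n : nat) : E0 := if n == 0%N then one else 0.
  have sv : square_summable v.
    have -> : v = single 0%N one by apply/funext.
    exact: l2P.
  exists v, v; split=> // x bx.
  apply: cvg_near_cst; exists 1%N => // n /= n0.
  rewrite (bigD1 (Ordinal n0))//= big1 ?addr0 => [|k k0].
    by rewrite /v/= scalar_innerE /one conjC1 mulr1.
  have -> : v k = 0 by rewrite /v ifN.
  by apply: etrans (scalar_innerE _ _) _; rewrite conjC0 mulr0.
Qed.

Lemma trivial_trace_preserving_action :
  trace_preserving_action B0 scalar_trace trivial_action.
Proof. by split. Qed.

Lemma group_algebraE (H : set G) : group_algebra R H = W H.
Proof.
apply/seteqP; split=> T hT M [vM SM]; apply: hT; split=> //.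
  by move=> S hS; apply: SM; right.
move=> S [[bS [q bq Sq]]|hS]; last exact: SM.
have -> : S = (q one : C) *: id.
  apply/funext => xi; apply: l2ext => g; rewrite Sq /trivial_action scalar_operatorE//.
  change (((xi : l2 G E0) g : C) * (q one : C) = (q one : C) * ((xi : l2 G E0) g : C)).
  exact: mulrC.
by apply: (vN_scale vM); exact: vN_id.
Qed.
End Scalars.

(** * Geometric series of contractions *)

Section GeometricSeries.
Variables (R : realType) (E : hilbert R) (r : R[i]).
Local Notation C := R[i].
Hypotheses (r0 : 0 <= r) (r2 : r <= 1 / 2).

Lemma geometric_tail m n : \sum_(m <= k < n) r ^+ k <= 2 * r ^+ m.
Proof.
have [nm|mn] := leqP n m.
  by rewrite big_geq// mulr_ge0 ?exprn_ge0.
have [d ->] : exists d, n = (m + d)%N by exists (n - m)%N; rewrite subnKC// ltnW.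
elim: d m {mn} => [|d IH] m.
  by rewrite addn0 big_geq// mulr_ge0 ?exprn_ge0.
rewrite big_ltn ?addnS ?ltnS ?leq_addr// -addSn.
apply: le_trans (lerD (lexx _) (IH _)) _.
rewrite exprS mulrA [2 * r ^+ m]mulr_natl mulr2n lerD2l ler_piMl ?exprn_ge0//.
by rewrite -[1 + 1]/(2 : C) mulrC -ler_pdivlMr.
Qed.

Lemma small_power (x e : C) : 0 <= x -> 0 < e -> exists m, x * r ^+ m < e.
Proof.
move=> /ge0_complexE[-> x0] /gt0_complexE[-> e0].
move: (complex.Re x) x0 => {x} x x0; move: (complex.Re e) e0 => {e} e e0.
pose m := Num.bound (x / e); exists m.
have h : x / e < 2 ^+ m.
  apply: lt_le_trans (archi_boundP _) _; first by rewrite divr_ge0// ltW.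
  by rewrite -natrX ler_nat ltnW// ltn_expl.
apply: (@le_lt_trans _ _ (x%:C * (1 / 2) ^+ m)%C).
  by rewrite ler_wpM2l ?ler0c// lerXn2r ?nnegrE// divr_ge0.
have -> : (1 / 2 : C) = ((2^-1)%:C)%C by rewrite div1r fmorphV/= rmorph_nat.
rewrite -rmorphXn/= -rmorphM/= ltcR exprVn ltr_pdivrMr ?exprn_gt0// mulrC.
by rewrite -ltr_pdivrMr.
Qed.

(** The last clause is the form in which [T] enters the von Neumann algebra generated by the [U k]:
    what commutes with all of them commutes with [T]. *)
Lemma geometric_operator (c : nat -> C) (U : nat -> E -> E) :
  (forall k, `|c k| <= r ^+ k) -> (forall k, linear (U k)) ->
  (forall k xi, `|U k xi| <= `|xi|) ->
  exists T, [/\ bounded_operators T,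
    forall xi (e : C), 0 < e -> exists N, forall n, (N <= n)%N ->
      `|T xi - \sum_(k < n) c k *: U k xi| < e &
    forall A, bounded_operators A -> (forall k, A \o U k = U k \o A) -> A \o T = T \o A].
Proof.
move=> cr lU nU; pose s n xi := \sum_(k < n) c k *: U k xi.
have sB m n xi : (m <= n)%N -> `|s n xi - s m xi| <= 2 * r ^+ m * `|xi|.
  move=> mn; rewrite /s -!(big_mkord xpredT (fun k => c k *: U k xi)).
  rewrite (big_cat_nat (leq0n m) mn)/= [_ + _ - _]addrC addKr.
  apply: le_trans (ler_norm_sum _ _ _) _.
  apply: (@le_trans _ _ (\sum_(m <= k < n) r ^+ k * `|xi|)).
    by apply: ler_sum => k _; rewrite normrZ ler_pM.
  by rewrite -mulr_suml ler_wpM2r// geometric_tail.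
have sN xi (e : C) : 0 < e -> exists N, forall n, (N <= n)%N -> `|s n xi - s N xi| < e.
  move=> e0; have [|m hm] := @small_power (2 * `|xi|) e _ e0; first by rewrite mulr_ge0.
  exists m => n mn; apply: le_lt_trans (sB _ _ _ mn) _.
  by rewrite mulrAC.
have s_cvg xi : cvg (s ^~ xi @ \oo).
  apply/cauchy_cvgP/cauchyP => e /(sN xi)[N hN]; exists (s N xi).
  by exists N => // n /= Nn; rewrite -ball_normE /= distrC; exact: hN.
pose T xi := lim (s ^~ xi @ \oo).
have T_near xi (e : C) : 0 < e -> exists N, forall n, (N <= n)%N -> `|T xi - s n xi| < e.
  move=> e0; have /cvgrPdist_lt/(_ _ e0)[N _ hN] := s_cvg xi.
  by exists N => n Nn; exact: hN.
exists T; split=> //; last first.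
  move=> A [lA cA] AU; apply/funext => xi /=.
  have h : s ^~ (A xi) @ \oo --> A (T xi).
    have -> : s ^~ (A xi) = A \o s ^~ xi.
      apply/funext => n; rewrite /s/= (lin_sum lA); apply: eq_bigr => k _.
      by rewrite (linZ lA); congr (_ *: _); exact: (esym (congr1 (@^~ xi) (AU k))).
    by apply: (cvg_comp _ _ (s_cvg xi)); exact: cA.
  exact: (cvg_unique _ h (s_cvg _)).
apply/bounded_operatorsP; split.
  move=> a xi eta.
  have h : s ^~ (a *: xi + eta) @ \oo --> a *: T xi + T eta.
    have -> : s ^~ (a *: xi + eta) = (fun n => a *: s n xi + s n eta).
      apply/funext => n; rewrite /s scaler_sumr -big_split/=; apply: eq_bigr => k _.
      by rewrite lU scalerDr !scalerA mulrC.
    by apply: cvgD; [apply: cvgZl_tmp; exact: s_cvg|exact: s_cvg].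
  exact: (cvg_unique _ (s_cvg _) h).
(* The partial sums are bounded by [2], and [1] is the error allowed against one of them. *)
exists (2 + 1) => [|xi]; first by rewrite addr_ge0.
have [->|xi0] := eqVneq xi 0.
  rewrite (_ : T 0 = 0) ?normr0 ?mulr0//; apply: eq0_norm_lt => e /(T_near 0)[N hN].
  have := hN N (leqnn _); rewrite /s big1 ?subr0// => k _.
  by rewrite (lin0 (lU k)) scaler0.
have xi1 : 0 < `|xi| by rewrite normr_gt0.
have [N hN] := T_near xi `|xi| xi1.
rewrite -[T xi](subrK (s N xi)); apply: le_trans (ler_normD _ _) _.
rewrite addrC mulrDl mul1r; apply: lerD; last exact: ltW (hN _ _).
have := sB 0%N N xi (leq0n _).
by rewrite {2}/s big_ord0 subr0 expr0 mulr1.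
Qed.
End GeometricSeries.

(** * The gliding hump *)

Section GlidingHump.
Variables (R : realType) (I : choiceType) (E : hilbert R).
Local Notation C := R[i].
Local Notation L := (l2 I E).
Variables (z : nat -> L) (p : nat -> I) (Z c0 r : C).
Hypotheses (r0 : 0 < r) (r2 : r <= 1 / 2) (c0_gt0 : 0 < c0).
Hypotheses (zZ : forall k, `|z k| <= Z) (zp : forall k, c0 <= `|z k (p k)|).
Hypothesis Zr : Z * (2 * r) <= c0 / 4.

(** If the sum so far is already large at [p m], nothing is added. Otherwise [r ^+ m *: z m] is
    added, whose entry of size at least [r ^+ m * c0] cannot be cancelled by one below half of
    that. *)
Let coef (u : L) m : C := if r ^+ m * (c0 / 2) <= `|u (p m)| then 0 else r ^+ m.

Let Fixpoint hump n : L := if n is m.+1 then hump m + coef (hump m) m *: z m else 0.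

Let rm_ge0 m : 0 <= r ^+ m. Proof. by rewrite exprn_ge0// ltW. Qed.

Let coef_le u m : `|coef u m| <= r ^+ m.
Proof. by rewrite /coef; case: ifP => _; rewrite ?normr0// ger0_norm. Qed.

Let humpE n : hump n = \sum_(k < n) coef (hump k) k *: z k.
Proof. by elim: n => [|n IH]; rewrite ?big_ord0// big_ord_recr/= -IH. Qed.

Let hump_step m : r ^+ m * (c0 / 2) <= `|hump m.+1 (p m)|.
Proof.
change (r ^+ m * (c0 / 2) <= `|hump m (p m) + coef (hump m) m *: z m (p m)|).
rewrite /coef; case: ifPn => [h|]; first by rewrite scale0r addr0.
rewrite -real_ltNge ?normr_real//; last first.
  by rewrite ger0_real// mulr_ge0// divr_ge0// ltW.
move=> h; rewrite addrC; apply: le_trans (lerB_normD _ _).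
rewrite normrZ ger0_norm// lerBrDr; apply: (@le_trans _ _ (r ^+ m * c0)).
  have -> : r ^+ m * c0 = r ^+ m * (c0 / 2) + r ^+ m * (c0 / 2) by field.
  by rewrite lerD2l ltW.
by rewrite ler_wpM2l.
Qed.

(* Each coefficient is chosen so that the partial sum is large at p m; the
   remaining terms are too small to destroy this. *)
Lemma gliding_hump : exists c : nat -> C, (forall k, `|c k| <= r ^+ k) /\
  forall m n, (m < n)%N -> r ^+ m * (c0 / 4) <= `|(\sum_(k < n) c k *: z k) (p m)|.
Proof.
exists (fun k => coef (hump k) k); split=> [k|m n mn]; first exact: coef_le.
rewrite -(big_mkord xpredT (fun k => coef (hump k) k *: z k)).
rewrite (big_cat_nat (leq0n _) mn)/= big_mkord -humpE.
set s := \sum_(_ <= _ < _) _.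
(* The later terms add up to at most [2 * r ^+ m.+1 * Z]; by [Zr] they destroy at most half of what
   [hump_step] secures. *)
have hs : `|s (p m)| <= r ^+ m * (c0 / 4).
  apply: le_trans (l2_norm_coord _ _) _.
  apply: le_trans (ler_norm_sum _ _ _) _.
  apply: (@le_trans _ _ (\sum_(m.+1 <= k < n) r ^+ k * Z)).
    by apply: ler_sum => k _; rewrite normrZ ler_pM.
  rewrite -mulr_suml; apply: (@le_trans _ _ (2 * r ^+ m.+1 * Z)).
    rewrite ler_wpM2r ?geometric_tail ?(ltW r0)//.
    exact: le_trans (zZ 0%N).
  rewrite exprS.
  have -> : 2 * (r * r ^+ m) * Z = r ^+ m * (Z * (2 * r)) by ring.
  by rewrite ler_wpM2l.
change (r ^+ m * (c0 / 4) <= `|hump m.+1 (p m) + s (p m)|).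
apply: le_trans (lerB_normD _ _); rewrite lerBrDr.
apply: le_trans (hump_step m); apply: (@le_trans _ _ (r ^+ m * (c0 / 4) + r ^+ m * (c0 / 4))).
  by rewrite lerD2l.
by rewrite -mulrDr; have -> : c0 / 4 + c0 / 4 = c0 / 2 by field.
Qed.
End GlidingHump.

(** * The one-sided quasi-normalizer under condition (SS) *)

Section QuasiNormalizer.
Variables (R : realType) (G : groupType).
Local Notation C := R[i].
Local Notation E0 := (scalar_hilbert R).
Local Notation L := (l2_hilbert G E0).
Local Notation sh := (@Defs.shift R G E0).
Local Notation B0 := (@bounded_operators R E0).
Local Notation W := (@crossed_product R G E0 B0 (@trivial_action R G)).
Let one : E0 := (1 : C).
Let vQ := scalars_von_neumann R.
Let tQ := scalar_faithful_normal_trace R.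
Let aQ := trivial_trace_preserving_action R G.
Implicit Types (H K : set G) (T : L -> L).

Let vW H : is_subgroup H -> von_neumann (W H).
Proof. by move=> sH; exact: (crossed_product_vN vQ aQ sH). Qed.

Lemma far_coset H K x n (eta : 'I_n -> L) (e : C) : is_subgroup H -> is_subgroup K ->
  condition_SS H K -> ~ K x -> 0 < e ->
  exists h, H h /\ forall i, `|mask (right_coset H (x * h)%g) (eta i)| <= e.
Proof.
move=> sH sK SS nKx e0.
have /choice[A hA] i : exists A : {fset G}, forall B, (A `<=` B)%fset ->
    `|(eta i : l2 G E0) - mask [set` B] (eta i)| < e by exact: mask_approx.
have [h Hh hB] := coset_escape (\bigcup_(i <- enum 'I_n) A i)%fset sH sK SS nKx.
exists h; split=> // i; set D := right_coset H _ in hB *.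
have AB : (A i `<=` \bigcup_(i <- enum 'I_n) A i)%fset.
  by apply/fsubsetP => y yA; apply/bigfcupP; exists i => //; rewrite mem_enum.
apply/ltW/(le_lt_trans _ (hA i _ AB)); set B := (\bigcup_(i <- _) _)%fset in hB *.
have -> : mask D (eta i) = mask D ((eta i : l2 G E0) - mask [set` B] (eta i)).
  apply: l2ext => y; have [Dy|Dy] := pselect (D y); last by rewrite !maskF.
  rewrite !maskT//; change ((eta i : l2 G E0) y =
    (eta i : l2 G E0) y - mask [set` B] (eta i : l2 G E0) y).
  by rewrite maskF ?subr0// => yB; exact: (hB y yB Dy).
exact: norm_mask.
Qed.

Lemma adjoint_sum n (T T' : 'I_n -> L -> L) : (forall i, is_adjoint (T i) (T' i)) ->
  is_adjoint (\sum_(i < n) T i) (\sum_(i < n) T' i).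
Proof.
move=> TT'; elim: n T T' TT' => [|n IH] T T' TT'.
  by rewrite !big_ord0 => v w; rewrite inner0l inner0r.
rewrite !big_ord_recl; have := IH _ _ (fun i => TT' (lift ord0 i)).
by move=> /(is_adjoint_lin 1 (TT' ord0)); rewrite conjC1 !scale1r.
Qed.

(** Let [u] be [x' \o beta] applied to the unit vector at [1]. The hump makes [u] of order [r ^+ m]
    at [g * h m]. But [u] is also a sum of elements of [W H] applied to the [eta i], so its
    restriction to the coset of that point is of order [r ^+ m * r ^+ m]. *)
Lemma quasi_normalizer_sub H K : is_subgroup H -> is_subgroup K ->
  condition_SS H K ->
  one_sided_quasi_normalizer (W [set: G]) (W H) `<=` W K.
Proof.
move=> sH sK SS x [Wx [n [y [Wy hy]]]].
have vG := vW (@subgroupT G); have vH := vW sH.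
have [x' Wx' xx'] := vN_self_adjoint vG Wx.
apply: (vN_adjoint (vW sK) _ (is_adjointC xx')).
have [t xt] := fourier_exists vQ tQ aQ Wx'.
have [Qt ht] := xt.
apply: (crossed_product_fourier vQ aQ sK (vN_bounded vG Wx') xt) => g nKg.
apply: contrapT => tg0.
pose c0 : C := `|t g one|.
have c00 : 0 < c0.
  rewrite normr_gt0; apply/eqP => h; apply: tg0; apply/funext => w.
  by rewrite (scalar_operatorE w (Qt g)) -/one h scaler0.
have /bounded_operatorsP[lx' [M M0 hM]] := vN_bounded vG Wx'.
pose Z : C := M * `|one|.
have Z0 : 0 <= Z by rewrite mulr_ge0.
have Zc : 0 < Z + c0 by rewrite ltr_wpDl.
(* This ratio is at most [1 / 8] and makes [Z * (2 * r)] at most [c0 / 4], the two conditions of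
   [gliding_hump]. *)
pose r : C := c0 / (8 * (Z + c0)).
have r0 : 0 < r by rewrite divr_gt0// mulr_gt0.
have r2 : r <= 1 / 2.
  rewrite ler_pdivrMr ?mulr_gt0//.
  have -> : 1 / 2 * (8 * (Z + c0)) = c0 + (3 * c0 + 4 * Z) by field.
  by rewrite lerDl addr_ge0 ?mulr_ge0// ltW.
have Zr : Z * (2 * r) <= c0 / 4.
  have -> : Z * (2 * r) = (Z / (Z + c0)) * (c0 / 4).
    by rewrite /r; field; rewrite gt_eqF.
  rewrite ler_piMl ?divr_ge0 ?(ltW c00)// ler_pdivrMr// mul1r lerDl.
  exact: ltW.
have /choice[y' yy'] i : exists y', is_adjoint (y i) y'.
  by have [y' _] := vN_self_adjoint vG (Wy i); exists y'.
pose eta i := y' i (single 1%g one).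
(* The cosets are chosen with the squared rate, so that the [eta i] decay faster than the hump. *)
have /choice[h hh] m := far_coset eta sH sK SS nKg (mulr_gt0 (exprn_gt0 m r0) (exprn_gt0 m r0)).
pose z k : l2 G E0 := x' (single (h k) one).
have zp k : z k (g * h k)%g = t g one by rewrite /z ht mulgK.
have zZ k : `|z k| <= Z.
  by apply: le_trans (hM _) _; rewrite norm_single.
have [|c [cr cz]] := @gliding_hump _ _ _ z (fun k => (g * h k)%g) Z c0 r r0 r2 c00 zZ _ Zr.
  by move=> k; rewrite zp.
have [beta [bbeta bapp bcomm]] := geometric_operator (ltW r0) r2 cr
  (fun k => bounded_linear (@shift_bounded R G E0 (h k)))
  (fun k xi => @norm_shift R G E0 (h k) xi).
have Wbeta : W H beta.
  apply: (vN_commute vH bbeta) => A cA; apply: bcomm; first exact: commutant_bounded cA.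
  move=> k; apply/funext => xi; apply: (commutantE _ cA).
  by apply: crossed_shift; have [] := hh k.
have [b Wb betab] := vN_self_adjoint vH Wbeta.
have [d [Wd bx]] := hy _ Wb.
have /choice[d' dd'] i : exists d', W H d' /\ is_adjoint (d i) d'.
  by have [d' Wd' dd'] := vN_self_adjoint vH (Wd i); exists d'.
have xbeta : x' \o beta = \sum_(i < n) (d' i \o y' i).
  apply: (@adjoint_unique _ _ (b \o x)).
    exact: is_adjoint_comp (is_adjointC betab) xx'.
  rewrite bx; apply: adjoint_sum => i.
  by apply: is_adjoint_comp (yy' i) _; have [] := dd' i.
have /choice[N hN] i : exists N : C, 0 <= N /\ forall xi, `|d' i xi| <= N * `|xi|.
  have [Wd' _] := dd' i; have /bounded_operatorsP[_ [N N0 hN]] := vN_bounded vH Wd'.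
  by exists N.
pose u : l2 G E0 := x' (beta (single 1%g one)).
have u_small m : `|u (g * h m)%g| <= (\sum_i N i) * (r ^+ m * r ^+ m).
  set D := right_coset H (g * h m)%g.
  have -> : u (g * h m)%g = mask D u (g * h m)%g by rewrite maskT//; exact: right_cosetxx.
  apply: le_trans (l2_norm_coord _ _) _.
  have uE : u = \sum_(i < n) d' i (eta i).
    have /(congr1 (@^~ (single 1%g one))) := xbeta.
    by rewrite /= fct_sumE.
  have lm := bounded_linear (@mask_bounded R G E0 D).
  have -> : mask D u = \sum_(i < n) d' i (mask D (eta i)).
    rewrite uE (lin_sum lm); apply: eq_bigr => i _; symmetry.
    apply: (mask_commute vQ aQ (D := D) (eta i) sH (proj1 (dd' i))).
    by move=> k w Hk; exact: right_coset_invariant.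
  apply: le_trans (ler_norm_sum _ _ _) _; rewrite mulr_suml; apply: ler_sum => i _.
  have [N0 hNi] := hN i; apply: le_trans (hNi _) _; rewrite ler_wpM2l//.
  by have [_] := hh m; apply.
have N0 : 0 <= \sum_i N i by apply: sumr_ge0 => i _; have [] := hN i.
have c4 : 0 < c0 / 4 by rewrite divr_gt0.
(* The added [1] pays for replacing [beta] by a partial sum. *)
have [|m hm] := @small_power _ r (ltW r0) r2 (\sum_i N i + 1) _ _ c4.
  by rewrite addr_ge0.
have rm : 0 < r ^+ m by rewrite exprn_gt0.
suff : c0 / 4 <= (\sum_i N i + 1) * r ^+ m by move=> /le_lt_trans/(_ hm); rewrite ltxx.
rewrite -(ler_pM2l rm).
have M1 : 0 < M + 1 by rewrite ltr_wpDl.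
(* Dividing by [M + 1] leaves an error of at most [r ^+ m * r ^+ m] after [x'] is applied. *)
have e0 : 0 < r ^+ m * r ^+ m / (M + 1) by rewrite divr_gt0// mulr_gt0.
have [k hk] := bapp (single 1%g one) _ e0.
have {}hk := hk _ (leq_maxl k m.+1).
(* The number of terms is at least [k] for the approximation of [beta] and exceeds [m] for the
   hump. *)
apply: le_trans (cz m _ (leq_maxr k m.+1)) _.
set nn := maxn k m.+1 in hk *.
have us : `|u - \sum_(j < nn) c j *: z j| <= r ^+ m * r ^+ m.
  have -> : u - \sum_(j < nn) c j *: z j =
      x' (beta (single 1%g one) - \sum_(j < nn) c j *: sh (h j) (single 1%g one)).
    rewrite (linB lx') (lin_sum lx'); congr (_ - _); apply: eq_bigr => j _.
    by rewrite (linZ lx') shift_single mulg1.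
  apply: le_trans (hM _) _; move/ltW: hk; rewrite ler_pdivlMr// => hk.
  by apply: le_trans hk; rewrite mulrC ler_wpM2l// lerDl.
apply: (@le_trans _ _ (`|u (g * h m)%g| + `|u - \sum_(j < nn) c j *: z j|)).
  set s := \sum_(j < nn) c j *: z j.
  apply: (@le_trans _ _ (`|u (g * h m)%g| + `|(u - s) (g * h m)%g|)); last first.
    by rewrite lerD2l; exact: l2_norm_coord.
  have -> : s (g * h m)%g = u (g * h m)%g - (u - s) (g * h m)%g.
    by rewrite l2D l2N opprB addrC subrK.
  exact: ler_normB.
apply: le_trans (lerD (u_small m) us) _.
by rewrite [leRHS]mulrCA mulrDl mul1r.
Qed.
End QuasiNormalizer.

(** * Finite orbits and the equivalence for group algebras *)

Section GroupAlgebra.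
Variables (R : realType) (G : groupType).
Local Notation C := R[i].
Local Notation E0 := (scalar_hilbert R).
Local Notation L := (l2_hilbert G E0).
Local Notation sh := (@Defs.shift R G E0).
Local Notation B0 := (@bounded_operators R E0).
Local Notation W := (@crossed_product R G E0 B0 (@trivial_action R G)).
Let one : E0 := (1 : C).
Let vQ := scalars_von_neumann R.
Let tQ := scalar_faithful_normal_trace R.
Let aQ := trivial_trace_preserving_action R G.
Implicit Types (H K : set G) (T : L -> L).

(** Pinching keeps the Fourier coefficients on [H] and kills the others: it is the conditional
    expectation onto [W H]. *)
Lemma pinch_crossed H T : is_subgroup H -> W [set: G] T ->
  exists2 U, W H U & forall xi x,
    (U xi : l2 G E0) x = (T (mask (right_coset H x) xi) : l2 G E0) x.
Proof.
move=> sH WT; have vG := crossed_product_vN vQ aQ (@subgroupT G).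
have [U [bU hU]] := pinch_exists sH (vN_bounded vG WT).
have [t [Qt ht]] := fourier_exists vQ tQ aQ WT.
exists U => //.
apply: (crossed_product_fourier vQ aQ sH bU (t := fun g => if `[< H g >] then t g else 0)).
  split=> [g|x y v]; first by case: ifP => _ //; exact: bounded0.
  have [H1 HM HV] := sH; rewrite hU; have [Hyx|nHyx] := pselect (right_coset H x y).
    rewrite mask_single// asboolT ?ht//.
    by move: (HV _ Hyx); rewrite invgM invgK.
  rewrite mask_single0// (lin0 (bounded_linear (vN_bounded vG WT))) asboolF//.
  by move=> /HV; rewrite invgM invgK.
by move=> g nHg; rewrite asboolF.
Qed.

Lemma quasi_normalizer_shift H k : is_subgroup H -> group_normalizer H k ->
  one_sided_quasi_normalizer (W [set: G]) (W H) (sh k).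
Proof.
move=> sH kH; split; first exact: crossed_shift.
exists 1%N, (fun=> sh k); split=> [_|b Wb]; first exact: crossed_shift.
exists (fun=> sh k^-1%g \o b \o sh k); split=> [_|].
  rewrite -{2}[k]invgK; apply: (shift_conj_crossed vQ aQ sH) => // h Hh.
  by have [_] := normalizes kH Hh; rewrite invgK.
rewrite big_ord_recl big_ord0 addr0; apply/funext => xi /=.
by rewrite shiftKV.
Qed.

(* A finite orbit {h_i g H} gives H g <= \bigcup_i h_i g H, and the
   pinchings onto L(H) of (h_i g)^-1 b g decompose b g along these cosets. *)
Lemma quasi_normalizer_finite_orbit H g : is_subgroup H ->
  finite_set [set left_coset h (left_coset g H) | h in H] ->
  one_sided_quasi_normalizer (W [set: G]) (W H) (sh g).
Proof.
move=> sH /finite_fsetP[F FE]; have [H1 HM HV] := sH.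
have vG := crossed_product_vN vQ aQ (@subgroupT G).
have shG k : W [set: G] (sh k) by exact: crossed_shift.
split=> //.
(* [rho D] represents the coset [D] of the orbit; outside [F] its value is arbitrary. *)
have /choice[rho hrho] (D : set G) : exists h, D \in F ->
    H h /\ left_coset h (left_coset g H) = D.
  have [DF|nDF] := boolP (D \in F); last by exists 1%g.
  have : [set` F] D by [].
  by rewrite -FE => -[h Hh <-]; exists h.
exists (size F), (fun i => sh (rho (nth set0 F i) * g)%g); split=> // b Wb.
have WGb : W [set: G] b by exact: crossed_product_sub Wb.
have /choice[c hc] (D : set G) : exists c, W H c /\ forall xi x, (c xi : l2 G E0) x =
    (b (sh g (mask (right_coset H x) xi)) : l2 G E0) (rho D * g * x)%g.
  have WT : W [set: G] (sh (rho D * g)^-1%g \o b \o sh g).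
    by apply: (vN_comp vG) => //; exact: (vN_comp vG).
  have [c Wc hc] := pinch_crossed sH WT; exists c; split=> // xi x.
  by rewrite hc /= invgK.
exists (fun i => c (nth set0 F i)); split=> [i|]; first by have [] := hc (nth set0 F i).
apply: operator_eq.
- exact: (vN_bounded vG (vN_comp vG WGb (shG g))).
- apply: (vN_bounded vG); apply: (vN_sum vG) => i _; apply: (vN_comp vG) => //.
  exact: (crossed_product_sub (@subsetT _ H) (proj1 (hc _))).
move=> x z v; rewrite fct_sumE l2_sum.
have shE (D : set G) : ((sh (rho D * g)%g \o c D) (single z v) : l2 G E0) x =
    if `[< H (z * x^-1 * (rho D * g))%g >] then (b (sh g (single z v)) : l2 G E0) x else 0.
  have [_ hcD] := hc D.
  change ((c D (single z v) : l2 G E0) ((rho D * g)^-1 * x)%g =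
    if `[< H (z * x^-1 * (rho D * g))%g >] then (b (sh g (single z v)) : l2 G E0) x else 0).
  rewrite hcD mulVKg; case: asboolP => h.
    by rewrite mask_single// /right_coset /= invgM invgK mulgA.
  rewrite mask_single0; last by rewrite /right_coset /= invgM invgK mulgA.
  rewrite (lin0 (bounded_linear (@shift_bounded R G E0 g))).
  by rewrite (lin0 (bounded_linear (vN_bounded vG WGb))).
rewrite -(big_mkord xpredT (fun i => ((sh (rho (nth set0 F i) * g)%g \o c (nth set0 F i))
  (single z v) : l2 G E0) x)).
rewrite -(big_nth set0 xpredT (fun D => ((sh (rho D * g)%g \o c D) (single z v) : l2 G E0) x)).
under eq_bigr do rewrite shE.
(* The entry of [b \o sh g] at [(x, z)] vanishes unless [x = h * g * z] with [h] in [H]; then the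
   coset of [h * g] is the only one that contributes, and it contributes the whole entry. *)
have [Hh|nHh] := pselect (H (x * (g * z)^-1)%g); last first.
  have b0 : (b (sh g (single z v)) : l2 G E0) x = 0.
    by rewrite shift_single; exact: (crossed_product_support vQ aQ v sH Wb nHh).
  rewrite /= b0 big1// => D _; exact: if_same.
set h := (x * (g * z)^-1)%g in Hh.
have xE : x = (h * g * z)%g by rewrite /h -mulgA mulgVK.
pose D0 := left_coset h (left_coset g H).
have D0F : D0 \in F.
  suff : [set` F] D0 by [].
  by rewrite -FE; exists h.
have D0P D : D \in F -> H (z * x^-1 * (rho D * g))%g <-> D = D0.
  move=> DF; have [Hr DE] := hrho _ DF.
  have e : (z * x^-1 * (rho D * g) = (h * g)^-1 * (rho D * g))%g.
    by rewrite xE [((h * g * z)^-1)%g]invgM mulVKg.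
  rewrite e; split=> [Hk|D0E].
    have rE : (rho D * g = h * g * ((h * g)^-1 * (rho D * g)))%g by rewrite mulVKg.
    move: ((h * g)^-1 * (rho D * g))%g Hk rE => k Hk rE.
    rewrite -DE /D0; apply/seteqP; split=> w [_ [l Hl <-] <-].
      exists (g * (k * l))%g; first by exists (k * l)%g => //; exact: HM.
      by rewrite !mulgA rE.
    exists (g * (k^-1 * l))%g; first by exists (k^-1 * l)%g => //; apply: HM => //; exact: HV.
    by rewrite !mulgA rE mulgK.
  have : left_coset (rho D) (left_coset g H) (rho D * g)%g.
    by exists (g * 1)%g; [exists 1%g|rewrite mulg1].
  by rewrite DE {1}D0E => -[_ [l Hl <-] <-]; rewrite [(h * (g * l))%g]mulgA mulKg.
rewrite /= (big_fsetD1 D0)//= asboolT ?big1_fset ?addr0//; last exact/D0P.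
move=> D; rewrite !inE => /andP[DD0 DF] _.
by rewrite asboolF// => /(D0P _ DF) DE; move: DD0; rewrite DE eqxx.
Qed.

Lemma crossed_sub_quasi_normalizer H K : is_subgroup H -> K `<=` group_normalizer H ->
  group_algebra R K `<=`
    vN_generated (one_sided_quasi_normalizer (W [set: G]) (W H)).
Proof.
move=> sH KH T hT M [vM SM]; apply: hT; split=> // _ [k Kk <-].
by apply: SM; apply: quasi_normalizer_shift => //; exact: KH.
Qed.

Lemma condition_SS_quasi_normalizer H K : is_subgroup H -> is_subgroup K ->
  K `<=` group_normalizer H ->
  (group_algebra R K = vN_generated (one_sided_quasi_normalizer
      (group_algebra R [set: G]) (group_algebra R H)) <-> condition_SS H K).
Proof.
move=> sH sK KH; split=> [e g nKg fin|SS].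
  (* A finite orbit off [K] would put [sh g] into [L(K)], although its entry at [(g, 1)] is not
     zero. *)
  have : vN_generated (one_sided_quasi_normalizer
      (group_algebra R [set: G]) (group_algebra R H)) (sh g).
    by apply: sub_vN_generated; rewrite !group_algebraE; exact: quasi_normalizer_finite_orbit.
  rewrite -e group_algebraE => Wg.
  have nKg1 : ~ K (g * 1^-1)%g by rewrite invg1 mulg1.
  have := crossed_product_support vQ aQ one sK Wg nKg1.
  by rewrite shift_single mulg1 singleE => /eqP; rewrite oner_eq0.
rewrite !(group_algebraE _ [set: G], group_algebraE _ H); apply/seteqP; split.
  exact: crossed_sub_quasi_normalizer.
apply: vN_generated_sub; rewrite group_algebraE; first exact: (crossed_product_vN vQ aQ sK).
exact: quasi_normalizer_sub.
Qed.
End GroupAlgebra.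

Theorem theorem2p7 (R : realType) (G : groupType) (H K : set G) :
  countable [set: G] ->
  is_subgroup H -> is_subgroup K -> H `<=` K ->
  infinite_set H -> infinite_set K ->
  K = group_normalizer H ->
  (group_algebra R K =
     vN_generated (one_sided_quasi_normalizer
       (group_algebra R [set: G]) (group_algebra R H))
   <-> condition_SS H K)
  /\
  (condition_SS H K ->
     vN_generated (normalizer (group_algebra R [set: G]) (group_algebra R H))
       = group_algebra R K
     /\
     forall (E : hilbert R) (Q : set (E -> E)) (tau : (E -> E) -> R[i])
       (alpha : G -> (E -> E) -> E -> E),
       von_neumann Q -> finite_algebra Q -> separable_predual Q ->
       faithful_normal_trace Q tau ->
       trace_preserving_action Q tau alpha ->
       crossed_product Q alpha K =
         vN_generated (normalizer
           (crossed_product Q alpha [set: G]) (crossed_product Q alpha H))).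
Proof.
move=> _ sH sK _ _ _ KE; have KH : K `<=` group_normalizer H by rewrite -KE.
split; first exact: condition_SS_quasi_normalizer.
move=> SS; split.
  rewrite !group_algebraE.
  exact: (crossed_normalizer (scalars_von_neumann R) (scalar_faithful_normal_trace R)
    (trivial_trace_preserving_action R G)).
by move=> E Q tau alpha vQ _ _ tQ aQ; symmetry; exact: (crossed_normalizer vQ tQ aQ).
Qed.
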